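(* Let $\Omega$ be an admissible domain in a stratified group $\mathbb{G}$. Let $0<V\in C(\Omega)$ have (weak) partial derivatives of order up to $2$ in $L^1_{loc}(\Omega)$, and suppose that $\mathcal{L}V<0$ and $\mathcal{L}(V^{\sigma})\leq 0$ on $\Omega$ (a.e.) for some $\sigma>1$. Then for all $u\in C_0^\infty(\Omega)$ (complex-valued) and all $1\leq p<\infty$, $$\left\| |\mathcal{L} V|^{\frac{1}{p}}u \right\|_{L^p(\Omega)} \leq \frac{p^2}{(p-1)\sigma +1} \left\| \frac{V}{|\mathcal{L}V|^{\frac{p-1}{p}}}\mathcal{L}u \right\|_{L^p(\Omega)}.$$
   Context: A stratified (homogeneous Carnot) group is $\mathbb{G}=(\mathbb{R}^n,\circ,\delta_\lambda)$: a Lie group structure on $\mathbb{R}^n$ with neutral element $0$, where $\mathbb{R}^n=\mathbb{R}^{N}\times\mathbb{R}^{N_2}\times\cdots\times\mathbb{R}^{N_r}$, $x=(x',x^{(2)},\dots,x^{(r)})$, the dilations $\delta_\lambda(x)=(\lambda x',\lambda^2x^{(2)},\dots,\lambda^r x^{(r)})$, $\lambda>0$, are group automorphisms, and the left-invariant vector fields $X_1,\dots,X_N$ with $X_k(0)=\partial/\partial x'_k|_0$ generate the Lie algebra of $\mathbb{G}$. The Haar measure is Lebesgue measure $dx$. $\mathcal{L}=\sum_{k=1}^N X_k^2$ is the sub-Laplacian. An admissible domain is a bounded open set $\Omega\subset\mathbb{G}$ whose boundary $\partial\Omega$ is piecewise smooth and simple (no self-intersections). $C_0^\infty(\Omega)$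 denotes smooth functions with compact support in $\Omega$. Norms may take the value $+\infty$. *)

(* Defs.v *)
From HB Require Import structures.
From mathcomp Require Import all_boot all_order all_algebra.
From mathcomp Require Import all_classical all_reals all_analysis.
From mathcomp Require Export complex.
Set Implicit Arguments.
Unset Strict Implicit.
Unset Printing Implicit Defensive.
Import Order.TTheory GRing.Theory Num.Theory.
Import numFieldNormedType.Exports.

Local Open Scope classical_set_scope.
Local Open Scope ring_scope.

(** Lebesgue measure on ['rV[R]_n].  The sigma-algebra is the product one,
    generated by the coordinates; since R is second countable, it is the Borel
    sigma-algebra. *)

Definition measure_rV_display : measure_display.
Proof. exact: default_measure_display. Qed.

Section measurable_rV.
Variables (R : realType) (n : nat).

Definition rV_coor (i : 'I_n) (x : 'rV[R]_n) : measurableTypeR R := x ord0 i.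

Let rV_set0 : g_sigma_preimage rV_coor set0.
Proof. exact: sigma_algebra0. Qed.

Let rV_setC A : g_sigma_preimage rV_coor A -> g_sigma_preimage rV_coor (~` A).
Proof. exact: sigma_algebraC. Qed.

Let rV_bigcup (F : (set 'rV[R]_n)^nat) :
  (forall i, g_sigma_preimage rV_coor (F i)) ->
  g_sigma_preimage rV_coor (\bigcup_i (F i)).
Proof. exact: sigma_algebra_bigcup. Qed.

HB.instance Definition _ := @isMeasurable.Build measure_rV_display
  'rV[R]_n (g_sigma_preimage rV_coor) rV_set0 rV_setC rV_bigcup.

Lemma measurable_rV_coor (i : 'I_n) : measurable_fun [set: 'rV[R]_n] (rV_coor i).
Proof.
move=> _ Y mY; rewrite setTI; apply: sub_sigma_algebra => /=.
rewrite -bigcup_seq/=; exists i => /=; first by rewrite mem_index_enum.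
by exists Y => //; rewrite setTI.
Qed.

Lemma measurable_fun_rVP d (T : measurableType d) (f : T -> 'rV[R]_n) :
  (forall i, measurable_fun [set: T] (rV_coor i \o f)) ->
  measurable_fun [set: T] f.
Proof.
move=> mf _ A mA; rewrite setTI.
suff : measurable `<=` [set B | measurable (f @^-1` B)] by exact.
apply: smallest_sub.
  split => /=.
  - by rewrite preimage_set0.
  - by move=> B mB; rewrite setTD; exact: measurableC.
  - by move=> F mF; rewrite preimage_bigcup; exact: bigcup_measurable.
rewrite -bigcup_seq => B [i _] [C mC]; rewrite setTI => <-.
by rewrite /= -[X in measurable X]setTI; exact: mf.
Qed.

End measurable_rV.

Definition rV_cons (R : realType) (n : nat) (z : R * 'rV[R]_n) : 'rV[R]_n.+1 :=
  \row_i (if unlift ord0 i is Some j then z.2 ord0 j else z.1).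

Section lebesgue_rV.
Variable R : realType.

Lemma measurable_rV_cons n :
  measurable_fun [set: measurableTypeR R * 'rV[R]_n] (@rV_cons R n).
Proof.
apply: measurable_fun_rVP => i.
rewrite (_ : _ \o _ =
  (if unlift ord0 i is Some j then rV_coor j \o snd else fst)); last first.
  by apply/funext => z; rewrite /rV_coor /rV_cons /= mxE; case: unlift.
case: unlift => [j|]; last exact: measurable_fst.
by apply: measurableT_comp; [exact: measurable_rV_coor | exact: measurable_snd].
Qed.

Definition rV_uncons n (x : 'rV[R]_n.+1) : measurableTypeR R * 'rV[R]_n :=
  (x ord0 ord0, \row_j x ord0 (lift ord0 j)).

Lemma rV_unconsK n : cancel (@rV_uncons n) (@rV_cons R n).
Proof.
move=> x; apply/rowP => i; rewrite !mxE.
by case: unliftP => [j ->|->] /=; rewrite ?mxE.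
Qed.

Lemma rV_consK n : cancel (@rV_cons R n) (@rV_uncons n).
Proof.
move=> [a y]; rewrite /rV_uncons mxE unlift_none /=; congr pair.
by apply/rowP => j; rewrite !mxE liftK.
Qed.

Lemma measurable_rV_uncons n : measurable_fun setT (@rV_uncons n).
Proof.
apply/measurable_fun_pairP; split.
  exact: (measurable_rV_coor ord0).
apply: measurable_fun_rVP => i.
rewrite (_ : _ \o _ = rV_coor (lift ord0 i)); first exact: measurable_rV_coor.
by apply/funext => z; rewrite /rV_coor /rV_uncons /= mxE.
Qed.

Section step.
Variables (n : nat) (m : {sigma_finite_measure set 'rV[R]_n -> \bar R}).

Definition lebesgue_rV_step : set 'rV[R]_n.+1 -> \bar R :=
  pushforward ((@lebesgue_measure R) \x m)%E (@rV_cons R n).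

Let step0 : lebesgue_rV_step set0 = 0%E.
Proof. by rewrite /lebesgue_rV_step /pushforward preimage_set0 measure0. Qed.

Let step_ge0 A : (0 <= lebesgue_rV_step A)%E.
Proof. by rewrite /lebesgue_rV_step /pushforward; exact: measure_ge0. Qed.

Let step_sigma_additive : semi_sigma_additive lebesgue_rV_step.
Proof.
move=> F mF tF mUF; rewrite /lebesgue_rV_step /pushforward preimage_bigcup.
apply: measure_semi_sigma_additive.
- by move=> k; rewrite -[X in measurable X]setTI; exact: measurable_rV_cons.
- by apply/trivIsetP => /= i j _ _ ij; rewrite -preimage_setI;
    move/trivIsetP : tF => /(_ i j) -> //; rewrite preimage_set0.
- by rewrite -preimage_bigcup -[X in measurable X]setTI;
    exact: measurable_rV_cons.
Qed.

HB.instance Definition _ := isMeasure.Build _ _ _ lebesgue_rV_step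
  step0 step_ge0 step_sigma_additive.

Let step_sigma_finite : sigma_finite setT lebesgue_rV_step.
Proof.
have /sigma_finiteP[F [TF ndF Foo]] := sigma_finiteT (@lebesgue_measure R).
have /sigma_finiteP[G [TG ndG Goo]] := sigma_finiteT m.
exists (fun k => @rV_uncons n @^-1` (F k `*` G k)).
  rewrite -preimage_bigcup -(preimage_setT (@rV_uncons n)); congr preimage.
  rewrite -setXTT TF TG predeqE => -[x y]; split.
    move=> [/= [i _ Fix] [j _ Gjy]]; exists (maxn i j) => //; split.
    - by move: x Fix; exact/subsetPset/ndF/leq_maxl.
    - by move: y Gjy; exact/subsetPset/ndG/leq_maxr.
  by move=> [i _ [/= ? ?]]; split; exists i.
move=> k; have [mF ?] := Foo k; have [mG ?] := Goo k; split.
  rewrite -[X in measurable X]setTI; apply: measurable_rV_uncons => //.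
  exact: measurableX.
rewrite /lebesgue_rV_step /pushforward -comp_preimage.
rewrite (_ : _ \o _ = id); last by apply/funext => z /=; exact: rV_consK.
by rewrite product_measure1E// lte_mul_pinfty// ge0_fin_numE.
Qed.

HB.instance Definition _ := Measure_isSigmaFinite.Build _ _ _ lebesgue_rV_step
  step_sigma_finite.

End step.

Fixpoint lebesgue_rV n : {sigma_finite_measure set 'rV[R]_n -> \bar R} :=
  match n with
  | 0 => @dirac _ _ (0 : 'rV[R]_0) R
  | n'.+1 => lebesgue_rV_step (lebesgue_rV n')
  end.

End lebesgue_rV.

(** C^k and smooth maps on an open set, through iterated directional
    derivatives; in finite dimension this is the usual notion. *)
Section smooth.
Variables (R : realType) (E F : normedModType R).

Fixpoint Ck (k : nat) (U : set E) (f : E -> F) : Prop :=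
  (forall x, U x -> {for x, continuous f}) /\
  match k with
  | 0 => True
  | k'.+1 => forall v, (forall x, U x -> derivable f x v) /\
                       Ck k' U (fun x => 'D_v f x)
  end.

Definition smooth_on (U : set E) (f : E -> F) : Prop := forall k, Ck k U f.

End smooth.

Section stratified_group.
Variable R : realType.

(** Vector fields on [R^n], identified with their coefficient vectors:
    [Z] acts on functions by [Z f x = 'D_(Z x) f x]. *)
Definition vfield n := 'rV[R]_n -> 'rV[R]_n.

Definition vbracket n (Y Z : vfield n) : vfield n :=
  fun x => 'D_(Y x) Z x - 'D_(Z x) Y x.

Inductive lie_generated n (S : set (vfield n)) : vfield n -> Prop :=
| lie_gen_base Z : S Z -> lie_generated S Z
| lie_gen_zero : lie_generated S (fun=> 0)
| lie_gen_linear a Y Z : lie_generated S Y -> lie_generated S Z ->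
    lie_generated S (fun x => a *: Y x + Z x)
| lie_gen_bracket Y Z : lie_generated S Y -> lie_generated S Z ->
    lie_generated S (vbracket Y Z).

Definition left_invariant n (op : 'rV[R]_n -> 'rV[R]_n -> 'rV[R]_n)
    (Z : vfield n) : Prop :=
  forall x y, Z (op x y) = 'D_(Z y) (op x) y.

(** The left-invariant vector field equal to the k-th basis vector at 0. *)
Definition left_basis_field n (op : 'rV[R]_n -> 'rV[R]_n -> 'rV[R]_n)
    (k : 'I_n) : vfield n :=
  fun x => 'D_(delta_mx ord0 k) (op x) 0.

(** The sequence [s = [:: N; N_2; ...; N_r]] lists the dimensions of the layers;
    coordinate [i] of [R^(N + N_2 + ... + N_r)] lies in layer
    [(reshape_index s i).+1], counting from 1. *)
Definition dilation (s : seq nat) (lambda : R) (x : 'rV[R]_(sumn s)) :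
    'rV[R]_(sumn s) :=
  \row_i (lambda ^+ (reshape_index s i).+1 * x ord0 i).

Record stratified_group (s : seq nat) := StratifiedGroup {
  sg_op : 'rV[R]_(sumn s) -> 'rV[R]_(sumn s) -> 'rV[R]_(sumn s) ;
  sg_inv : 'rV[R]_(sumn s) -> 'rV[R]_(sumn s) ;
  sg_layers : s != [::] /\ {in s, forall d, (0 < d)%N} ;
  sg_opA : associative sg_op ;
  sg_op0x : left_id 0 sg_op ;
  sg_opx0 : right_id 0 sg_op ;
  sg_opVx : left_inverse 0 sg_inv sg_op ;
  sg_opxV : right_inverse 0 sg_inv sg_op ;
  sg_op_smooth : smooth_on setT
    (fun z : 'rV[R]_(sumn s) * 'rV[R]_(sumn s) => sg_op z.1 z.2) ;
  sg_inv_smooth : smooth_on setT sg_inv ;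
  sg_dilation : forall lambda, 0 < lambda ->
    {morph @dilation s lambda : x y / sg_op x y} ;
  sg_generated : forall Z, left_invariant sg_op Z ->
    lie_generated [set left_basis_field sg_op k | k in
                    [set k : 'I_(sumn s) | (k < head 0%N s)%N]] Z
}.

End stratified_group.

Section analysis_on_group.
Variables (R : realType) (s : seq nat) (G : stratified_group R s).
Local Notation n := (sumn s).
Local Notation N := (head 0%N s).

Definition sgX (k : 'I_n) : vfield R n := left_basis_field (sg_op G) k.

Definition sublaplacian (f : 'rV[R]_n -> R) (x : 'rV[R]_n) : R :=
  \sum_(k < n | (k < N)%N)
    'D_(sgX k x) (fun y => 'D_(sgX k y) f y) x.

Definition csublaplacian (u : 'rV[R]_n -> R[i]) (x : 'rV[R]_n) : R[i] :=
  Complex (sublaplacian (fun y => complex.Re (u y)) x)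
          (sublaplacian (fun y => complex.Im (u y)) x).

End analysis_on_group.

Section function_spaces.
Variables (R : realType) (n : nat).
Implicit Types (Omega : set 'rV[R]_n) (f g V : 'rV[R]_n -> R).

Definition Cc_infty Omega (phi : 'rV[R]_n -> R) : Prop :=
  [/\ smooth_on setT phi,
      compact (closure [set x | phi x != 0]) &
      closure [set x | phi x != 0] `<=` Omega].

Definition Cc_infty_complex Omega (u : 'rV[R]_n -> R[i]) : Prop :=
  [/\ smooth_on setT (fun x => complex.Re (u x)),
      smooth_on setT (fun x => complex.Im (u x)),
      compact (closure [set x | u x != 0]) &
      closure [set x | u x != 0] `<=` Omega].

Definition L1loc Omega f : Prop :=
  forall K, compact K -> K `<=` Omega ->
    (lebesgue_rV R n).-integrable K (EFin \o f).

Definition weak_partial Omega (i : 'I_n) f g : Prop :=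
  [/\ L1loc Omega f, L1loc Omega g &
   forall phi, Cc_infty Omega phi ->
     \int[lebesgue_rV R n]_(x in Omega) (f x * 'D_(delta_mx ord0 i) phi x) =
     - \int[lebesgue_rV R n]_(x in Omega) (g x * phi x)].

Definition W21loc Omega V : Prop :=
  forall i, exists2 g, weak_partial Omega i V g &
    forall j, exists h, weak_partial Omega j g h.

(** [g] represents [Z f = \sum_j Z_j (d_j f)], where the [d_j f] are weak partial
    derivatives, hence only determined almost everywhere. *)
Definition weak_vfield Omega (Z : vfield R n) f g : Prop :=
  L1loc Omega g /\
  exists D : 'I_n -> 'rV[R]_n -> R,
    (forall j, weak_partial Omega j f (D j)) /\
    {ae lebesgue_rV R n, forall x, Omega x ->
      g x = \sum_(j < n) Z x ord0 j * D j x}.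

Definition Lp_norm Omega (p : R) (F : 'rV[R]_n -> R[i]) : \bar R :=
  'N[lebesgue_rV R n]_p%:E[(fun x => (ComplexField.Normc.normc (F x))%:E) \_ Omega].

End function_spaces.

(** [h] represents [L f = \sum_k X_k (X_k f)] almost everywhere; as [X_k] is
    applied to [X_k f], no coefficient has to be expanded. *)
Definition weak_sublaplacian (R : realType) (s : seq nat)
    (G : stratified_group R s) (Omega : set 'rV[R]_(sumn s))
    (f h : 'rV[R]_(sumn s) -> R) : Prop :=
  L1loc Omega h /\
  exists Xf XXf : 'I_(sumn s) -> 'rV[R]_(sumn s) -> R,
    (forall k : 'I_(sumn s), (k < head 0 s)%N ->
      weak_vfield Omega (sgX G k) f (Xf k) /\
      weak_vfield Omega (sgX G k) (Xf k) (XXf k)) /\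
    {ae lebesgue_rV R (sumn s), forall x, Omega x ->
      h x = \sum_(k < sumn s | (k < head 0 s)%N) XXf k x}.

Section admissible.
Variables (R : realType) (n : nat).
Implicit Type Omega : set 'rV[R]_n.

Definition boundary (A : set 'rV[R]_n) : set 'rV[R]_n := closure A `\` interior A.

Definition closed_cube m : set 'rV[R]_m :=
  [set t | forall i, 0 <= t ord0 i <= 1].

Definition open_cube m : set 'rV[R]_m :=
  [set t | forall i, 0 < t ord0 i < 1].

(** A smooth parametrized patch of dimension n-1: smooth up to the faces of the
    cube, injective and immersive inside the cube.  Degeneracies on the faces
    are allowed, as for polar coordinates at the vertex of a cone. *)
Definition smooth_patch (gamma : 'rV[R]_n.-1 -> 'rV[R]_n) : Prop :=
  [/\ exists2 U, open U & closed_cube (m := n.-1) `<=` U /\ smooth_on U gamma,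
      {in open_cube (m := n.-1) &, injective gamma} &
      forall t, open_cube t -> forall v, 'D_v gamma t = 0 -> v = 0].

Definition piecewise_smooth (S : set 'rV[R]_n) : Prop :=
  exists (m : nat) (gamma : 'I_m -> 'rV[R]_n.-1 -> 'rV[R]_n),
    (forall j, smooth_patch (gamma j)) /\
    S = \bigcup_(j in setT) (gamma j @` closed_cube (m := n.-1)).

(** No self-intersection: [S] is a topological manifold of dimension n-1, every
    point having a neighborhood in [S] homeomorphic (by [chart], with inverse
    [param]) to [R^(n-1)]. *)
Definition simple_hypersurface (S : set 'rV[R]_n) : Prop :=
  forall x, S x -> exists (U : set 'rV[R]_n)
      (chart : 'rV[R]_n -> 'rV[R]_n.-1) (param : 'rV[R]_n.-1 -> 'rV[R]_n),
    [/\ open U /\ U x,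
        {within S `&` U, continuous chart}, continuous param,
        forall t, (S `&` U) (param t) /\ chart (param t) = t &
        forall y, (S `&` U) y -> param (chart y) = y].

Definition admissible_domain Omega : Prop :=
  [/\ open Omega, bounded_set Omega,
      piecewise_smooth (boundary Omega) &
      simple_hypersurface (boundary Omega)].

End admissible.

(* Main.v *)
(** The proof avoids differentiating [V].  Tested against nonnegative functions,
    [V `^ sigma] is superharmonic.  Averaging it over left translates gives smooth
    superharmonic functions [m] converging to it locally uniformly, and with
    [a = 1 / sigma] and [v = m `^ a] an integration by parts of
    [\int m * L (m `^ (a - 1) * Phi) <= 0], AM-GM and a passage to the limit give
    [- \int V * L phi <= 1/2 * (- \int V * L Phi) + (2 (sigma - 1))^-1 * \int V * theta]
    whenever [|grad phi|^2 <= Phi * theta].  This is applied with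
    [phi = (|u|^2 + t) `^ (p/2) - t `^ (p/2)], [Phi] equal to [(|u|^2 + t) `^ (p/2)]
    on the support of [u], and [theta = |grad phi|^2 / Phi].  Combined with
    [L phi >= - p (|u|^2 + t) `^ ((p - 1) / 2) |L u| + (p - 1) / p * theta], it yields
    [\int |L V| phi <= p^2 / ((p - 1) sigma + 1) *
    \int V (|u|^2 + t) `^ ((p - 1) / 2) |L u|] up to an error [O(t `^ (p/2))];
    Young's inequality and [t -> 0] conclude.

    Integration by parts and averaging need that translations preserve Lebesgue
    measure: by homogeneity, the group law and the inverse are triangular in the
    coordinates with diagonal entries 1 and -1. *)

Require Import Defs.
From mathcomp Require Import all_boot all_order all_algebra.
From mathcomp Require Import all_classical all_reals all_analysis.
From mathcomp Require Import measurable_realfun ring lra.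
Set Implicit Arguments.
Unset Strict Implicit.
Unset Printing Implicit Defensive.
Import Order.TTheory GRing.Theory Num.Theory.
Import numFieldNormedType.Exports.
Local Open Scope classical_set_scope.
Local Open Scope ring_scope.

(** * Borel and Lebesgue measure on row vectors *)

Section borel.
Variable R : realType.

(** The constant results from two competing inequalities. Without regularization, let A be the
    integral of |L V| |u|^p, T that of V theta, and J that of V |u|^(p-1) |L u|. The Hardy step with
    Phi = phi reads A <= A/2 + T / (2 (sigma - 1)), that is, (sigma - 1) A <= T. The lower bound for
    L phi reads A <= p J - ((p - 1) / p) T. Eliminating T leaves A (1 + (p - 1)(sigma - 1) / p) <= p
    J, and the bracket equals ((p - 1) sigma + 1) / p. The function averaged is V^sigma rather than
    V: an average of superharmonic functions is superharmonic, but taking powers does not commute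
    with averaging. With m close to V^sigma, the function m^(1/sigma) is close to V and its sigma-th
    power is still superharmonic. Translates are taken on the left because L is built from
    left-invariant fields. The parameter t keeps the powers of |u|^2 + t smooth at the zeros of u,
    where |u|^p may fail to be twice differentiable. *)

Lemma dense_balls_open_measurable d (T : measurableType d)
    (X : pseudoMetricType R) (C : countType) (q : C -> X)
    (f : T -> X) :
  (forall (x : X) (e : R), 0 < e -> exists c, ball x e (q c)) ->
  (forall x (e : R), 0 < e -> measurable (f @^-1` ball x e)) ->
  forall U, open U -> measurable (f @^-1` U).
Proof.
move=> dq mb U oU.
(* Only the countably many balls with centre [q c] and radius 1/(k+1) are used; [U] is the union of
   those it contains. *)
pose F (ck : C * nat) : set T :=
  if pselect (ball (q ck.1) (ck.2.+1%:R^-1 : R) `<=` U)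
  then f @^-1` ball (q ck.1) (ck.2.+1%:R^-1 : R) else set0.
rewrite (_ : f @^-1` U = \bigcup_ck F ck).
  apply: countable_bigcupT_measurable => //.
  by move=> ck; rewrite /F; case: pselect => ?; [apply: mb; rewrite invr_gt0 ltr0n|exact: measurable0].
apply/seteqP; split=> x; last first.
  by case=> -[c k] _; rewrite /F; case: pselect => //= sub; exact: sub.
move=> /= Ux.
have /nbhs_ballP[e /= e0 eU] := open_nbhs_nbhs (conj oU Ux).
have [k ke] : exists k : nat, k.+1%:R^-1 < e / 2.
  have e20 : 0 < e / 2 by rewrite divr_gt0.
  have [k _ /(_ _ (leqnn k)) hk] := near_infty_natSinv_lt (PosNum e20).
  by exists k.
have k0 : 0 < k.+1%:R^-1 :> R by rewrite invr_gt0 ltr0n.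
have [c xc] := dq (f x) _ k0.
exists (c, k) => //; rewrite /F /=; case: pselect => [?|nsub] /=.
  exact: ball_sym.
apply: nsub => y cy; apply: eU; rewrite (splitr e).
exact: ball_triangle (le_ball (ltW ke) xc) (le_ball (ltW ke) cy).
Qed.

Definition rat_rV n (q : 'rV[rat]_n) : 'rV[R]_n := map_mx ratr q.

Lemma rat_rV_dense n (x : 'rV[R]_n) (e : R) : 0 < e ->
  exists q : 'rV[rat]_n, ball x e (rat_rV q).
Proof.
move=> e0.
have dq i : exists q : rat, ball (x ord0 i) e (ratr q).
  have /rat_in_itvoo[q] : x ord0 i - e < x ord0 i + e by rewrite ltrD2l gtrN.
  rewrite in_itv/= => /andP[h1 h2]; exists q.
  by rewrite -ball_normE /ball_/= ltr_distlC h1 h2.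
have [q hq] := choice dq.
exists (\row_i q i); split => // i j; rewrite !mxE (ord1 i); exact: hq.
Qed.

Lemma measurable_rV_ball n (x : 'rV[R]_n) e : measurable (ball x e).
Proof.
have [e0|e0] := ltP 0 e; last first.
  rewrite (_ : ball x e = set0) //; apply/seteqP; split=> // y [e0' _].
  by move: e0; rewrite leNgt e0'.
rewrite (_ : ball x e = \big[setI/setT]_(i < n)
    (@rV_coor R n i @^-1` ball (x ord0 i) e)); last first.
  rewrite -bigcap_seq; apply/seteqP; split=> y.
    by move=> [_ h] i _ /=; exact: h.
  move=> h; split => // i j; rewrite (ord1 i); apply: (h j) => /=.
  exact: mem_index_enum.
apply: bigsetI_measurable => i _; rewrite -[X in measurable X]setTI.
by apply: measurable_rV_coor => //; rewrite ball_itv; exact: measurable_itv.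
Qed.

Lemma open_measurable_rV n (U : set 'rV[R]_n) : open U -> measurable U.
Proof.
move=> oU.
rewrite -[U]preimage_id.
apply: (dense_balls_open_measurable (q := @rat_rV n)) => //.
  exact: rat_rV_dense.
by move=> x e _; exact: measurable_rV_ball.
Qed.

Lemma open_measurable_rV2 n m (U : set ('rV[R]_n * 'rV[R]_m)) :
  open U -> measurable U.
Proof.
move=> oU.
rewrite -[U]preimage_id.
apply: (dense_balls_open_measurable (q := fun q : 'rV[rat]_n * 'rV[rat]_m =>
   (rat_rV q.1, rat_rV q.2))) => //.
  move=> [x y] e e0.
  have [p hp] := rat_rV_dense x e0; have [q hq] := rat_rV_dense y e0.
  by exists (p, q); split.
move=> [x y] e _; rewrite preimage_id.
rewrite (_ : ball _ _ = ball x e `*` ball y e); last first.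
  by apply/seteqP; split=> [[a b] []|[a b] []].
by apply: measurableX; exact: measurable_rV_ball.
Qed.

Lemma closed_measurable_rV n (K : set 'rV[R]_n) : closed K -> measurable K.
Proof.
by move=> cK; rewrite -(setCK K); apply: measurableC; apply: open_measurable_rV;
  exact: closed_openC.
Qed.

Lemma compact_measurable_rV n (K : set 'rV[R]_n) : compact K -> measurable K.
Proof. by move=> cK; apply: closed_measurable_rV; exact: compact_closed. Qed.

Lemma continuous_measurable_rV n (f : 'rV[R]_n -> R) :
  continuous f -> measurable_fun setT f.
Proof.
move=> cf; apply: (measurability _ (RGenOInfty.measurableE R)).
move=> _ [_ [a ->] <-]; rewrite setTI; apply: open_measurable_rV.
by apply: open_comp => // x _; exact: cf.
Qed.

Lemma continuous_measurable_rV2 n m (f : 'rV[R]_n * 'rV[R]_m -> R) :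
  continuous f -> measurable_fun setT f.
Proof.
move=> cf; apply: (measurability _ (RGenOInfty.measurableE R)).
move=> _ [_ [a ->] <-]; rewrite setTI; apply: open_measurable_rV2.
by apply: open_comp => // x _; exact: cf.
Qed.

Lemma continuous_measurable_rVrV n m (f : 'rV[R]_n -> 'rV[R]_m) :
  continuous f -> measurable_fun setT f.
Proof.
move=> cf; apply: measurable_fun_rVP => i.
apply: continuous_measurable_rV => x.
apply: continuous_comp; first exact: cf.
exact: coord_continuous.
Qed.

End borel.

(** * Volume of boxes and compact sets, affine changes of one variable *)

Section volume.
Variable R : realType.

Definition rV_box n (M : R) : set 'rV[R]_n := [set x | forall i, `|x ord0 i| <= M].

Lemma closed_rV_box n (M : R) : closed (@rV_box n M).
Proof.
rewrite (_ : rV_box M = \bigcap_i [set x : 'rV[R]_n | `|x ord0 i| <= M]); last first.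
  by apply/seteqP; split=> x h i => [_|]; [exact: h|exact: (h i I)].
apply: closed_bigI => i _.
rewrite (_ : [set x | _] = (fun x : 'rV[R]_n => `|x ord0 i|) @^-1` [set r | r <= M])//.
apply: closed_comp; last exact: closed_le.
by move=> x _; apply: continuous_comp; [exact: coord_continuous|exact: norm_continuous].
Qed.

Lemma compact_rV_box n (M : R) : compact (@rV_box n M).
Proof.
apply: bounded_closed_compact; last exact: closed_rV_box.
exists `|M|; split; first exact: num_real.
move=> A MA x xb /=; rewrite [leLHS]/Num.Def.normr/= mx_normrE.
apply: (@bigmax_le _ R) => [|[i j] _] /=; first exact: le_trans (ltW MA).
rewrite (ord1 i); apply: le_trans (xb j) _.
by apply: ltW; apply: le_lt_trans MA; exact: ler_norm.
Qed.

Lemma lebesgue_rV_box n (M : R) : 0 <= M ->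
  lebesgue_rV R n (@rV_box n M) = ((M *+ 2) ^+ n)%:E.
Proof.
move=> M0; elim: n => [|n IH].
  rewrite expr0 /= /dirac indicE mem_set//= => i; by case: i.
rewrite (_ : lebesgue_rV R n.+1 (rV_box M) = (lebesgue_measure \x lebesgue_rV R n)%E
  (@rV_cons R n @^-1` rV_box M))//.
rewrite (_ : _ @^-1` _ = `[-M, M] `*` @rV_box n M); last first.
  apply/seteqP; split=> [[a y] h|[a y] [/= h1 h2] i].
    split=> [|i] /=.
      have := h ord0; rewrite /= mxE unlift_none/= in_itv/= ler_norml.
      by [].
    by have := h (lift ord0 i); rewrite /= mxE liftK.
  rewrite mxE; case: unliftP => [j _|_] /=; first exact: h2.
  by move: h1; rewrite in_itv/= ler_norml.
rewrite product_measure1E//; last by apply: closed_measurable_rV; exact: closed_rV_box.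
rewrite IH [X in (X * _)%E](@lebesgue_measure_itv R `[-M, M])/= lte_fin.
case: ltP => [MM|MM].
  by rewrite opprK -EFinD -mulr2n -EFinM exprS.
have -> : M = 0 by move: MM M0; lra.
by rewrite mul0e mul0rn expr0n.
Qed.

Lemma compact_sub_rV_box n (K : set 'rV[R]_n) : compact K ->
  exists2 M : R, 0 < M & K `<=` rV_box M.
Proof.
move=> /compact_bounded[M [_ hM]].
exists (Num.max (M + 1) 1); first by rewrite lt_max ltr01 orbT.
move=> x Kx i.
have h : `|x| <= Num.max (M + 1) 1.
  by apply: hM => //; rewrite lt_max ltrDl ltr01.
by apply: le_trans h; rewrite [leRHS]/Num.Def.normr/= mx_normrE;
  exact: (le_bigmax _ (fun ij => `|x ij.1 ij.2|) (ord0, i)).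
Qed.

Lemma lebesgue_rV_compact n (K : set 'rV[R]_n) : compact K ->
  (lebesgue_rV R n K < +oo)%E.
Proof.
move=> cK; have [M M0 KM] := compact_sub_rV_box cK.
apply: (@le_lt_trans _ _ (lebesgue_rV R n (rV_box M))).
  apply: le_measure => //; rewrite inE.
    exact: compact_measurable_rV.
  by apply: closed_measurable_rV; exact: closed_rV_box.
by rewrite lebesgue_rV_box ?ltW// ltry.
Qed.

(* [F x] differs from [e *: x] in coordinate [j] by a function of the earlier
   coordinates only, so [F] preserves Lebesgue measure when [e = 1] or [e = -1]. *)
Definition triangular n (e : R) (F : 'rV[R]_n -> 'rV[R]_n) :=
  forall (j : 'I_n) (x y : 'rV[R]_n),
    (forall i : 'I_n, (i < j)%N -> x ord0 i = y ord0 i) ->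
    F x ord0 j - e * x ord0 j = F y ord0 j - e * y ord0 j.

(** By uniqueness of Lebesgue measure it suffices to compare lengths of preimages of half-open
    intervals. For [e = -1] the preimage is half-open on the other side. *)
Lemma integral_reflection_shift (e c : R) (h : R -> \bar R) : e = 1 \/ e = -1 ->
  measurable_fun setT h -> (forall x, (0 <= h x)%E) ->
  (\int[lebesgue_measure]_z h (e * z + c)%R = \int[lebesgue_measure]_z h z)%E.
Proof.
move=> e1 mh h0.
pose phi : measurableTypeR R -> measurableTypeR R := fun z => e * z + c.
have mphi : measurable_fun setT phi.
  apply: measurable_funD => //; apply: measurable_funM => //.
have := @ge0_integral_pushforward _ _ _ _ R phi mphi
  (@lebesgue_measure R) setT h measurableT mh (fun y _ => h0 y).
rewrite preimage_setT => <-.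
apply: eq_measure_integral => A mA _.
apply/esym/lebesgue_measure_unique => // _ [[a b]] _ <-.
rewrite /= /pushforward.
case: e1 => e1.
  rewrite (_ : phi @^-1` _ = `]a - c, b - c]%classic).
    rewrite !lebesgue_measure_itv/= !lte_fin ltrD2r.
    by case: ifP => // _; rewrite -!EFinB; congr (_ %:E); ring.
  by apply/seteqP; split=> z; rewrite /phi /= e1 !in_itv/= => /andP[h1 h2];
    apply/andP; split; lra.
rewrite (_ : phi @^-1` _ = `[c - b, c - a[%classic).
  rewrite !lebesgue_measure_itv/= !lte_fin ltrD2l ltrN2.
  by case: ifP => // _; rewrite -!EFinB; congr (_ %:E); ring.
by apply/seteqP; split=> z; rewrite /phi /= e1 !in_itv/= => /andP[h1 h2];
  apply/andP; split; lra.
Qed.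

End volume.

(** * Invariance of Lebesgue measure under triangular maps *)

Section triangular.
Variable R : realType.

(** Induction on the dimension by slicing along the first coordinate. That coordinate undergoes
    [z -> e * z + c], and for fixed [z] the remaining coordinates again undergo a triangular map, so
    each slice keeps its measure. *)
Lemma triangular_measure n (e : R) (F : 'rV[R]_n -> 'rV[R]_n) :
  e = 1 \/ e = -1 -> measurable_fun setT F -> triangular e F ->
  forall A, measurable A -> lebesgue_rV R n (F @^-1` A) = lebesgue_rV R n A.
Proof.
move=> e1; elim: n F => [|n IH] F mF tF A mA.
  by congr (lebesgue_rV R 0 _); apply/seteqP; split=> x /=;
    rewrite (_ : F x = x)//; apply/rowP => -[].
pose c := F 0 ord0 ord0.
(* The first coordinate has no predecessors, so the triangularity condition is vacuous there and any
   point may be compared with 0. *)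
have tri0 z : F z ord0 ord0 = e * z ord0 ord0 + c.
  by have := tF ord0 z 0 (fun i h => False_ind _ (elimF idP (ltn0 i) h));
    rewrite mxE mulr0 subr0 -/c => <-; ring.
pose G (z : R) (y : 'rV[R]_n) : 'rV[R]_n :=
  \row_j F (rV_cons (z, y)) ord0 (lift ord0 j).
have FG z y : F (rV_cons (z, y)) = rV_cons (e * z + c, G z y).
  apply/rowP => i; rewrite mxE; case: unliftP => [j ->|->] /=; first by rewrite mxE.
  by rewrite tri0 mxE unlift_none.
have mcons (z : R) : measurable_fun setT (fun y : 'rV[R]_n => rV_cons (z, y)).
  apply: measurableT_comp; first exact: measurable_rV_cons.
  exact: measurable_pair1.
have mG z : measurable_fun setT (G z).
  apply: measurable_fun_rVP => i.
  rewrite (_ : _ \o _ = @rV_coor R n.+1 (lift ord0 i) \o (F \o (fun y => rV_cons (z, y)))); last first.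
    by apply/funext => y; rewrite /rV_coor /G /= mxE.
  apply: measurableT_comp; first exact: measurable_rV_coor.
  by apply: measurableT_comp.
have tG z : triangular e (G z).
  move=> j x y xy; rewrite !mxE.
  have := tF (lift ord0 j) (rV_cons (z, x)) (rV_cons (z, y)); rewrite !mxE !liftK; apply.
  move=> i; rewrite !mxE; case: unliftP => [k ->|//] /= h; apply: xy.
  by move: h; rewrite /bump /= !add1n ltnS.
pose B := @rV_cons R n @^-1` A.
have mB : measurable B.
  by rewrite -[B]setTI; apply: measurable_rV_cons.
rewrite (_ : lebesgue_rV R n.+1 A = (lebesgue_measure \x lebesgue_rV R n)%E B)//.
rewrite (_ : lebesgue_rV R n.+1 _ = (lebesgue_measure \x lebesgue_rV R n)%E
  (@rV_cons R n @^-1` (F @^-1` A)))//.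
rewrite /product_measure1.
transitivity (\int[lebesgue_measure]_z
  ((lebesgue_rV R n \o xsection B) (e * z + c)%R))%E.
  apply: eq_integral => z _ /=.
  rewrite -(IH _ (mG z) (tG z) (xsection B (e * z + c))); last exact: measurable_xsection.
  congr (lebesgue_rV R n _); apply/seteqP; split=> y; rewrite /xsection /= !inE /B /=.
    by rewrite FG.
  by rewrite FG.
apply: integral_reflection_shift => //.
exact: measurable_fun_xsection.
Qed.

Lemma triangular_ge0_integral n (e : R) (F : 'rV[R]_n -> 'rV[R]_n) (f : 'rV[R]_n -> \bar R) :
  e = 1 \/ e = -1 -> measurable_fun setT F -> triangular e F ->
  measurable_fun setT f -> (forall x, 0 <= f x)%E ->
  (\int[lebesgue_rV R n]_x f (F x) = \int[lebesgue_rV R n]_x f x)%E.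
Proof.
move=> e1 mF tF mf f0.
have := @ge0_integral_pushforward _ _ _ _ R F mF
  (lebesgue_rV R n) setT f measurableT mf (fun y _ => f0 y).
rewrite preimage_setT => <-.
apply: eq_measure_integral => A mA _.
exact: (triangular_measure e1 mF tF mA).
Qed.

Lemma triangular_integrable n (e : R) (F : 'rV[R]_n -> 'rV[R]_n) (f : 'rV[R]_n -> R) :
  e = 1 \/ e = -1 -> measurable_fun setT F -> triangular e F ->
  (lebesgue_rV R n).-integrable setT (EFin \o f) ->
  (lebesgue_rV R n).-integrable setT (EFin \o (f \o F)).
Proof.
move=> e1 mF tF /integrableP[mf fi]; apply/integrableP; split.
  exact: (measurableT_comp mf mF).
rewrite (triangular_ge0_integral (f := fun x => `|(f x)%:E|%E) e1 mF tF)//.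
exact: measurableT_comp.
Qed.

Lemma triangular_Rintegral n (e : R) (F : 'rV[R]_n -> 'rV[R]_n) (f : 'rV[R]_n -> R) :
  e = 1 \/ e = -1 -> measurable_fun setT F -> triangular e F ->
  measurable_fun setT f ->
  \int[lebesgue_rV R n]_x f (F x) = \int[lebesgue_rV R n]_x f x.
Proof.
move=> e1 mF tF mf; rewrite /Rintegral; congr fine.
have mfE : measurable_fun setT (EFin \o f) by exact/measurable_EFinP.
rewrite integralE [RHS]integralE; congr (_ - _)%E.
  rewrite -(triangular_ge0_integral e1 mF tF (f := (EFin \o f)^\+%E))//.
    by apply: eq_integral => x _; rewrite !funeposE.
  exact: measurable_funepos.
rewrite -(triangular_ge0_integral e1 mF tF (f := (EFin \o f)^\-%E))//.
  by apply: eq_integral => x _; rewrite !funenegE.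
exact: measurable_funeneg.
Qed.

End triangular.

(** * Calculus of C^k functions *)

Section Ck_calculus.
Variables (R : realType) (E : normedModType R).
Implicit Types (f g : E -> R) (x v w : E) (k : nat).

Lemma Ck_continuous (F : normedModType R) k (f : E -> F) : Ck k setT f -> continuous f.
Proof. by case: k => [|k] [cf _] x; exact: cf. Qed.

Lemma Ck_derivable (F : normedModType R) k (f : E -> F) v x :
  Ck k.+1 setT f -> derivable f x v.
Proof. by move=> [_ /(_ v)[df _]]; exact: df. Qed.

Lemma Ck_derive (F : normedModType R) k (f : E -> F) v :
  Ck k.+1 setT f -> Ck k setT ('D_v f).
Proof. by move=> [_ /(_ v)[]]. Qed.

Lemma CkS (F : normedModType R) k (f : E -> F) :
  continuous f -> (forall v x, derivable f x v) ->
  (forall v, Ck k setT ('D_v f)) -> Ck k.+1 setT f.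
Proof. by move=> cf df ddf; split=> [x _|v]; [exact: cf|split=> [x _|]]. Qed.

Lemma Ck_pred (F : normedModType R) k (f : E -> F) : Ck k.+1 setT f -> Ck k setT f.
Proof.
elim: k f => [|k IH] f Cf; first by split => // x _; exact: (Ck_continuous Cf).
apply: CkS => [|v x|v].
- exact: Ck_continuous Cf.
- exact: Ck_derivable Cf.
- by apply: IH; exact: Ck_derive.
Qed.

Lemma Ck_cst (F : normedModType R) k (a : F) : Ck k setT (fun _ : E => a).
Proof.
elim: k a => [|k IH] a; first by split => // x _; exact: cvg_cst.
apply: CkS => [x|v x|v]; [exact: cvg_cst|exact: derivable_cst|].
by rewrite (_ : 'D_v _ = fun=> 0); [exact: IH|apply/funext => x; exact: derive_cst].
Qed.

Lemma CkD (F : normedModType R) k (f g : E -> F) : Ck k setT f -> Ck k setT g ->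
  Ck k setT (fun x => f x + g x).
Proof.
elim: k f g => [|k IH] f g Cf Cg.
  by split=> // x _; apply: cvgD; [exact: (Ck_continuous Cf)|exact: (Ck_continuous Cg)].
apply: CkS => [x|v x|v].
- by apply: cvgD; [exact: (Ck_continuous Cf)|exact: (Ck_continuous Cg)].
- apply: derivableD; [exact: (Ck_derivable Cf)|exact: (Ck_derivable Cg)].
- rewrite (_ : 'D_v _ = fun x => 'D_v f x + 'D_v g x).
    by apply: IH; exact: Ck_derive.
  apply/funext => x; apply: deriveD;
    [exact: (Ck_derivable Cf)|exact: (Ck_derivable Cg)].
Qed.

Lemma CkM k f g : Ck k setT f -> Ck k setT g -> Ck k setT (fun x => f x * g x).
Proof.
elim: k f g => [|k IH] f g Cf Cg.
  by split=> // x _; apply: cvgM; [exact: (Ck_continuous Cf)|exact: (Ck_continuous Cg)].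
apply: CkS => [x|v x|v].
- by apply: cvgM; [exact: (Ck_continuous Cf)|exact: (Ck_continuous Cg)].
- by apply: derivableM; [exact: (Ck_derivable Cf)|exact: (Ck_derivable Cg)].
- rewrite (_ : 'D_v _ = fun x => f x * 'D_v g x + g x * 'D_v f x).
    by apply: CkD; apply: IH; [exact: Ck_pred|exact: Ck_derive|exact: Ck_pred|exact: Ck_derive].
  apply/funext => x; apply: deriveM;
    [exact: (Ck_derivable Cf)|exact: (Ck_derivable Cg)].
Qed.

Lemma Ck_sum k (I : Type) (r : seq I) (P : pred I) (f : I -> E -> R) :
  (forall i, P i -> Ck k setT (f i)) -> Ck k setT (fun x => \sum_(i <- r | P i) f i x).
Proof.
move=> Cf; elim: r => [|i r IH].
  rewrite (_ : (fun _ => _) = fun=> 0); first exact: Ck_cst.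
  by apply/funext => x; rewrite big_nil.
rewrite (_ : (fun _ => _) = fun x => (if P i then f i x else 0) +
    \sum_(i <- r | P i) f i x).
  apply: CkD => //; case Pi: (P i); [exact: Cf|exact: Ck_cst].
by apply/funext => x; rewrite big_cons; case: ifP => _ //; rewrite add0r.
Qed.

(** Restriction to a line turns ['D_v] into a one-variable derivative, to which the mean value
    theorem and the one-variable chain rule apply. *)
Lemma line_is_derive f x v (t : R) : derivable f (t *: v + x) v ->
  is_derive t 1 (fun s : R => f (s *: v + x)) ('D_v f (t *: v + x)).
Proof.
move=> df.
have e : (fun h : R => h^-1 *: (((fun s : R => f (s *: v + x)) \o shift t) (h *: 1)
    - f (t *: v + x))) = fun h : R => h^-1 *: ((f \o shift (t *: v + x)) (h *: v)
    - f (t *: v + x)).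
  by apply/funext => h /=; rewrite [h *: 1]mulr1 scalerDl addrA.
have df2 : derivable (fun s : R => f (s *: v + x)) t 1 by rewrite /derivable e.
apply: (DeriveDef df2).
by rewrite /derive e.
Qed.

Lemma derive_lineE f x v : 'D_v f x = 'D_1 (fun s : R => f (s *: v + x)) 0.
Proof.
rewrite /derive; set a := (X in lim (X @ _)); set b := (X in _ = lim (X @ _)).
suff -> : a = b by [].
apply/funext => h; rewrite /a /b /=.
by rewrite [h *: 1]mulr1 addr0 scale0r add0r.
Qed.

Lemma derivable_lineE f x v :
  derivable f x v <-> derivable (fun s : R => f (s *: v + x)) 0 1.
Proof.
rewrite /derivable; set a := (X in cvg (X @ _)); set b := (X in _ <-> cvg (X @ _)).
suff -> : a = b by [].
apply/funext => h; rewrite /a /b /=.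
by rewrite [h *: 1]mulr1 addr0 scale0r add0r.
Qed.

Lemma line_MVT f x v : (forall y, derivable f y v) ->
  exists2 c : R, 0 <= c <= 1 & f (v + x) - f x = 'D_v f (c *: v + x).
Proof.
move=> df.
have dl (t : R) : is_derive t 1 (fun s : R => f (s *: v + x)) ('D_v f (t *: v + x)).
  exact: line_is_derive.
have [|c c01] := MVT_segment ler01 (fun t _ => dl t).
  apply: derivable_within_continuous => t _; exact: (@ex_derive _ _ _ _ _ _ _ (dl t)).
rewrite scale1r scale0r add0r subr0 mulr1 => ->; exists c => //.
Qed.

Lemma is_deriveZ f x v (a : R) : derivable f x v ->
  is_derive x (a *: v) f (a * 'D_v f x).
Proof.
move=> df.
have d0 : is_derive (0 : R) 1 (fun s : R => f (s *: v + x)) ('D_v f x).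
  by have := @line_is_derive f x v 0; rewrite scale0r add0r; exact.
have e : (fun s : R => f (s *: (a *: v) + x)) =
    (fun s : R => f (s *: v + x)) \o (fun s => a * s).
  by apply/funext => s /=; rewrite scalerA mulrC.
have d1 : is_derive (0 : R) 1 (fun s : R => f (s *: (a *: v) + x)) (a * 'D_v f x).
  rewrite e.
  have da : is_derive (0 : R) 1 (fun s : R => a * s) a.
    by apply: is_derive_eq; rewrite scaler1 ?mulr1.
  have d0' : is_derive (a * 0 : R) 1 (fun s : R => f (s *: v + x)) ('D_v f x).
    by rewrite mulr0.
  by apply: (is_derive_eq (is_derive1_comp d0' da)); rewrite mulrC.
by apply: DeriveDef; [apply/derivable_lineE|rewrite derive_lineE]; case: d1.
Qed.

End Ck_calculus.

(** * Linearity of directional derivatives and the chain rule *)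

Section chain_rule.
Variables (R : realType).
Implicit Types E F : normedModType R.

(** [B] is the linear part of the affine map [A], so the two difference quotients are the same
    function of [h]. *)
Lemma is_derive_affine E E' F (f : E -> F) (A B : E' -> E) (x v : E') :
  (forall (h : R), A (h *: v + x) = h *: B v + A x) ->
  derivable f (A x) (B v) -> is_derive x v (f \o A) ('D_(B v) f (A x)).
Proof.
move=> AB df.
have e : (fun h : R => h^-1 *: (((f \o A) \o shift x) (h *: v) - (f \o A) x)) =
    fun h : R => h^-1 *: ((f \o shift (A x)) (h *: B v) - f (A x)).
  by apply/funext => h /=; rewrite AB.
have df2 : derivable (f \o A) x v by rewrite /derivable e.
by apply: (DeriveDef df2); rewrite /derive e.
Qed.

Lemma Ck_affine E E' F k (f : E -> F) (A B : E' -> E) :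
  (forall (h : R) v x, A (h *: v + x) = h *: B v + A x) -> continuous A ->
  Ck k setT f -> Ck k setT (f \o A).
Proof.
move=> AB cA; elim: k f => [|k IH] f Cf.
  by split=> // x _; apply: continuous_comp; [exact: cA|exact: (Ck_continuous Cf)].
apply: CkS => [x|v x|v].
- by apply: continuous_comp; [exact: cA|exact: (Ck_continuous Cf)].
- have [] := @is_derive_affine _ _ _ f A B x v _ (Ck_derivable Cf) => //.
- rewrite (_ : 'D_v _ = 'D_(B v) f \o A); first by apply: IH; exact: Ck_derive.
  apply/funext => x.
  by have [_ ->] := @is_derive_affine _ _ _ f A B x v (fun h => AB h v x) (Ck_derivable Cf).
Qed.

(** Directional derivatives alone need not be additive in the direction; continuity of ['D_w f]
    makes them so. The increment along h (v + w) is split at x + h v, and the mean value theorem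
    writes the second leg as h times ['D_w f] at a point tending to x. *)
Lemma is_deriveDv E (f : E -> R) x v w : Ck 1 setT f ->
  is_derive x (v + w) f ('D_v f x + 'D_w f x).
Proof.
move=> Cf.
have lim : h^-1 *: ((f \o shift x) (h *: (v + w)) - f x) @[h --> (0 : R)^'] -->
    'D_v f x + 'D_w f x.
  have hq (h : R) : exists c : R, (0 <= c <= 1) /\
      f (h *: w + (h *: v + x)) - f (h *: v + x) =
      h * 'D_w f (c *: (h *: w) + (h *: v + x)).
    have [|c c01 ->] := @line_MVT R E f (h *: v + x) (h *: w).
      by move=> y; have [] := is_deriveZ h (@Ck_derivable _ _ _ _ _ w y Cf).
    exists c; split=> //.
    by have [_ ->] := is_deriveZ h (@Ck_derivable _ _ _ _ _ w (c *: (h *: w) + (h *: v + x)) Cf).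
  have [c hc] := choice hq.
  have -> : (fun h : R => h^-1 *: ((f \o shift x) (h *: (v + w)) - f x)) =
     fun h => h^-1 *: ((f \o shift x) (h *: v) - f x) +
       h^-1 * (h * 'D_w f (c h *: (h *: w) + (h *: v + x))).
    apply/funext => h /=; rewrite -(hc h).2 -[X in _ = _ + X]/(_ *: _) -scalerDr.
    congr (_ *: _); rewrite [RHS]addrC [RHS]addrA subrK.
    by rewrite scalerDr addrA [h *: w + _]addrC.
  apply: cvgD; first exact: (@Ck_derivable _ _ _ _ _ v x Cf).
  have cw := Ck_continuous (@Ck_derive _ _ _ _ _ w Cf).
  have : 'D_w f (c h *: (h *: w) + (h *: v + x)) @[h --> (0:R)^'] --> 'D_w f x.
    apply: (@continuous_cvg _ _ _ _ _ _ ('D_w f)); first exact: cw.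
    rewrite -[X in _ --> X]add0r; apply: cvgD.
      apply/norm_cvg0P.
      apply: (@squeeze_cvgr _ _ _ _ (cst 0) (fun h : R => `|h| * `|w|)).
      + apply: nearW => h; rewrite normr_ge0/= normrZ normrZ.
        rewrite ler_piMl//.
        by case: (hc h) => /andP[c0 c1] _; rewrite ger0_norm.
      + exact: cvg_cst.
      + rewrite -[X in _ --> X](mul0r `|w|); apply: cvgMl.
        rewrite -[X in _ --> X](@normr0 _ R); apply: cvg_norm.
        exact: nbhs_dnbhs.
    rewrite -[X in _ --> X]add0r; apply: cvgD; last exact: cvg_cst.
    rewrite -[X in _ --> X](scale0r v); apply: cvgZl; exact: nbhs_dnbhs.
  apply: cvg_trans; apply: near_eq_cvg; near=> h.
  by rewrite mulrA mulVf ?mul1r//; near: h; exact: nbhs_dnbhs_neq.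
have df : derivable f x (v + w) by apply/cvg_ex; eexists; exact: lim.
apply: (DeriveDef df); exact: cvg_lim lim.
Unshelve. all: by end_near. Qed.

Lemma derive0v E (f : E -> R) x : is_derive x 0 f 0.
Proof.
have e : (fun h : R => h^-1 *: ((f \o shift x) (h *: 0) - f x)) = cst 0.
  by apply/funext => h /=; rewrite scaler0 add0r subrr scaler0.
have df : derivable f x 0 by rewrite /derivable e; exact: is_cvg_cst.
by apply: (DeriveDef df); rewrite /derive e; exact: lim_cst.
Qed.

Lemma derive_lincomb E (I : finType) (e : I -> E) (a : I -> R) (f : E -> R) x :
  Ck 1 setT f -> 'D_(\sum_i a i *: e i) f x = \sum_i a i * 'D_(e i) f x.
Proof.
move=> Cf; apply: (big_ind2 (fun v r => 'D_v f x = r)) => //.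
- by have [] := derive0v f x.
- move=> v r w t <- <-; by have [] := is_deriveDv x v w Cf.
- by move=> i _; have [] := is_deriveZ (a i) (@Ck_derivable _ _ _ _ _ (e i) x Cf).
Qed.

Lemma cvg_sumr (T I : Type) (F : set_system T) (r : seq I) (f : I -> T -> R)
    (a : I -> R) : Filter F -> (forall i, f i x @[x --> F] --> a i) ->
  \sum_(i <- r) f i x @[x --> F] --> \sum_(i <- r) a i.
Proof.
move=> FF fa; elim: r => [|i r IH].
  rewrite big_nil; under eq_cvg do rewrite big_nil; exact: cvg_cst.
by rewrite big_cons; under eq_cvg do rewrite big_cons; apply: cvgD.
Qed.

(* A basis [e] with its dual coordinates [c]; additivity of [c] is all that the
   chain rule needs. *)
Definition coord_system E (I : finType) (e : I -> E) (c : I -> E -> R) :=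
  (forall y, y = \sum_i c i y *: e i) /\
  (forall i y z, c i (y - z) = c i y - c i z).

Lemma derive_coord E (I : finType) (e : I -> E) (c : I -> E -> R) (f : E -> R) x v :
  coord_system e c -> Ck 1 setT f -> 'D_v f x = \sum_i c i v * 'D_(e i) f x.
Proof. by move=> [ec _] Cf; rewrite {1}(ec v) derive_lincomb. Qed.

(** The mean value theorem is applied to [f] on the segment from [F x] to [F (h *: v + x)]. The
    derivative along this segment is expanded in the basis, its coefficients divided by [h] are the
    difference quotients of the coordinates of [F], and the intermediate point tends to [F x]. *)
Lemma is_derive_chain E E' (I : finType) (e : I -> E) (c : I -> E -> R)
    (f : E -> R) (F : E' -> E) x v :
  coord_system e c -> Ck 1 setT f -> {for x, continuous F} ->
  (forall i, derivable (c i \o F) x v) ->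
  is_derive x v (f \o F) (\sum_i 'D_v (c i \o F) x * 'D_(e i) f (F x)).
Proof.
move=> sys Cf cF dF; have [_ cB] := sys.
have hq (h : R) : exists t : R, (0 <= t <= 1) /\
    f (F (h *: v + x)) - f (F x) =
    'D_(F (h *: v + x) - F x) f (t *: (F (h *: v + x) - F x) + F x).
  have [|t t01 ht] := @line_MVT R E f (F x) (F (h *: v + x) - F x).
    by move=> y; exact: (Ck_derivable Cf).
  by exists t; rewrite -ht subrK.
have [t ht] := choice hq.
have lim : h^-1 *: (((f \o F) \o shift x) (h *: v) - (f \o F) x) @[h --> (0 : R)^'] -->
    \sum_i 'D_v (c i \o F) x * 'D_(e i) f (F x).
  have -> : (fun h : R => h^-1 *: (((f \o F) \o shift x) (h *: v) - (f \o F) x)) =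
     fun h : R => \sum_i (h^-1 *: (((c i \o F) \o shift x) (h *: v) - (c i \o F) x))
       * 'D_(e i) f (t h *: (F (h *: v + x) - F x) + F x).
    apply/funext => h /=; rewrite (ht h).2 (derive_coord _ _ sys)// -[LHS]/(h^-1 * _).
    rewrite mulr_sumr; apply: eq_bigr => i _.
    by rewrite cB mulrA.
  apply: cvg_sumr => i; apply: cvgM; first exact: dF.
  have cw := Ck_continuous (@Ck_derive _ _ _ _ _ (e i) Cf).
  apply: (@continuous_cvg _ _ _ _ _ _ ('D_(e i) f)); first exact: cw.
  rewrite -[X in _ --> X]add0r; apply: cvgD; last exact: cvg_cst.
  have dF0 : `|F (h *: v + x) - F x| @[h --> (0 : R)^'] --> (0 : R).
    rewrite -[X in _ --> X](@normr0 _ E); apply: cvg_norm.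
    rewrite -(subrr (F x)); apply: cvgB; last exact: cvg_cst.
    apply: (@continuous_cvg _ _ _ _ _ _ F) => //.
    rewrite -[X in _ --> X]add0r; apply: cvgD; last exact: cvg_cst.
    rewrite -[X in _ --> X](scale0r v); apply: cvgZl; exact: nbhs_dnbhs.
  apply/norm_cvg0P.
  apply: (@squeeze_cvgr _ _ _ _ (cst 0) _ _ _ _ _ dF0); last exact: cvg_cst.
  apply: nearW => h; rewrite normr_ge0/= normrZ ler_piMl//.
  by case: (ht h) => /andP[t0 t1] _; rewrite ger0_norm.
have df : derivable (f \o F) x v by apply/cvg_ex; eexists; exact: lim.
apply: (DeriveDef df); exact: cvg_lim lim.
Qed.

Lemma Ck_comp E E' (I : finType) (e : I -> E) (c : I -> E -> R) k
    (f : E -> R) (F : E' -> E) :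
  coord_system e c -> continuous F -> (forall i, Ck k setT (c i \o F)) ->
  Ck k setT f -> Ck k setT (f \o F).
Proof.
move=> sys cF; elim: k f => [|k IH] f CF Cf.
  by split=> // x _; apply: continuous_comp; [exact: cF|exact: (Ck_continuous Cf)].
have Cf1 : Ck 1 setT f.
  clear -Cf; elim: k Cf => // k IHk Cf; apply: IHk; exact: Ck_pred.
have ch x v : is_derive x v (f \o F) (\sum_i 'D_v (c i \o F) x * 'D_(e i) f (F x)).
  apply: is_derive_chain => //; first exact: cF.
  move=> i; exact: (Ck_derivable (CF i)).
apply: CkS => [x|v x|v].
- by apply: continuous_comp; [exact: cF|exact: (Ck_continuous Cf)].
- by have [] := ch x v.
- rewrite (_ : 'D_v _ = fun x => \sum_i 'D_v (c i \o F) x * ('D_(e i) f \o F) x).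
    apply: Ck_sum => i _; apply: CkM; first exact: Ck_derive (CF i).
    by apply: IH; [move=> j; exact: Ck_pred|exact: Ck_derive].
  by apply/funext => x; have [_ ->] := ch x v.
Qed.

End chain_rule.

(** * Coordinates of row vectors, real powers, and flat functions *)

Section coordinates.
Variable R : realType.

Lemma coord_system_rV n :
  @coord_system R 'rV[R]_n _ (fun i : 'I_n => delta_mx ord0 i) (fun i y => y ord0 i).
Proof.
split=> [y|i y z]; last by rewrite !mxE.
exact: row_sum_delta.
Qed.

Lemma coord_system_rV2 n m :
  @coord_system R ('rV[R]_n * 'rV[R]_m)%type ('I_n + 'I_m)%type
    (fun i => match i with
       | inl i => (delta_mx ord0 i, 0) | inr j => (0, delta_mx ord0 j) end)
    (fun i y => match i with inl i => y.1 ord0 i | inr j => y.2 ord0 j end).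
Proof.
split=> [[y z]|[i|i] y z]; rewrite ?mxE//=.
have fst_sum (I : Type) (r : seq I) (f : I -> 'rV[R]_n * 'rV[R]_m) :
    (\sum_(i <- r) f i).1 = \sum_(i <- r) (f i).1.
  by elim: r => [|a r IH]; rewrite ?big_nil// !big_cons /= IH.
have snd_sum (I : Type) (r : seq I) (f : I -> 'rV[R]_n * 'rV[R]_m) :
    (\sum_(i <- r) f i).2 = \sum_(i <- r) (f i).2.
  by elim: r => [|a r IH]; rewrite ?big_nil// !big_cons /= IH.
rewrite big_sumType /=; congr pair; rewrite ?fst_sum ?snd_sum /=.
  rewrite [X in _ + X]big1 => [|i _]; last by rewrite scaler0.
  by rewrite addr0; exact: row_sum_delta.
rewrite [X in X + _]big1 => [|i _]; last by rewrite scaler0.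
by rewrite add0r; exact: row_sum_delta.
Qed.

Lemma Ck_coord (E : normedModType R) n k (F : E -> 'rV[R]_n) (i : 'I_n) :
  Ck k setT F -> Ck k setT (fun x => F x ord0 i).
Proof.
elim: k F => [|k IH] F CF.
  split=> // x _; apply: (@continuous_comp _ _ _ F (fun y => y ord0 i)).
    exact: (Ck_continuous CF).
  exact: coord_continuous.
have dF v x : derivable F x v by exact: (Ck_derivable CF).
apply: CkS => [x|v x|v].
- apply: (@continuous_comp _ _ _ F (fun y => y ord0 i)).
    exact: (Ck_continuous CF).
  exact: coord_continuous.
- by have /derivable_mxP := dF v x; exact.
- rewrite (_ : 'D_v _ = fun x => 'D_v F x ord0 i); first by apply: IH; exact: Ck_derive.
  by apply/funext => x; rewrite (derive_mx (dF v x)) mxE.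
Qed.

Lemma is_derive_comp1 (E : normedModType R) (f : E -> R) (g : R -> R) x v (dg : R) :
  derivable f x v -> is_derive (f x) 1 g dg ->
  is_derive x v (g \o f) (dg * 'D_v f x).
Proof.
move=> df Dg.
have d0 : is_derive (0 : R) 1 (fun s : R => f (s *: v + x)) ('D_v f x).
  by have := @line_is_derive R E f x v 0; rewrite scale0r add0r; exact.
have Dg0 : is_derive (f (0 *: v + x)) 1 g dg by rewrite scale0r add0r.
have d1 : is_derive (0 : R) 1 (g \o (fun s : R => f (s *: v + x))) (dg * 'D_v f x).
  by apply: (is_derive_eq (is_derive1_comp Dg0 d0)).
by apply: DeriveDef; [apply/derivable_lineE|rewrite derive_lineE]; case: d1.
Qed.

Lemma is_derive1_continuous (g : R -> R) (t dg : R) : is_derive t 1 g dg ->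
  {for t, continuous g}.
Proof.
by move=> [/derivable1_diffP dg' _]; exact: differentiable_continuous.
Qed.

Lemma Ck_powR (E : normedModType R) k (f : E -> R) (a : R) :
  (forall x, 0 < f x) -> Ck k setT f -> Ck k setT (fun x => f x `^ a).
Proof.
move=> f0; elim: k a => [|k IH] a Cf.
  split=> // x _; apply: (@continuous_comp _ _ _ f (fun t => t `^ a)).
    exact: (Ck_continuous Cf).
  exact: is_derive1_continuous (is_derive1_powR a (f0 x)).
have ch v x : is_derive x v (fun x => f x `^ a) (a * f x `^ (a - 1) * 'D_v f x).
  exact: (is_derive_comp1 (Ck_derivable Cf) (is_derive1_powR a (f0 x))).
apply: CkS => [x|v x|v].
- by apply: (Ck_continuous (k := k)); exact: (IH _ (Ck_pred Cf)).
- by have [] := ch v x.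
- rewrite (_ : 'D_v _ = fun x => a * f x `^ (a - 1) * 'D_v f x).
    apply: CkM; last exact: Ck_derive.
    apply: CkM; first exact: Ck_cst.
    exact: (IH _ (Ck_pred Cf)).
  by apply/funext => x; have [_ ->] := ch v x.
Qed.

(* The index [m] makes the family stable under differentiation. *)
Definition flat (m : nat) (t : R) : R :=
  if 0 < t then t^-1 ^+ m * expR (- t^-1) else 0.

Lemma flat_ge0 m t : 0 <= flat m t.
Proof.
by rewrite /flat; case: ifPn => // t0; rewrite mulr_ge0 ?expR_ge0// exprn_ge0// invr_ge0 ltW.
Qed.

(** This is exp y >= y^(m+1) / (m+1)! at y = 1/t. The linear bound controls the difference quotients
    at 0. *)
Lemma flat_le m t : 0 < t -> flat m t <= m.+1`!%:R * t.
Proof.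
move=> t0; rewrite /flat t0 -ler_pdivrMr// mulrAC -exprSr expRN ler_pdivrMr ?expR_gt0//.
have y0 : 0 <= t^-1 by rewrite invr_ge0 ltW.
have := expR_ge1Dxn m y0; have f0 : 0 < m.+1`!%:R :> R by rewrite ltr0n fact_gt0.
move=> h; rewrite -ler_pdivrMl// mulrC; apply: le_trans h.
by rewrite lerDr.
Qed.

Lemma is_derive_flat (m : nat) (t : R) : is_derive t 1 (flat m) (flat m.+2 t - m%:R * flat m.+1 t).
Proof.
have [t0|t0|->] := ltgtP t 0.
- rewrite [X in is_derive _ _ _ X](_ : _ = 0); last first.
    by rewrite /flat ltNge ltW//= mulr0 subr0.
  apply: (@near_eq_is_derive _ _ _ (cst 0)).
  near=> s; rewrite /flat ifF//; apply/negbTE; rewrite -leNgt ltW//.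
  by near: s; exact: lt_nbhsl.
- have t_neq0 : t != 0 by rewrite gt_eqF.
  apply: (@near_eq_is_derive _ R R (fun s : R => s^-1 ^+ m * expR (- s^-1))).
    by near=> s; rewrite /flat ifT//; near: s; exact: lt_nbhsr.
  have dV : is_derive t 1 (fun s : R => s^-1) (- t ^- 2).
    by apply: (is_derive_eq (is_deriveV t_neq0 (is_derive_id t 1))); rewrite scaler1.
  have dX : is_derive t 1 (fun s : R => s^-1 ^+ m) (m%:R * t^-1 ^+ m.-1 * (- t ^- 2)).
    rewrite (_ : (fun s => _) = (fun s : R => s^-1) ^+ m); last first.
      by apply/funext => s; rewrite exprfctE.
    exact: (is_derive_eq (is_deriveX m dV)).
  have dE : is_derive t 1 (fun s : R => expR (- s^-1)) (expR (- t^-1) * t ^- 2).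
    have dN : is_derive t 1 (fun s : R => - s^-1) (t ^- 2).
      by apply: (is_derive_eq (is_deriveN dV)); rewrite opprK.
    exact: (is_derive_eq (is_derive1_comp (is_derive_expR _) dN)).
  apply: (is_derive_eq (is_deriveM dX dE)).
  rewrite /flat t0 -![_ *: _]/(_ * _) !exprVn.
  clear dX; case: m => [|m]; first by rewrite !mul0r !expr0 mulr0 addr0 subr0 invr1 !mul1r mulrC.
  rewrite !exprS /=; field. by rewrite t_neq0 expf_neq0.
- rewrite [X in is_derive _ _ _ X](_ : _ = 0); last by rewrite /flat ltxx mulr0 subr0.
  have lim : h^-1 *: ((flat m \o shift 0) (h *: 1) - flat m 0) @[h --> (0:R)^'] --> (0 : R).
    apply/norm_cvg0P.
    apply: (@squeeze_cvgr _ _ _ _ (cst 0) (fun h : R => m.+2`!%:R * `|h|)).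
    (* For h > 0 the quotient [flat m h / h] is exactly [flat m.+1 h], which [flat_le] bounds
       linearly. *)
    + near=> h; rewrite normr_ge0/= [h *: 1]mulr1 addr0 /flat ltxx subr0.
      case: ifPn => h0; last by rewrite scaler0 normr0 mulr_ge0.
      rewrite gtr0_norm ?(gtr0_norm h0); last first.
        by rewrite pmulr_rgt0 ?invr_gt0// pmulr_rgt0 ?expR_gt0// exprn_gt0// invr_gt0.
      apply: le_trans (flat_le m.+1 h0).
      by rewrite /flat h0 -[leLHS]/(_ * _) exprS mulrA.
    + exact: cvg_cst.
    + rewrite -[X in _ --> X](mulr0 m.+2`!%:R); apply: cvgMr.
      rewrite -[X in _ --> X](@normr0 _ R); apply: cvg_norm.
      exact: nbhs_dnbhs.
  have df : derivable (flat m) 0 1 by apply/cvg_ex; eexists; exact: lim.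
  by apply: (DeriveDef df); exact: cvg_lim lim.
Unshelve. all: by end_near. Qed.

Lemma Ck_flat (E : normedModType R) k (f : E -> R) m :
  Ck k setT f -> Ck k setT (fun x => flat m (f x)).
Proof.
elim: k m => [|k IH] m Cf.
  split=> // x _; apply: (@continuous_comp _ _ _ f (flat m)).
    exact: (Ck_continuous Cf).
  exact: is_derive1_continuous (is_derive_flat m (f x)).
have ch v x := is_derive_comp1 (@Ck_derivable _ _ _ _ _ v x Cf) (is_derive_flat m (f x)).
apply: CkS => [x|v x|v].
- by apply: (Ck_continuous (k := k)); exact: (IH _ (Ck_pred Cf)).
- by have [] := ch v x.
- rewrite (_ : 'D_v _ = fun x => (flat m.+2 (f x) + (- m%:R) * flat m.+1 (f x)) * 'D_v f x).
    apply: CkM; last exact: Ck_derive.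
    apply: CkD; first exact: (IH _ (Ck_pred Cf)).
    by apply: CkM; [exact: Ck_cst|exact: (IH _ (Ck_pred Cf))].
  by apply/funext => x; have [_ ->] := ch v x; rewrite mulNr.
Qed.

End coordinates.

(** * Locally integrable functions and parametric integrals *)

Section integrability.
Variable R : realType.
Local Notation mu := (lebesgue_rV R).

Definition zero_off T (K : set T) (f : T -> R) := forall x, ~ K x -> f x = 0.

Lemma compact_continuous_bounded (T : topologicalType) (K : set T) (c : T -> R) :
  compact K -> {within K, continuous c} ->
  exists2 M : R, 0 <= M & forall x, K x -> `|c x| <= M.
Proof.
move=> cK cc; have /compact_bounded[M [_ hM]] := continuous_compact cc cK.
exists (Num.max (M + 1) 0); first by rewrite le_max lexx orbT.
move=> x Kx; apply: (hM _ _ (c x)); last by exists x.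
by rewrite lt_max ltrDl ltr01.
Qed.

Lemma integrableM_bounded n (c g : 'rV[R]_n -> R) (K : set 'rV[R]_n) (M : R) :
  measurable_fun setT c -> (forall x, K x -> `|c x| <= M) ->
  zero_off K g ->
  (mu n).-integrable setT (EFin \o g) ->
  (mu n).-integrable setT (EFin \o (fun x => c x * g x)).
Proof.
move=> mc cM gK ig.
have mg : measurable_fun setT g by apply/measurable_EFinP; case/integrableP: ig.
apply: (@le_integrable _ _ _ (mu n) setT _ _ (fun x => (M * g x)%:E)) => //.
- by apply/measurable_EFinP; exact: measurable_funM.
- move=> x _ /=; rewrite lee_fin !normrM.
  have [Kx|nKx] := pselect (K x); last by rewrite gK// normr0 !mulr0.
  by rewrite ler_wpM2r// (le_trans (cM _ Kx))// ler_norm.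
- have := integrableZl measurableT M ig; apply: eq_integrable => // x _ /=.
Qed.

Lemma integrableM_continuous n (c g : 'rV[R]_n -> R) (K : set 'rV[R]_n) :
  continuous c -> compact K -> zero_off K g ->
  (mu n).-integrable setT (EFin \o g) ->
  (mu n).-integrable setT (EFin \o (fun x => c x * g x)).
Proof.
move=> cc cK gK ig.
have [M M0 cM] := compact_continuous_bounded cK (continuous_subspaceT cc).
apply: integrableM_bounded ig => //; [exact: continuous_measurable_rV|exact: cM|exact: gK].
Qed.

Lemma L1loc_integrable_restrict n (Omega K : set 'rV[R]_n) f :
  L1loc Omega f -> compact K -> K `<=` Omega ->
  (mu n).-integrable setT (EFin \o (f \_ K)).
Proof.
move=> fL cK KO; rewrite -restrict_EFin -integrable_mkcond; last exact: compact_measurable_rV.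
exact: fL.
Qed.

Lemma L1loc_integrableM n (Omega K : set 'rV[R]_n) f c :
  L1loc Omega f -> compact K -> K `<=` Omega -> continuous c -> zero_off K c ->
  (mu n).-integrable setT (EFin \o (fun x => f x * c x)).
Proof.
move=> fL cK KO cc c0.
have := integrableM_continuous cc cK _ (L1loc_integrable_restrict fL cK KO).
rewrite (_ : (fun x => c x * _) = (fun x => f x * c x)).
  by apply => x Kx; rewrite patchN// notin_setE.
apply/funext => x; have [Kx|Kx] := pselect (K x).
  by rewrite patchE mem_set// mulrC.
by rewrite c0// mulr0 mul0r.
Qed.

Lemma L1loc_cst n (Omega : set 'rV[R]_n) (a : R) : L1loc Omega (fun=> a).
Proof.
move=> K cK _; have mK := compact_measurable_rV cK; apply/integrableP; split.
  exact: (measurable_cst a%:E).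
rewrite (eq_integral (cst `|a|%:E))//.
by rewrite integral_cst// lte_mul_pinfty// lebesgue_rV_compact.
Qed.

Lemma Cc_integrable n (K : set 'rV[R]_n) c :
  compact K -> continuous c -> zero_off K c ->
  (mu n).-integrable setT (EFin \o c).
Proof.
move=> cK cc c0.
have := L1loc_integrableM (@L1loc_cst n setT 1) cK (@subsetT _ _) cc c0.
by apply: eq_integrable => // x _ /=; rewrite mul1r.
Qed.

Lemma Rintegral_zero_off n (D : set 'rV[R]_n) f : zero_off D f ->
  \int[mu n]_(x in D) f x = \int[mu n]_x f x.
Proof.
move=> f0; rewrite Rintegral_mkcond; apply: eq_Rintegral => x _.
by rewrite patchE; case: ifPn => //; rewrite notin_setE => /f0.
Qed.

(** A form of the tube lemma: compactness of [K] makes continuity in the parameter uniform over the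
    integration variable. *)
Lemma near_compact_param (T U : topologicalType) (H : T * U -> R) (K : set U) x (e : R) :
  continuous H -> compact K -> 0 < e ->
  \forall x' \near x, forall z, K z -> `|H (x', z) - H (x, z)| < e.
Proof.
move=> cH /compact_near_coveringP cK e0.
apply: (cK _ _ (fun x' z => `|H (x', z) - H (x, z)| < e)) => z Kz.
have e20 : 0 < e / 2 by rewrite divr_gt0.
have /cvgrPdist_lt/(_ _ e20)[/= [A B] [/= Ax Bz] AB] := cH (x, z).
exists (B, A) => //= -[z' x'] /= [Bz' Ax'].
rewrite -(subrKA (H (x, z))) (le_lt_trans (ler_normD _ _))// (splitr e) ltrD//.
  by rewrite distrC; exact: (AB (x', z')).
by apply: (AB (x, z')); split=> //=; exact: nbhs_singleton.
Qed.

Section parametric.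
Variables (E : normedModType R) (n : nat) (K : set 'rV[R]_n) (g : 'rV[R]_n -> R).
Hypotheses (cK : compact K) (g0 : zero_off K g)
  (ig : (mu n).-integrable setT (EFin \o g)).
Implicit Types H : E * 'rV[R]_n -> R.

Lemma continuous_slice2 H x : continuous H -> continuous (fun z => H (x, z)).
Proof.
move=> cH z; apply: (@continuous_comp _ _ _ (fun z => (x, z)) H); last exact: cH.
move=> A [[P Q] [/= Px Qz] PQ]; apply: filterS Qz => y Qy.
by apply: PQ; split=> //=; exact: nbhs_singleton.
Qed.

Lemma param_integrable H x : continuous H ->
  (mu n).-integrable setT (EFin \o (fun z => H (x, z) * g z)).
Proof.
move=> cH; apply: integrableM_continuous cK g0 ig.
exact: continuous_slice2.
Qed.

Lemma param_continuous H : continuous H ->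
  continuous (fun x => \int[mu n]_z (H (x, z) * g z)).
Proof.
move=> cH x; apply/cvgrPdist_le => e e0.
pose C := \int[mu n]_z `|g z|.
have C0 : 0 <= C by apply: Rintegral_ge0.
have d0 : 0 < e / (C + 1) by rewrite divr_gt0// ltr_wpDl.
have := near_compact_param x cH cK d0.
apply: filterS => x' hx'.
rewrite distrC -RintegralB//; [|exact: param_integrable..].
have iB : (mu n).-integrable setT (EFin \o (fun z => H (x', z) * g z - H (x, z) * g z)).
  by have := integrableB measurableT (param_integrable x' cH) (param_integrable x cH);
    apply: eq_integrable.
apply: le_trans (le_normr_Rintegral measurableT iB) _.
apply: (@le_trans _ _ (\int[mu n]_z (e / (C + 1) * `|g z|))).
  apply: le_Rintegral => //.
  - by have := integrable_norm iB; apply: eq_integrable.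
  - have := integrableZl measurableT (e / (C + 1)) (integrable_norm ig).
    by apply: eq_integrable.
  - move=> z _; rewrite -mulrBl normrM.
    have [Kz|nKz] := pselect (K z); last by rewrite g0// normr0 !mulr0.
    by rewrite ler_wpM2r// ltW// hx'.
rewrite RintegralZl//; last exact: integrable_norm.
rewrite -/C mulrAC ler_pdivrMr ?ltr_wpDl// ler_wpM2l ?(ltW e0)//.
by rewrite lerDl.
Qed.

Lemma slice_derive H x z v : derivable H (x, z) (v, 0) ->
  is_derive x v (fun x => H (x, z)) ('D_(v, 0) H (x, z)).
Proof.
move=> dH; apply: (@is_derive_affine _ _ _ _ H (fun x => (x, z)) (fun v => (v, 0)) x v) => //.
by move=> h; rewrite -[RHS]/(_, _) /= scaler0 add0r.
Qed.

(** The parameter is restricted to the line s v + x with |s| < 1. There the derivative of the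
    integrand is dominated by [M * |g|], with [M] the bound of a continuous function on the compact
    set [-1, 1] x [K]. *)
Lemma param_derive H x v : Ck 1 setT H ->
  is_derive x v (fun x => \int[mu n]_z (H (x, z) * g z))
    (\int[mu n]_z ('D_(v, 0) H (x, z) * g z)).
Proof.
move=> CH.
have cH := Ck_continuous CH.
have cDH := Ck_continuous (@Ck_derive _ _ _ _ _ (v, 0) CH).
pose f (s : R) z := H (s *: v + x, z) * g z.
have df (s : R) z : is_derive s 1 (f ^~ z) ('D_(v, 0) H (s *: v + x, z) * g z).
  have dH : derivable (fun x => H (x, z)) (s *: v + x) v.
    by have [] := @slice_derive H (s *: v + x) z v (Ck_derivable CH).
  have d1 := line_is_derive dH.
  have [_ e1] := @slice_derive H (s *: v + x) z v (Ck_derivable CH).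
  rewrite -e1.
  apply: (is_derive_eq (is_deriveM d1 (is_derive_cst (g z) s 1))).
  by rewrite scaler0 add0r [LHS]mulrC.
have [M M0 hM] : exists2 M : R, 0 <= M & forall s z, `|s| <= 1 -> K z ->
    `|'D_(v, 0) H (s *: v + x, z)| <= M.
  have cS : compact ((`[-1, 1]%classic : set R) `*` K).
    by apply: compact_setX => //; exact: segment_compact.
  have [|M M0 hM] := @compact_continuous_bounded _ _
    (fun p : R * 'rV[R]_n => 'D_(v, 0) H (p.1 *: v + x, p.2)) cS.
    apply: continuous_subspaceT => p.
    apply: (@continuous_comp _ _ _ (fun p : R * 'rV[R]_n => (p.1 *: v + x, p.2)) ('D_(v, 0) H));
      last exact: cDH.
    have A1 : (fun p : R * 'rV[R]_n => p.1 *: v + x) @ p --> p.1 *: v + x.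
      by apply: cvgD; [apply: cvgZr_tmp; exact: cvg_fst|exact: cvg_cst].
    have A2 : snd @ p --> p.2 by exact: cvg_snd.
    exact: (cvg_pair A1 A2).
  exists M => // s z s1 Kz; apply: (hM (s, z)); split => //=.
  by rewrite in_itv/= -ler_norml.
have I0 : (`]-1, 1[%classic : set R) 0 by rewrite /= in_itv/= ltrN10 ltr01.
have intf (s : R) : `]-1, 1[%classic s -> (mu n).-integrable setT (EFin \o f s).
  by move=> _; exact: param_integrable.
have dfI (s : R) z : `]-1, 1[%classic s -> setT z -> derivable (f ^~ z) s 1.
  by move=> _ _; have [] := df s z.
have G0 z : 0 <= M * `|g z| by rewrite mulr_ge0.
have intG : (mu n).-integrable setT (EFin \o (fun z => M * `|g z|)).
  have := integrableZl measurableT M (integrable_norm ig).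
  by apply: eq_integrable.
have Gub (s : R) z : `]-1, 1[%classic s -> setT z -> `|partial1of2 f s z| <= M * `|g z|.
  move=> s1 _; rewrite partial1of2E; have [_ ->] := df s z; rewrite normrM.
  have [Kz|nKz] := pselect (K z); last by rewrite g0// normr0 !mulr0.
  rewrite ler_wpM2r// hM//; move: s1; rewrite /= in_itv/= -ltr_norml; exact: ltW.
have d1 := derivable_under_integral measurableT I0 intf dfI G0 intG Gub.
have e1 := differentiation_under_integral measurableT I0 intf dfI G0 intG Gub.
apply: DeriveDef; first by apply/derivable_lineE.
rewrite derive_lineE -derive1E [LHS]e1.
apply: eq_Rintegral => z _; rewrite partial1of2E; have [_ ->] := df 0 z.
by rewrite scale0r add0r.
Qed.

Lemma param_Ck k H : Ck k setT H ->
  Ck k setT (fun x => \int[mu n]_z (H (x, z) * g z)).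
Proof.
elim: k H => [|k IH] H CH.
  by split=> // x _; apply: param_continuous; exact: Ck_continuous CH.
have CH1 : Ck 1 setT H.
  by clear -CH; elim: k CH => // k IHk Cf; apply: IHk; exact: Ck_pred.
apply: CkS => [|v x|v].
- by apply: param_continuous; exact: Ck_continuous CH.
- by have [] := param_derive x v CH1.
- rewrite (_ : 'D_v _ = fun x => \int[mu n]_z ('D_(v, 0) H (x, z) * g z)).
    have IHv := IH _ (@Ck_derive _ _ _ _ _ (v, 0) CH); exact: IHv.
  by apply/funext => x; have [_ ->] := param_derive x v CH1.
Qed.

End parametric.

End integrability.

(** * Fubini for continuous kernels, and smooth bumps *)

Section fubini_bump.
Variable R : realType.
Local Notation mu := (lebesgue_rV R).

(** On [K1] x [K2] the kernel is bounded by some [M], so the integrand is dominated by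
    [M * (|f| * |g|)], whose double integral is finite. It serves to shift an average from the
    weight to the test function. *)
Lemma Fubini_kernel n m (H : 'rV[R]_n * 'rV[R]_m -> R)
    (K1 : set 'rV[R]_n) (K2 : set 'rV[R]_m) f g :
  continuous H -> compact K1 -> compact K2 -> zero_off K1 f -> zero_off K2 g ->
  (mu n).-integrable setT (EFin \o f) -> (mu m).-integrable setT (EFin \o g) ->
  \int[mu n]_x ((\int[mu m]_z (H (x, z) * g z)) * f x) =
  \int[mu m]_z ((\int[mu n]_x (H (x, z) * f x)) * g z).
Proof.
move=> cH cK1 cK2 f0 g0 i_f ig.
have mf : measurable_fun setT f by apply/measurable_EFinP; case/integrableP: i_f.
have mg : measurable_fun setT g by apply/measurable_EFinP; case/integrableP: ig.
have cH1 z : continuous (fun x => H (x, z)).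
  move=> x; apply: (@continuous_comp _ _ _ (fun x => (x, z)) H); last exact: cH.
  move=> A [[P Q] [/= Px Qz] PQ]; apply: filterS Px => y Py.
  by apply: PQ; split=> //=; exact: nbhs_singleton.
have [M M0 hM] := compact_continuous_bounded (compact_setX cK1 cK2) (continuous_subspaceT cH).
have HM x z : `|H (x, z) * g z * f x| <= M * (`|f x| * `|g z|).
  rewrite !normrM -mulrA [X in _ * X]mulrC.
  have [K1x|nK1] := pselect (K1 x); last by rewrite f0// normr0 !mul0r !mulr0.
  have [K2z|nK2] := pselect (K2 z); last by rewrite g0// normr0 !mulr0.
  by rewrite ler_wpM2r// ?mulr_ge0//; exact: (hM (x, z)).
pose F (p : 'rV[R]_n * 'rV[R]_m) : \bar R := (H p * g p.2 * f p.1)%:E.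
have mF : measurable_fun setT F.
  apply/measurable_EFinP; apply: measurable_funM.
    apply: measurable_funM; first exact: continuous_measurable_rV2.
    exact: (measurableT_comp mg measurable_snd).
  exact: (measurableT_comp mf measurable_fst).
have iF : ((mu n) \x (mu m))%E.-integrable setT F.
  apply/integrable12ltyP => //.
  apply: (@le_lt_trans _ _ (\int[mu n]_x \int[mu m]_z (M * (`|f x| * `|g z|))%:E)%E).
    apply: ge0_le_integral => //.
    - by move=> x _; exact: integral_ge0.
    - have mA : measurable_fun setT (fun p => `|F p|%E) by exact: measurableT_comp.
      exact: (measurable_fun_fubini_tonelli_F _ mA (fun p => abse_ge0 _)).
    - have mB : measurable_fun setT
          (fun p : 'rV[R]_n * 'rV[R]_m => (M * (`|f p.1| * `|g p.2|))%:E).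
        have m1 : measurable_fun setT (fun p : 'rV[R]_n * 'rV[R]_m => `|f p.1|).
          by apply: measurableT_comp => //; exact: (measurableT_comp mf measurable_fst).
        have m2 : measurable_fun setT (fun p : 'rV[R]_n * 'rV[R]_m => `|g p.2|).
          by apply: measurableT_comp => //; exact: (measurableT_comp mg measurable_snd).
        by apply/measurable_EFinP; apply: measurable_funM => //; exact: measurable_funM.
      apply: (measurable_fun_fubini_tonelli_F _ mB) => p.
      by rewrite lee_fin mulr_ge0// mulr_ge0.
    - move=> x _; apply: ge0_le_integral => //.
      + have mFx : measurable_fun setT (fun z => F (x, z)).
          exact: (measurableT_comp mF (measurable_pair1 x)).
        by apply: (measurableT_comp _ mFx); exact: abse_measurable.
      + apply/measurable_EFinP; apply: measurable_funM => //; apply: measurable_funM => //.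
        exact: measurableT_comp.
      + by move=> z _; rewrite /F /= lee_fin.
  have e x : (\int[mu m]_z (M * (`|f x| * `|g z|))%:E =
     (M * `|f x|)%:E * \int[mu m]_z `|(g z)%:E|)%E.
    rewrite -ge0_integralZl//; last 2 first.
    - by apply: measurableT_comp => //; exact/measurable_EFinP.
    - by rewrite lee_fin mulr_ge0.
    by apply: eq_integral => z _; rewrite /= mulrA.
  under eq_integral do rewrite e.
  rewrite ge0_integralZr//; last 3 first.
  - by apply/measurable_EFinP; apply: measurable_funM => //; exact: measurableT_comp.
  - by move=> x _; rewrite lee_fin mulr_ge0.
  - exact: integral_ge0.
  rewrite (_ : (\int[mu n]_x (M * `|f x|)%:E)%E = (M%:E * \int[mu n]_x `|(f x)%:E|)%E).
    have /integrableP[_ fo] := i_f; have /integrableP[_ go] := ig.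
    rewrite lte_mul_pinfty//.
    - by rewrite mule_ge0// ?lee_fin//; exact: integral_ge0.
    - rewrite fin_numM// ge0_fin_numE//; exact: integral_ge0.
  rewrite -ge0_integralZl//.
  by apply: measurableT_comp => //; exact/measurable_EFinP.
have := Fubini iF; rewrite /F /= => Fub.
have -> : \int[mu n]_x (\int[mu m]_z (H (x, z) * g z) * f x) =
  fine (\int[mu n]_x \int[mu m]_z (H (x, z) * g z * f x)%:E)%E.
  congr fine; apply: eq_integral => x _.
  rewrite -RintegralZr//; last exact: (param_integrable cK2).
  rewrite /Rintegral fineK//; apply: integrable_fin_num => //.
  have := integrableZr measurableT (f x) (@param_integrable _ _ _ _ _ cK2 g0 ig H x cH).
  by apply: eq_integrable.
rewrite Fub; congr fine; apply: eq_integral => z _.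
rewrite -RintegralZr//; last exact: (integrableM_continuous _ cK1).
have i2 : (mu n).-integrable setT (EFin \o (fun x => H (x, z) * f x * g z)).
  have := integrableZr measurableT (g z) (integrableM_continuous (cH1 z) cK1 f0 i_f).
  by apply: eq_integrable.
rewrite /Rintegral fineK; last exact: integrable_fin_num.
by apply: eq_integral => x _; rewrite mulrAC.
Qed.

Lemma is_derive_linear (E : normedModType R) (f : E -> R) x v :
  (forall (h : R) v x, f (h *: v + x) = h * f v + f x) -> is_derive x v f (f v).
Proof.
move=> lf.
have e : {near (0 : R)^', (fun h : R => h^-1 *: ((f \o shift x) (h *: v) - f x)) =1 cst (f v)}.
  near=> h; have h0 : h != 0 by near: h; exact: nbhs_dnbhs_neq.
  by rewrite /= lf addrK -[LHS]/(_ * _) mulKf.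
have lim : h^-1 *: ((f \o shift x) (h *: v) - f x) @[h --> (0 : R)^'] --> f v.
  apply: cvg_trans (near_eq_cvg _) (cvg_cst (f v)).
  by apply: filterS e => h ->.
have df : derivable f x v by apply/cvg_ex; eexists; exact: lim.
by apply: (DeriveDef df); exact: cvg_lim lim.
Unshelve. all: by end_near. Qed.

Lemma Ck_linear (E : normedModType R) k (f : E -> R) :
  continuous f -> (forall (h : R) v x, f (h *: v + x) = h * f v + f x) -> Ck k setT f.
Proof.
move=> cf lf; case: k => [|k]; first by split=> // x _; exact: cf.
apply: CkS => [//|v x|v]; first by have [] := is_derive_linear x v lf.
rewrite (_ : 'D_v f = fun=> f v); first exact: Ck_cst.
by apply/funext => x; have [] := is_derive_linear x v lf.
Qed.

(** The classical exp(-1 / (r^2 - |x|^2)), extended by 0. The Euclidean square is written out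
    because the norm on row vectors is the maximum norm, which is not smooth. *)
Definition bump n (r : R) (x : 'rV[R]_n) : R :=
  flat 0 (r ^+ 2 - \sum_i x ord0 i * x ord0 i).

Lemma bump_Ck n r k : Ck k setT (@bump n r).
Proof.
apply: Ck_flat; apply: CkD; first exact: Ck_cst.
rewrite (_ : (fun x => _) = fun x : 'rV[R]_n => (-1) * \sum_i x ord0 i * x ord0 i); last first.
  by apply/funext => x; rewrite mulN1r.
apply: CkM; first exact: Ck_cst.
apply: Ck_sum => i _; apply: CkM; apply: Ck_linear;
  by [exact: coord_continuous|move=> h v x; rewrite !mxE].
Qed.

Lemma bump_ge0 n r x : 0 <= @bump n r x.
Proof. exact: flat_ge0. Qed.

Lemma bump_zero_off n r : 0 <= r -> zero_off (@rV_box R n r) (bump r).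
Proof.
move=> r0 x nb; rewrite /bump /flat ifF//; apply/negbTE; rewrite -leNgt subr_le0.
apply: contra_notT nb; rewrite -ltNge => h i.
rewrite -(@ler_pXn2r _ 2)// ?nnegrE// real_normK ?num_real//.
apply: ltW; apply: le_lt_trans h; rewrite (bigD1 i)//= expr2 lerDl.
by apply: sumr_ge0 => j _; rewrite -expr2 sqr_ge0.
Qed.

(** A box of half-side r/(n+1) lies well inside the Euclidean ball of radius r: n r^2/(n+1)^2 <= r^2
    - r^2/(n+1). Dividing by n+1 also covers dimension 0. The bound makes the integral of the bump
    positive. *)
Lemma bump_ge n (r rho : R) x : 0 < r -> rho = r / n.+1%:R -> rV_box rho x ->
  flat 0 (r ^+ 2 / n.+1%:R) <= @bump n r x.
Proof.
move=> r0 rhoE xb.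
have N0 : 0 < n.+1%:R :> R by rewrite ltr0n.
have t0 : 0 < r ^+ 2 / n.+1%:R by rewrite divr_gt0// exprn_gt0.
have t1 : r ^+ 2 / n.+1%:R <= r ^+ 2 - \sum_i x ord0 i * x ord0 i.
  have : \sum_i x ord0 i * x ord0 i <= \sum_(i < n) rho ^+ 2.
    apply: ler_sum => i _; rewrite -expr2 -(real_normK (num_real _)).
    rewrite lerXn2r// nnegrE// rhoE divr_ge0// ltW//.
  rewrite sumr_const card_ord -[rho ^+ 2 *+ n]mulr_natr => h.
  have NE : n.+1%:R = n%:R + 1 :> R by rewrite -natr1.
  have n0 : 0 <= n%:R :> R by [].
  have e : r ^+ 2 - (r ^+ 2 / n.+1%:R + rho ^+ 2 * n%:R) =
      r ^+ 2 * n%:R ^+ 2 / n.+1%:R ^+ 2.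
    by rewrite rhoE NE; field; rewrite -NE (gt_eqF N0).
  have : 0 <= r ^+ 2 * n%:R ^+ 2 / n.+1%:R ^+ 2.
    by apply: divr_ge0; [apply: mulr_ge0|]; exact: sqr_ge0.
  rewrite -e subr_ge0 => h2; rewrite lerBrDr; apply: le_trans h2.
  by rewrite lerD2l.
rewrite /bump /flat t0 (lt_le_trans t0 t1) !expr0 !mul1r ler_expR lerN2.
by rewrite lef_pV2// posrE// (lt_le_trans t0).
Qed.

Lemma bump_integrable n r : 0 < r ->
  (mu n).-integrable setT (EFin \o bump r).
Proof.
move=> r0; apply: (Cc_integrable (@compact_rV_box R n r)).
  exact: Ck_continuous (bump_Ck n r 0).
by apply: bump_zero_off; exact: ltW.
Qed.

Lemma bump_integral_gt0 n r : 0 < r -> 0 < \int[mu n]_x bump r x.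
Proof.
move=> r0; pose rho := r / n.+1%:R; pose c := flat 0 (r ^+ 2 / n.+1%:R).
have rho0 : 0 < rho by rewrite divr_gt0.
have c0 : 0 < c.
  have t0 : 0 < r ^+ 2 / n.+1%:R by rewrite divr_gt0// exprn_gt0.
  by rewrite /c /flat t0 expr0 mul1r expR_gt0.
have mB : measurable (@rV_box R n rho).
  by apply: closed_measurable_rV; exact: closed_rV_box.
have B : \int[mu n]_(x in rV_box rho) c = c * (rho *+ 2) ^+ n.
  by rewrite Rintegral_cst// [X in fine X](lebesgue_rV_box n (ltW rho0)).
have : 0 < \int[mu n]_(x in rV_box rho) c.
  by rewrite B mulr_gt0// exprn_gt0// pmulrn_lgt0.
move/lt_le_trans; apply.
have ib := bump_integrable n r0.
apply: (@le_trans _ _ (\int[mu n]_(x in rV_box rho) bump r x)).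
  apply: le_Rintegral => //.
  - exact: (@L1loc_cst R n setT c _ (@compact_rV_box R n rho) (@subsetT _ _)).
  - by apply: integrableS ib.
  - by move=> x xb; exact: bump_ge xb.
rewrite Rintegral_mkcond; apply: le_Rintegral => //.
  rewrite -restrict_EFin -integrable_mkcond//; exact: integrableS ib.
move=> x _; rewrite patchE; case: ifP => // _; exact: bump_ge0.
Qed.

End fubini_bump.

(** * Translations and left-invariant fields of a stratified group *)

Lemma reshape_index_cons d s i :
  reshape_index (d :: s) i = if (i < d)%N then 0%N else (reshape_index s (i - d)).+1.
Proof.
rewrite /reshape_index /=; case: ltnP => di.
  by have -> : (i.+1 - d == 0)%N by rewrite subn_eq0.
by rewrite subSn.
Qed.

(** A later coordinate lies in the same layer or a higher one; this converts triangularity by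
    weights into triangularity by indices. *)
Lemma reshape_index_mono s : {homo reshape_index s : i j / (i <= j)%N}.
Proof.
elim: s => [|d s IH] i j ij //; rewrite !reshape_index_cons.
case: (ltnP i d) => // di; rewrite [(j < d)%N]ltnNge (leq_trans di ij)/= ltnS.
by apply: IH; rewrite leq_sub2r.
Qed.

Section stratified.
Variables (R : realType) (s : seq nat) (G : stratified_group R s).
Local Notation n := (sumn s).
Local Notation op := (sg_op G).
Local Notation inv := (sg_inv G).
Local Notation rV := 'rV[R]_n.
Local Notation wt := (fun i : 'I_n => (reshape_index s i).+1).
Local Notation ee i := (delta_mx ord0 i : rV).

Lemma cvg_rV m (T : Type) (F : set_system T) (f : T -> 'rV[R]_m) (l : 'rV[R]_m) :
  Filter F -> (forall j, f x ord0 j @[x --> F] --> l ord0 j) -> f x @[x --> F] --> l.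
Proof.
move=> FF fl; apply/cvgrPdist_le => e e0; near=> x.
rewrite [leLHS]/Num.Def.normr/= mx_normrE; apply: (bigmax_le _ (ltW e0)) => -[i j] _ /=.
rewrite !mxE (ord1 i); move: j; near: x; apply: filter_forall => j.
by move/cvgrPdist_le : (fl j) => /(_ _ e0).
Unshelve. all: by end_near. Qed.

Lemma sg_inv0 : inv 0 = 0.
Proof. by have := sg_opVx G 0; rewrite sg_opx0. Qed.

Lemma sg_inv_unique x y : op x y = 0 -> y = inv x.
Proof.
move=> xy; rewrite -[LHS](sg_op0x G) -(sg_opVx G x) -sg_opA xy; exact: sg_opx0.
Qed.

Lemma sg_invK : involutive inv.
Proof. by move=> x; apply/esym/sg_inv_unique; rewrite sg_opVx. Qed.

Lemma dilation_inv (l : R) x : 0 < l -> inv (dilation l x) = dilation l (inv x).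
Proof.
move=> l0; apply/esym/sg_inv_unique; rewrite -sg_dilation// sg_opxV.
by apply/rowP => i; rewrite !mxE mulr0.
Qed.

Lemma op_Ck j k : Ck k setT (fun z : rV * rV => op z.1 z.2 ord0 j).
Proof. by apply: (Ck_coord j); exact: sg_op_smooth. Qed.

Lemma inv_Ck j k : Ck k setT (fun z : rV => inv z ord0 j).
Proof. by apply: (Ck_coord j); exact: sg_inv_smooth. Qed.

Lemma inv_continuous : continuous inv.
Proof. exact: Ck_continuous (sg_inv_smooth G 0). Qed.

Lemma op_continuous : continuous (fun z : rV * rV => op z.1 z.2).
Proof. exact: Ck_continuous (sg_op_smooth G 0). Qed.

(** The quotient x z^-1. It is a right translation in its first variable and a measure-preserving
    reflection in its second, so its two partial maps provide every change of variables used
    below. *)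
Definition opV (z : rV * rV) : rV := op z.1 (inv z.2).

Lemma pair_continuous (T U V : topologicalType) (f : T -> U) (g : T -> V) :
  continuous f -> continuous g -> continuous (fun x => (f x, g x)).
Proof. by move=> cf cg x; exact: (cvg_pair (cf x) (cg x)). Qed.

Lemma continuous_pair1 (T U : topologicalType) (y : U) : continuous (fun x : T => (x, y)).
Proof.
move=> x A [[P Q] [/= Px Qy] PQ]; apply: filterS Px => z Pz.
by apply: PQ; split=> //=; exact: nbhs_singleton.
Qed.

Lemma continuous_pair2 (T U : topologicalType) (x : T) : continuous (fun y : U => (x, y)).
Proof.
move=> y A [[P Q] [/= Px Qy] PQ]; apply: filterS Qy => z Qz.
by apply: PQ; split=> //=; exact: nbhs_singleton.
Qed.

Lemma Ck_fst_coord j k : Ck k setT (fun z : rV * rV => z.1 ord0 j).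
Proof.
apply: Ck_linear => [z|h v x]; last by rewrite /= !mxE.
by apply: (@continuous_comp _ _ _ fst (fun x : rV => x ord0 j));
  [exact: cvg_fst|exact: coord_continuous].
Qed.

Lemma Ck_snd (f : rV -> R) k : Ck k setT f -> Ck k setT (fun z : rV * rV => f z.2).
Proof.
by move=> Cf; apply: (Ck_affine (A := snd) (B := snd)) => // z; exact: cvg_snd.
Qed.

Lemma opV_Ck j k : Ck k setT (fun z => opV z ord0 j).
Proof.
apply: (Ck_comp (@coord_system_rV2 R n n) (F := fun z : rV * rV => (z.1, inv z.2))
  _ _ (op_Ck j k)).
  apply: pair_continuous => z; first exact: cvg_fst.
  by apply: (@continuous_comp _ _ _ snd inv); [exact: cvg_snd|exact: inv_continuous].
case=> i; first exact: Ck_fst_coord.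
exact: (Ck_snd (inv_Ck i k)).
Qed.

Lemma opV_continuous : continuous opV.
Proof.
move=> z; apply: cvg_rV => j; exact: (Ck_continuous (opV_Ck j 0)).
Qed.

Lemma opV_dilation (l : R) x z : 0 < l ->
  opV (dilation l x, dilation l z) = dilation l (opV (x, z)).
Proof. by move=> l0; rewrite /opV /= dilation_inv// sg_dilation. Qed.

(* The dilation identity gives [D_e f (X) = l ^+ k * D_e f (dilation l X)] for
   [l > 0]; let [l] tend to 0.  When [k = 0] the factor [0 ^+ 0] is 1. *)
Lemma derive_homogeneous (f : rV * rV -> R) (e : rV * rV) (d k : nat) X :
  Ck 1 setT f ->
  (forall l, 0 < l -> forall x z, f (dilation l x, dilation l z) = l ^+ d * f (x, z)) ->
  (forall l : R, (dilation l e.1, dilation l e.2) = l ^+ (d + k) *: e) ->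
  'D_e f X = 0 ^+ k * 'D_e f 0.
Proof.
move=> Cf hf he.
pose D2 (l : R) (z : rV * rV) := (dilation l z.1, dilation l z.2).
have D2E (l : R) z : D2 l z = (\row_i (l ^+ wt i * z.1 ord0 i), \row_i (l ^+ wt i * z.2 ord0 i)).
  by [].
have eqn (l : R) : 0 < l -> 'D_e f X = l ^+ k * 'D_e f (D2 l X).
  move=> l0.
  have ld0 : l ^+ d != 0 by rewrite expf_neq0// gt_eqF.
  have A (h : R) : D2 l (h *: e + X) = h *: (l ^+ (d + k) *: e) + D2 l X.
    rewrite -he /D2; congr pair; apply/rowP => i; rewrite !mxE; ring.
  have [d1 e1] := is_derive_affine (B := fun=> l ^+ (d + k) *: e) (v := e) A (Ck_derivable Cf).
  have [_ e2] := is_deriveZ (l ^+ (d + k)) (@Ck_derivable _ _ _ _ _ e (D2 l X) Cf).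
  have e3 : 'D_e (f \o D2 l) X = l ^+ d * 'D_e f X.
    rewrite (_ : f \o D2 l = fun z => l ^+ d * f z); last first.
      by apply/funext => -[x z] /=; exact: hf.
    have [_ ->//] := is_deriveM (is_derive_cst (l ^+ d) X e)
      (DeriveDef (@Ck_derivable _ _ _ _ _ e X Cf) erefl).
    by rewrite scaler0 addr0.
  apply: (mulfI ld0); rewrite -e3 e1 e2 exprD mulrA; ring.
pose g (l : R) := l ^+ k * 'D_e f (D2 l X).
have D20 : D2 0 X = 0.
  by rewrite D2E; congr pair; apply/rowP => i; rewrite !mxE expr0n mul0r.
have cD2 : continuous (fun l : R => D2 l X).
  apply: pair_continuous => l; apply: cvg_rV => j; rewrite !mxE;
    under eq_cvg do rewrite mxE;
    by apply: cvgM; [exact: exprn_continuous|exact: cvg_cst].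
have cg : g l @[l --> (0 : R)^'+] --> g 0.
  apply: cvg_at_right_filter; apply: cvgM; first exact: exprn_continuous.
  apply: (@continuous_comp _ _ _ (fun l => D2 l X) ('D_e f)); first exact: cD2.
  exact: (Ck_continuous (@Ck_derive _ _ _ _ _ e Cf)).
have cc : g l @[l --> (0 : R)^'+] --> 'D_e f X.
  apply: cvg_trans (near_eq_cvg _) (cvg_cst ('D_e f X)).
  near=> l; rewrite /= /g -eqn//.
have := cvg_unique (@Rhausdorff R) cc cg.
by move=> ->; rewrite /g D20.
Unshelve. all: by end_near. Qed.

Lemma opV0 x : opV (x, 0) = x.
Proof. by rewrite /opV /= sg_inv0 sg_opx0. Qed.

Lemma opVV x : opV (x, x) = 0.
Proof. by rewrite /opV /= sg_opxV. Qed.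

Lemma opV_homogeneous (j : 'I_n) (l : R) : 0 < l -> forall x z,
  opV (dilation l x, dilation l z) ord0 j = l ^+ wt j * opV (x, z) ord0 j.
Proof. by move=> l0 x z; rewrite opV_dilation// mxE. Qed.

Lemma dilation_delta (l : R) i : dilation l (ee i) = l ^+ wt i *: ee i.
Proof.
apply/rowP => j; rewrite !mxE eqxx /=.
by have [->|] := eqVneq j i; rewrite ?mulr0.
Qed.

Lemma dilation0 (l : R) : dilation l 0 = 0 :> rV.
Proof. by apply/rowP => i; rewrite !mxE mulr0. Qed.

(** The j-th coordinate is homogeneous of degree [wt j], so its derivative in the i-th variable has
    degree [wt j - wt i], which is not positive. Smoothness at the origin forces it to be constant
    when the weights agree and zero otherwise; the constant is read off from x 0^-1 = x. *)
Lemma derive_opV1 i j X : (wt j <= wt i)%N ->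
  'D_(ee i, 0) (fun z => opV z ord0 j) X = (i == j)%:R.
Proof.
move=> wji.
rewrite (derive_homogeneous (d := wt j) (k := wt i - wt j) _ (opV_Ck j 1)
  (opV_homogeneous j)); last first.
  move=> l; rewrite /= dilation0 dilation_delta subnKC//.
  by rewrite -[RHS]/(_, _) /= scaler0.
have D0 : 'D_(ee i, 0) (fun z => opV z ord0 j) 0 = (i == j)%:R.
  have [_ <-] := @slice_derive R rV n (fun z => opV z ord0 j) 0 0 (ee i)
    (Ck_derivable (opV_Ck j 1)).
  rewrite (_ : (fun x => _) = fun x : rV => x ord0 j); last first.
    by apply/funext => x; rewrite opV0.
  have lin (h : R) (v x : rV) : (h *: v + x) ord0 j = h * v ord0 j + x ord0 j.
    by rewrite !mxE.
  by have [_ ->] := is_derive_linear 0 (ee i) lin; rewrite mxE eqxx eq_sym.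
rewrite D0; move: wji; rewrite leq_eqVlt => /orP[/eqP ->|wji].
  by rewrite subnn expr0 mul1r.
rewrite expr0n subn_eq0 leqNgt wji /= mul0r.
by case: eqVneq wji => [->|//]; rewrite ltnn.
Qed.

(** On the diagonal x x^-1 is constant, so the derivative in the second variable is minus the one in
    the first. This avoids expanding the group inverse. *)
Lemma derive_opV_diag i j X : (wt j <= wt i)%N ->
  'D_(ee i, ee i) (fun z => opV z ord0 j) X = 0.
Proof.
move=> wji.
rewrite (derive_homogeneous (d := wt j) (k := wt i - wt j) _ (opV_Ck j 1)
  (opV_homogeneous j)); last by move=> l; rewrite /= dilation_delta subnKC.
have [_ <-] := @is_derive_affine R _ _ _ (fun z => opV z ord0 j)
  (fun x => (x, x)) (fun x => (x, x)) (0 : rV) (ee i) (fun=> erefl)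
  (Ck_derivable (opV_Ck j 1)).
rewrite (_ : _ \o _ = cst 0) ?derive_cst ?mulr0//.
by apply/funext => x /=; rewrite opVV mxE.
Qed.

Lemma derive_opV2 i j X : (wt j <= wt i)%N ->
  'D_(0, ee i) (fun z => opV z ord0 j) X = - (i == j)%:R.
Proof.
move=> wji; have := derive_opV_diag X wji.
rewrite (_ : (ee i, ee i) = (ee i, 0) + (0, ee i)); last first.
  by rewrite -[RHS]/(_, _) addr0 add0r.
have [_ ->] := is_deriveDv X (ee i, 0) (0, ee i) (opV_Ck j 1).
by rewrite derive_opV1// => /eqP; rewrite addr_eq0 => /eqP ->; rewrite opprK.
Qed.

Lemma wt_mono (i j : 'I_n) : (i <= j)%N -> (wt i <= wt j)%N.
Proof. by rewrite ltnS; exact: reshape_index_mono. Qed.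

(** Mean value theorem from [x] to [y]. In the expansion of the derivative, indices below [j]
    contribute nothing because the coordinates agree, [j] itself has coefficient 1, and indices
    above [j] have vanishing derivative by their weight. *)
Lemma triangular_opV1 z : triangular 1 (fun x => opV (x, z)).
Proof.
move=> j x y xy.
have [c _] := @line_MVT R _ (fun z => opV z ord0 j) (x, z) (y - x, 0)
  (fun X => Ck_derivable (opV_Ck j 1)).
have -> : (y - x, 0) + (x, z) = (y, z) by rewrite -[LHS]/(_, _) subrK add0r.
rewrite (derive_coord _ _ (@coord_system_rV2 R n n) (opV_Ck j 1)) big_sumType /=.
rewrite [X in _ = _ + X]big1 => [|i _]; last by rewrite mxE mul0r.
rewrite addr0 (bigD1 j)//= derive_opV1// eqxx mulr1 big1 => [|i ij]; last first.
  case: (ltnP i j) => [ltij|leji].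
    by rewrite !mxE xy// subrr mul0r.
  by rewrite derive_opV1 ?wt_mono// (negbTE ij) mulr0.
by rewrite !mxE addr0 => /eqP; rewrite subr_eq => /eqP ->; ring.
Qed.

Lemma triangular_opV2 x : triangular (-1) (fun z => opV (x, z)).
Proof.
move=> j y z yz.
have [c _] := @line_MVT R _ (fun z => opV z ord0 j) (x, y) (0, z - y)
  (fun X => Ck_derivable (opV_Ck j 1)).
have -> : (0, z - y) + (x, y) = (x, z) by rewrite -[LHS]/(_, _) subrK add0r.
rewrite (derive_coord _ _ (@coord_system_rV2 R n n) (opV_Ck j 1)) big_sumType /=.
rewrite [X in _ = X + _]big1 => [|i _]; last by rewrite mxE mul0r.
rewrite add0r (bigD1 j)//= derive_opV2// eqxx mulrN1 big1 => [|i ij]; last first.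
  case: (ltnP i j) => [ltij|leji].
    by rewrite !mxE yz// subrr mul0r.
  by rewrite derive_opV2 ?wt_mono// (negbTE ij) oppr0 mulr0.
by rewrite !mxE addr0 => /eqP; rewrite subr_eq => /eqP ->; ring.
Qed.

Lemma sgX_coordE k x j :
  sgX G k x ord0 j = 'D_(0, ee k) (fun z : rV * rV => op z.1 z.2 ord0 j) (x, 0).
Proof.
have hA (h : R) : (x, h *: ee k + 0) = h *: (0, ee k) + (x, 0) :> rV * rV.
  by rewrite -[RHS]/(_, _) /= scaler0 add0r.
have dA : derivable (op x) 0 (ee k).
  by have [] := @is_derive_affine R _ _ _ (fun z : rV * rV => op z.1 z.2)
    (fun y => (x, y)) (fun v => (0, v)) (0 : rV) (ee k) hA
    (Ck_derivable (sg_op_smooth G 1)).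
rewrite /sgX /left_basis_field (derive_mx dA) mxE.
by have [_ <-] := @is_derive_affine R _ _ _ (fun z : rV * rV => op z.1 z.2 ord0 j)
  (fun y => (x, y)) (fun v => (0, v)) (0 : rV) (ee k) hA (Ck_derivable (op_Ck j 1)).
Qed.

Lemma sgX_Ck k j m : Ck m setT (fun x => sgX G k x ord0 j).
Proof.
rewrite (_ : (fun x => _) = ('D_(0, ee k) (fun z : rV * rV => op z.1 z.2 ord0 j))
    \o (fun x => (x, 0))); last by apply/funext => x; rewrite sgX_coordE.
apply: (Ck_affine (B := fun v => (v, 0))).
- by move=> h v x; rewrite -[RHS]/(_, _) /= scaler0 addr0.
- exact: continuous_pair1.
- by apply: Ck_derive; exact: op_Ck.
Qed.

(* [sgX G k] does not depend on the [j]-th variable in its [j]-th coordinate, since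
   right translations are triangular. *)
Lemma sgX_div k j x : 'D_(ee j) (fun y => sgX G k y ord0 j) x = 0.
Proof.
have inv_t (h : R) : sgX G k (h *: ee j + x) ord0 j = sgX G k x ord0 j.
  have dE y : derivable (op y) 0 (ee k).
    have hA (l : R) : (y, l *: ee k + 0) = l *: (0, ee k) + (y, 0) :> rV * rV.
      by rewrite -[RHS]/(_, _) /= scaler0 add0r.
    by have [] := @is_derive_affine R _ _ _ (fun z : rV * rV => op z.1 z.2)
      (fun z => (y, z)) (fun v => (0, v)) (0 : rV) (ee k) hA
      (Ck_derivable (sg_op_smooth G 1)).
  rewrite /sgX /left_basis_field !(derive_mx (dE _)) !mxE.
  have -> : (fun t => op (h *: ee j + x) t ord0 j) = fun t => op x t ord0 j + h.
    (* Right multiplication by [t] is [opV (_, inv t)], hence triangular with diagonal 1: moving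
       along [ee j] merely adds [h] to coordinate [j]. *)
    apply/funext => t; have := @triangular_opV1 (inv t) j (h *: ee j + x) x.
    rewrite /opV /= sg_invK !mxE !eqxx mulr1 => T.
    have : op (h *: ee j + x) t ord0 j - 1 * (h + x ord0 j) = op x t ord0 j - 1 * x ord0 j.
      apply: T => i ij; rewrite !mxE (_ : i == j = false) ?mulr0 ?add0r//.
      by apply/negbTE; rewrite neq_ltn ij.
    by rewrite !mul1r => /eqP; rewrite subr_eq => /eqP ->; ring.
  rewrite deriveD// ?derive_cst ?addr0//.
  by have /derivable_mxP := dE x; exact.
rewrite derive_lineE (_ : (fun t => _) = cst (sgX G k x ord0 j)) ?derive_cst//.
by apply/funext => t; rewrite inv_t.
Qed.

(** Left invariance in coordinates: by associativity [op (op y z)] is [op y] after [op z], and the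
    chain rule is applied at 0. *)
Lemma sgX_left k y z j :
  sgX G k (op y z) ord0 j =
  \sum_i sgX G k z ord0 i * 'D_(ee i) (fun t => op y t ord0 j) z.
Proof.
have dE a t i : derivable (op a) t (ee i).
  have hA (h : R) : (a, h *: ee i + t) = h *: (0, ee i) + (a, t) :> rV * rV.
    by rewrite -[RHS]/(_, _) /= scaler0 add0r.
  by have [] := @is_derive_affine R _ _ _ (fun z : rV * rV => op z.1 z.2)
    (fun z => (a, z)) (fun v => (0, v)) t (ee i) hA
    (Ck_derivable (sg_op_smooth G 1)).
have dEj a t i l : derivable (fun x => op a x ord0 l) t (ee i).
  by have /derivable_mxP := dE a t i; exact.
have Cy : Ck 1 setT (fun t => op y t ord0 j).
  apply: (Ck_affine (f := fun z : rV * rV => op z.1 z.2 ord0 j)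
    (A := fun t => (y, t)) (B := fun v => (0, v))).
  - by move=> h v x; rewrite -[RHS]/(_, _) /= scaler0 add0r.
  - exact: continuous_pair2.
  - exact: op_Ck.
rewrite /sgX /left_basis_field !(derive_mx (dE _ _ _)) !mxE.
rewrite (_ : (fun t => _) = (fun t => op y t ord0 j) \o (op z)); last first.
  by apply/funext => t /=; rewrite sg_opA.
have cz : {for 0, continuous (op z)}.
  apply: (@continuous_comp _ _ _ (fun t => (z, t)) (fun z : rV * rV => op z.1 z.2)).
    exact: continuous_pair2.
  exact: op_continuous.
have [_ ->] := is_derive_chain (@coord_system_rV R n) Cy cz (dEj z 0 k).
apply: eq_bigr => i _; rewrite sg_opx0; congr (_ * _).
by rewrite mxE.
Qed.

End stratified.

(** * Integration by parts *)

Section smooth_functions.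
Variables (R : realType) (n : nat).
Local Notation rV := 'rV[R]_n.
Implicit Types (f g : rV -> R) (K : set rV).
Local Notation mu := (lebesgue_rV R n).
Local Notation ee i := (delta_mx ord0 i : rV).

Local Notation smooth f := (smooth_on [set: rV] f).

Lemma smooth_cst (a : R) : smooth (fun _ : rV => a).
Proof. by move=> k; exact: Ck_cst. Qed.

Lemma smoothD f g : smooth f -> smooth g -> smooth (fun x => f x + g x).
Proof. by move=> sf sg k; apply: CkD. Qed.

Lemma smoothM f g : smooth f -> smooth g -> smooth (fun x => f x * g x).
Proof. by move=> sf sg k; apply: CkM. Qed.

Lemma smooth_sum (I : Type) (r : seq I) (P : pred I) (f : I -> rV -> R) :
  (forall i, P i -> smooth (f i)) -> smooth (fun x => \sum_(i <- r | P i) f i x).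
Proof. by move=> sf k; apply: Ck_sum => i Pi; exact: sf. Qed.

Lemma smooth_powR f (a : R) : (forall x, 0 < f x) -> smooth f -> smooth (fun x => f x `^ a).
Proof. by move=> f0 sf k; apply: Ck_powR. Qed.

Lemma smooth_derive f v : smooth f -> smooth ('D_v f).
Proof. by move=> sf k; exact: Ck_derive (sf k.+1). Qed.

Lemma smooth_continuous f : smooth f -> continuous f.
Proof. by move=> sf; exact: Ck_continuous (sf 0%N). Qed.

Lemma derive_zero_off K f v : closed K -> zero_off K f -> zero_off K ('D_v f).
Proof.
move=> cK f0 x nKx.
rewrite (@near_eq_derive _ _ _ _ (cst 0)) ?derive_cst//.
have : nbhs x (~` K) by apply: open_nbhs_nbhs; split=> //; exact: closed_openC.
by apply: filterS => y; exact: f0.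
Qed.

Lemma continuousM_fun f g : continuous f -> continuous g -> continuous (fun x => f x * g x).
Proof. by move=> cf cg x; exact: (cvgM (cf x) (cg x)). Qed.

Definition test K f := smooth f /\ zero_off K f.

Lemma testD K f g : test K f -> test K g -> test K (fun x => f x + g x).
Proof.
move=> [sf f0] [sg g0]; split; first exact: smoothD.
by move=> x nK; rewrite f0// g0// addr0.
Qed.

Lemma testMr K f g : smooth f -> test K g -> test K (fun x => f x * g x).
Proof.
move=> sf [sg g0]; split; first exact: smoothM.
by move=> x nK; rewrite g0// mulr0.
Qed.

Lemma test_derive K f v : closed K -> test K f -> test K ('D_v f).
Proof.
by move=> cK [sf f0]; split; [exact: smooth_derive|exact: derive_zero_off].
Qed.

Lemma test_integrable K f : compact K -> test K f -> mu.-integrable setT (EFin \o f).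
Proof.
by move=> cK [sf f0]; apply: Cc_integrable cK _ f0; exact: smooth_continuous.
Qed.

Lemma test_Cc_infty K (Omega : set rV) f : compact K -> K `<=` Omega -> test K f ->
  Cc_infty Omega f.
Proof.
move=> cK KO [sf f0].
have clK : closed K by exact: compact_closed.
have sub : closure [set x | f x != 0] `<=` K.
  rewrite [X in _ `<=` X](closure_id K).1//; apply: closure_subset => x /= /eqP.
  by apply: contra_notP => /f0.
split=> //; last exact: subset_trans KO.
by apply: subclosed_compact cK sub; exact: closed_closure.
Qed.

Lemma continuous_translation (a : rV) : continuous (fun x : rV => a + x).
Proof.
move=> x; have FF : Filter (nbhs x) by exact: nbhs_filter.
apply: (@cvgD _ _ _ _ FF (cst a) id); [exact: (@cvg_cst _ a _ _ FF)|exact: cvg_id].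
Qed.

(** By translation invariance the integral of F(t e_j + z) over z does not depend on t;
    differentiation under the integral sign at t = 0 gives the claim. *)
Lemma integral_derive0 K F j : compact K -> test K F ->
  \int[mu]_x 'D_(ee j) F x = 0.
Proof.
move=> cK tF; have [sF F0] := tF.
have clK : closed K by exact: compact_closed.
have [M M0 KM] := compact_sub_rV_box cK.
(* The extra 1 leaves room for all translates with |t| <= 1, so that multiplying by the indicator
   [g] of this box changes none of them. *)
pose K' := @rV_box R n (M + 1).
have cK' : compact K' by exact: compact_rV_box.
pose g : rV -> R := (cst (1 : R) : rV -> R) \_ K'.
have ig : mu.-integrable setT (EFin \o g).
  apply: (@L1loc_integrable_restrict R n setT K' (cst 1)) => //.
  exact: L1loc_cst.
have g0 : zero_off K' g by move=> x nK; rewrite /g patchN// notin_setE.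
pose A (p : R * rV) := p.1 *: ee j + p.2.
have CH k : Ck k setT (F \o A).
  apply: (Ck_affine (B := A)) (sF k).
    by move=> h v x; rewrite /A /= scalerDr scalerDl scalerA addrACA.
  move=> p; apply: cvgD; last exact: cvg_snd.
  by apply: cvgZr_tmp; exact: cvg_fst.
have [_] := param_derive cK' g0 ig (0 : R) (1 : R) (CH 1).
have mF : measurable_fun setT F.
  by apply: continuous_measurable_rV; exact: smooth_continuous.
have cst_int (t : R) : `|t| <= 1 -> \int[mu]_z ((F \o A) (t, z) * g z) = \int[mu]_z F z.
  move=> t1; rewrite -(@triangular_Rintegral R n 1 (fun z => t *: ee j + z) F) //; last 3 first.
  - by left.
  - apply: continuous_measurable_rVrV => z.
    exact: continuous_translation.
  - by move=> i x y _; rewrite !mxE; ring.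
  apply: eq_Rintegral => z _; rewrite /A /=.
  have [Kz|nKz] := pselect (K' z); first by rewrite /g patchE mem_set// mulr1.
  rewrite g0// mulr0 F0// => Kz; apply: nKz => i.
  have := KM _ Kz i; rewrite !mxE eqxx /= => h.
  have -> : z ord0 i = (t * (i == j)%:R + z ord0 i) - t * (i == j)%:R :> R by ring.
  apply: le_trans (ler_normB _ _) _; apply: lerD; first exact: h.
  by rewrite normrM; case: (i == j); rewrite ?normr1 ?normr0 ?mulr1 ?mulr0.
rewrite (@near_eq_derive _ _ _ _ (cst (\int[mu]_z F z))) ?derive_cst; last first.
  near=> t; apply: cst_int; near: t.
  exact: (@nbhs0_le _ R^o 1).
move=> /esym <-; apply: eq_Rintegral => z _.
have hA (h : R) : A (h *: (1, 0) + (0, z)) = h *: ee j + z.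
  by rewrite /A /= [h *: 1]mulr1 scaler0 addr0 add0r.
have hA0 : A (0, z) = z by rewrite /A /= scale0r add0r.
have [_ ->] := @is_derive_affine R _ _ _ F A (fun=> ee j) (0, z) (1, 0)
  (fun h => etrans (hA h) (congr1 _ (esym hA0))) (Ck_derivable (sF 1)).
rewrite hA0; have [Kz|nKz] := pselect (K' z); first by rewrite /g patchE mem_set// mulr1.
rewrite g0// mulr0 (derive_zero_off _ clK F0)// => Kz; apply: nKz => i.
by apply: le_trans (KM _ Kz i) _; rewrite lerDl.
Unshelve. all: by end_near. Qed.

End smooth_functions.

Lemma Rintegral_sum d (T : measurableType d) (R : realType) (mu : {measure set T -> \bar R})
    (I : Type) (r : seq I) (P : pred I) (f : I -> T -> R) :
  (forall i, P i -> mu.-integrable setT (EFin \o f i)) ->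
  mu.-integrable setT (EFin \o (fun x => \sum_(i <- r | P i) f i x)) /\
  \int[mu]_x (\sum_(i <- r | P i) f i x) = \sum_(i <- r | P i) \int[mu]_x f i x.
Proof.
move=> fi; elim: r => [|i r [IH1 IH2]].
  have e : (fun x => \sum_(i <- [::] | P i) f i x) = cst 0.
    by apply/funext => x; rewrite big_nil.
  rewrite e big_nil; split; first exact: integrable0.
  by rewrite Rintegral_cst// mul0r.
have e : (fun x => \sum_(i <- i :: r | P i) f i x) =
    fun x => (if P i then f i x else 0) + \sum_(i <- r | P i) f i x.
  by apply/funext => x; rewrite big_cons; case: ifP => // _; rewrite add0r.
have i1 : mu.-integrable setT (EFin \o (fun x => if P i then f i x else 0)).
  by case Pi : (P i); [exact: fi|exact: integrable0].
rewrite e big_cons; split.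
  by have := integrableD measurableT i1 IH1; apply: eq_integrable.
rewrite RintegralD// IH2; case: ifP => Pi //.
by rewrite (_ : \int[mu]_x 0 = 0) ?add0r// Rintegral_cst// mul0r.
Qed.

Section horizontal.
Variables (R : realType) (s : seq nat) (G : stratified_group R s).
Local Notation n := (sumn s).
Local Notation N := (head 0%N s).
Local Notation op := (sg_op G).
Local Notation rV := 'rV[R]_n.
Local Notation mu := (lebesgue_rV R n).
Local Notation ee i := (delta_mx ord0 i : rV).
Local Notation smooth f := (smooth_on [set: rV] f).
Implicit Types (f g : rV -> R) (K : set rV) (k j : 'I_n).

Definition XD k f : rV -> R := fun x => 'D_(sgX G k x) f x.

Lemma XDE k f x : Ck 1 setT f -> XD k f x = \sum_j sgX G k x ord0 j * 'D_(ee j) f x.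
Proof. by move=> Cf; rewrite /XD (derive_coord _ _ (@coord_system_rV R n) Cf). Qed.

Lemma smooth_XD k f : smooth f -> smooth (XD k f).
Proof.
move=> sf; rewrite (_ : XD k f = fun x => \sum_j sgX G k x ord0 j * 'D_(ee j) f x).
  apply: smooth_sum => j _; apply: smoothM; last exact: smooth_derive.
  by move=> m; exact: sgX_Ck.
by apply/funext => x; rewrite XDE//; exact: sf.
Qed.

Lemma XDD k f g x : smooth f -> smooth g ->
  XD k (fun x => f x + g x) x = XD k f x + XD k g x.
Proof.
by move=> sf sg; apply: deriveD; [exact: Ck_derivable (sf 1)|exact: Ck_derivable (sg 1)].
Qed.

Lemma XDM k f g x : smooth f -> smooth g ->
  XD k (fun x => f x * g x) x = f x * XD k g x + g x * XD k f x.
Proof.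
by move=> sf sg; apply: deriveM; [exact: Ck_derivable (sf 1)|exact: Ck_derivable (sg 1)].
Qed.

Lemma XD_cst k a x : XD k (fun=> a) x = 0.
Proof. exact: derive_cst. Qed.

Lemma XDZ k a f x : smooth f -> XD k (fun x => a * f x) x = a * XD k f x.
Proof.
by move=> sf; rewrite XDM ?XD_cst ?mulr0 ?addr0//; exact: smooth_cst.
Qed.

Lemma XD_powR k f a x : (forall x, 0 < f x) -> smooth f ->
  XD k (fun x => f x `^ a) x = a * f x `^ (a - 1) * XD k f x.
Proof.
move=> f0 sf.
by have [_] := is_derive_comp1 (@Ck_derivable _ _ _ _ _ (sgX G k x) x (sf 1))
  (is_derive1_powR a (f0 x)).
Qed.

Lemma XD_zero_off k K f : closed K -> zero_off K f -> zero_off K (XD k f).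
Proof. by move=> cK f0 x nK; exact: (derive_zero_off _ cK f0). Qed.

Lemma test_XD k K f : closed K -> test K f -> test K (XD k f).
Proof.
by move=> cK [sf f0]; split; [exact: smooth_XD|exact: XD_zero_off].
Qed.

(** The j-th coefficient of the field does not depend on the j-th variable, so the field is
    divergence free and [XD G k f] is a divergence. Hence its formal adjoint is its negative. *)
Lemma XD_divE k f x : smooth f ->
  XD k f x = \sum_j 'D_(ee j) (fun y => sgX G k y ord0 j * f y) x.
Proof.
move=> sf; rewrite XDE; last exact: sf.
apply: eq_bigr => j _; rewrite (@deriveM _ _ (fun y => sgX G k y ord0 j) f).
- by rewrite sgX_div scaler0 addr0.
- exact: Ck_derivable (sgX_Ck G k j 1).
- exact: Ck_derivable (sf 1).
Qed.

Lemma integral_XD0 k K f : compact K -> test K f -> \int[mu]_x XD k f x = 0.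
Proof.
move=> cK tf; have [sf f0] := tf.
have tj j : test K (fun y => sgX G k y ord0 j * f y).
  by apply: testMr => // m; exact: sgX_Ck.
have clK : closed K by exact: compact_closed.
under eq_Rintegral do rewrite XD_divE//.
have [|_ ->] := @Rintegral_sum _ _ R mu _ (index_enum 'I_n) xpredT
  (fun j x => 'D_(ee j) (fun y => sgX G k y ord0 j * f y) x).
  move=> j _; apply: (test_integrable cK); exact: test_derive.
by apply: big1 => j _; exact: integral_derive0 cK (tj j).
Qed.

Lemma integral_XD_parts k K f g : compact K -> test K f -> smooth g ->
  \int[mu]_x (f x * XD k g x) = - \int[mu]_x (XD k f x * g x).
Proof.
move=> cK tf sg; have [sf f0] := tf; have clK : closed K by exact: compact_closed.
have t1 : test K (fun x => XD k g x * f x) by apply: testMr => //; exact: smooth_XD.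
have t2 : test K (fun x => g x * XD k f x) by apply: testMr => //; exact: test_XD.
have := integral_XD0 k cK (testMr sg tf).
under eq_Rintegral do rewrite XDM//.
rewrite RintegralD//; [|exact: (test_integrable cK)|]; last first.
  apply: (test_integrable cK); move: t1; congr test; apply/funext => x; exact: mulrC.
rewrite addrC => /eqP; rewrite addr_eq0 => /eqP ->; congr (- _).
by apply: eq_Rintegral => x _; rewrite mulrC.
Qed.

Lemma XD_left k f y z : smooth f -> XD k (f \o op y) z = XD k f (op y z).
Proof.
move=> sf.
have Cy j m : Ck m setT (fun t => op y t ord0 j).
  apply: (Ck_affine (f := fun z : rV * rV => op z.1 z.2 ord0 j)
    (A := fun t => (y, t)) (B := fun v => (0, v))).
  - by move=> h v x; rewrite -[RHS]/(_, _) /= scaler0 add0r.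
  - exact: continuous_pair2.
  - exact: op_Ck.
have cy : continuous (op y).
  move=> t; apply: (@continuous_comp _ _ _ (fun t => (y, t)) (fun z : rV * rV => op z.1 z.2)).
    exact: continuous_pair2.
  exact: op_continuous.
have Cfy : Ck 1 setT (f \o op y).
  apply: (Ck_comp (@coord_system_rV R n)) (sf 1) => // i; exact: Cy.
rewrite (XDE _ _ Cfy) (XDE _ _ (sf 1)).
under [RHS]eq_bigr do rewrite sgX_left mulr_suml.
rewrite exchange_big /=; apply: eq_bigr => i _.
have [_ ->] := @is_derive_chain R _ _ _ _ _ f (op y) z (ee i) (@coord_system_rV R n) (sf 1)
  (cy z) (fun j => Ck_derivable (Cy j 1%N)).
by rewrite mulr_sumr; apply: eq_bigr => j _; rewrite mulrA.
Qed.

Lemma sublaplacianE f x : sublaplacian G f x = \sum_(k < n | (k < N)%N) XD k (XD k f) x.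
Proof. by []. Qed.

Lemma smooth_sublaplacian f : smooth f -> smooth (sublaplacian G f).
Proof.
move=> sf; apply: smooth_sum => k _; do 2 apply: smooth_XD; exact: sf.
Qed.

Lemma test_sublaplacian K f : closed K -> test K f -> test K (sublaplacian G f).
Proof.
move=> cK tf; split; first exact: smooth_sublaplacian tf.1.
move=> x nK; rewrite sublaplacianE big1// => k _.
by have [_] := test_XD k cK (test_XD k cK tf); exact.
Qed.

(** The smooth coefficients are absorbed into the test functions [psi j], to which the definition of
    weak partial derivatives applies; the divergence form of the field then reassembles
    [XD G k phi]. *)
Lemma weak_vfield_test (Omega : set rV) k f g K phi :
  weak_vfield Omega (sgX G k) f g -> compact K -> K `<=` Omega -> test K phi ->
  \int[mu]_x (g x * phi x) = - \int[mu]_x (f x * XD k phi x).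
Proof.
move=> [gL [D [Dw gae]]] cK KO tphi; have [sphi phi0] := tphi.
have clK : closed K by exact: compact_closed.
pose psi j := fun x => sgX G k x ord0 j * phi x.
have tpsi j : test K (psi j) by apply: testMr => // m; exact: sgX_Ck.
have zO (h : rV -> R) (t : rV -> R) : zero_off K t -> zero_off Omega (fun x => h x * t x).
  by move=> t0 x nO; rewrite t0 ?mulr0// => /KO.
have parts j : \int[mu]_x (D j x * psi j x) = - \int[mu]_x (f x * 'D_(ee j) (psi j) x).
  have [_ _ /(_ (psi j) (test_Cc_infty cK KO (tpsi j)))] := Dw j.
  rewrite (Rintegral_zero_off (zO f _ (derive_zero_off (ee j) clK (tpsi j).2))).
  by rewrite (Rintegral_zero_off (zO (D j) _ (tpsi j).2)) => ->; rewrite opprK.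
have iDpsi j : mu.-integrable setT (EFin \o (fun x => D j x * psi j x)).
  have [_ DL _] := Dw j.
  apply: (L1loc_integrableM DL cK KO) (tpsi j).2.
  exact: smooth_continuous (tpsi j).1.
have ifpsi j : mu.-integrable setT (EFin \o (fun x => f x * 'D_(ee j) (psi j) x)).
  have [fL _ _] := Dw j; have [s1 s2] := test_derive (ee j) clK (tpsi j).
  by apply: (L1loc_integrableM fL cK KO) s2; exact: smooth_continuous.
have [i1 e1] := @Rintegral_sum _ _ R mu _ (index_enum 'I_n) xpredT
  (fun j x => D j x * psi j x) (fun j _ => iDpsi j).
have [i2 e2] := @Rintegral_sum _ _ R mu _ (index_enum 'I_n) xpredT
  (fun j x => f x * 'D_(ee j) (psi j) x) (fun j _ => ifpsi j).
have ig : mu.-integrable setT (EFin \o (fun x => g x * phi x)).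
  by apply: (L1loc_integrableM gL cK KO) phi0; exact: smooth_continuous.
transitivity (\int[mu]_x \sum_j (D j x * psi j x)).
  congr fine; apply: ae_eq_integral => //.
  - by case/integrableP: ig.
  - by case/integrableP: i1.
  - apply: filterS gae => x gx _; congr EFin.
    have [Ox|nO] := pselect (Omega x).
      rewrite gx// mulr_suml; apply: eq_bigr => j _; rewrite /psi; ring.
    have nK : ~ K x by move/KO.
    rewrite phi0// mulr0 big1// => j _; by rewrite /psi phi0// !mulr0.
rewrite e1 (eq_bigr _ (fun j _ => parts j)) sumrN -e2; congr (- _).
apply: eq_Rintegral => x _; rewrite XD_divE// mulr_sumr; exact: eq_bigr.
Qed.

Lemma weak_sublaplacian_test (Omega : set rV) f h K phi :
  weak_sublaplacian G Omega f h -> compact K -> K `<=` Omega -> test K phi ->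
  \int[mu]_x (f x * sublaplacian G phi x) = \int[mu]_x (h x * phi x).
Proof.
move=> [hL [Xf [XXf [Xw hae]]]] cK KO tphi; have [sphi phi0] := tphi.
have clK : closed K by exact: compact_closed.
have iX k : (k < N)%N -> mu.-integrable setT (EFin \o (fun x => XXf k x * phi x)).
  move=> kN; have [_ [gL _]] := Xw k kN.
  by apply: (L1loc_integrableM gL cK KO) phi0; exact: smooth_continuous.
have iF k : (k < N)%N -> mu.-integrable setT (EFin \o (fun x => f x * XD k (XD k phi) x)).
  move=> kN; have [[_ [D [Dw _]]] _] := Xw k kN; have [fL _ _] := Dw k.
  have [s1 s2] := test_XD k clK (test_XD k clK tphi).
  by apply: (L1loc_integrableM fL cK KO) s2; exact: smooth_continuous.
have [i1 e1] := @Rintegral_sum _ _ R mu _ (index_enum 'I_n) (fun k : 'I_n => k < N)%N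
  (fun k x => XXf k x * phi x) iX.
have [i2 e2] := @Rintegral_sum _ _ R mu _ (index_enum 'I_n) (fun k : 'I_n => k < N)%N
  (fun k x => f x * XD k (XD k phi) x) iF.
have ih : mu.-integrable setT (EFin \o (fun x => h x * phi x)).
  by apply: (L1loc_integrableM hL cK KO) phi0; exact: smooth_continuous.
transitivity (\int[mu]_x \sum_(k < n | (k < N)%N) (XXf k x * phi x)); last first.
  congr fine; apply: ae_eq_integral => //.
  - by case/integrableP: i1.
  - by case/integrableP: ih.
  - apply: filterS hae => x hx _; congr EFin.
    have [Ox|nO] := pselect (Omega x); first by rewrite hx// mulr_suml.
    have nK : ~ K x by move/KO.
    by rewrite phi0// mulr0 big1// => j _; rewrite mulr0.
rewrite e1; transitivity (\sum_(k < n | (k < N)%N) \int[mu]_x (f x * XD k (XD k phi) x)).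
  rewrite -e2; apply: eq_Rintegral => x _; by rewrite sublaplacianE mulr_sumr.
apply: eq_bigr => k kN; have [w1 w2] := Xw k kN.
rewrite (weak_vfield_test w2 cK KO tphi) (weak_vfield_test w1 cK KO (test_XD k clK tphi)).
by rewrite opprK.
Qed.

End horizontal.

(** * Mollification of superharmonic functions *)

Section mollification.
Variables (R : realType) (s : seq nat) (G : stratified_group R s).
Local Notation n := (sumn s).
Local Notation N := (head 0%N s).
Local Notation op := (sg_op G).
Local Notation inv := (sg_inv G).
Local Notation opV := (opV G).
Local Notation rV := 'rV[R]_n.
Local Notation mu := (lebesgue_rV R n).
Local Notation smooth f := (smooth_on [set: rV] f).
Local Notation L := (sublaplacian G).

Lemma op_opV x z : op (opV (x, z)) z = x.
Proof. by rewrite /opV /= -sg_opA sg_opVx sg_opx0. Qed.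

Lemma opVK x z : op (inv (opV (x, z))) x = z.
Proof. by rewrite -[X in op _ X](op_opV x z) sg_opA sg_opVx sg_op0x. Qed.

Lemma op_invK y z : op (inv y) (op y z) = z.
Proof. by rewrite sg_opA sg_opVx sg_op0x. Qed.

Lemma continuous_opV1 z : continuous (fun x => opV (x, z)).
Proof.
move=> x; apply: (@continuous_comp _ _ _ (fun x => (x, z)) opV).
  exact: continuous_pair1.
exact: opV_continuous.
Qed.

Lemma continuous_opV2 x : continuous (fun z => opV (x, z)).
Proof.
move=> z; apply: (@continuous_comp _ _ _ (fun z => (x, z)) opV).
  exact: continuous_pair2.
exact: opV_continuous.
Qed.

Lemma integral_opV1 (f : rV -> R) z : continuous f ->
  \int[mu]_x f (opV (x, z)) = \int[mu]_y f y.
Proof.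
move=> cf; apply: (@triangular_Rintegral R n 1 (fun x => opV (x, z))).
- by left.
- by apply: continuous_measurable_rVrV; exact: continuous_opV1.
- exact: triangular_opV1.
- exact: continuous_measurable_rV.
Qed.

Lemma integral_opV2 (f : rV -> R) x : continuous f ->
  \int[mu]_z f (opV (x, z)) = \int[mu]_y f y.
Proof.
move=> cf; apply: (@triangular_Rintegral R n (-1) (fun z => opV (x, z))).
- by right.
- by apply: continuous_measurable_rVrV; exact: continuous_opV2.
- exact: triangular_opV2.
- exact: continuous_measurable_rV.
Qed.

Section left_average.
Variables (K : set rV) (eta : rV -> R).
Hypotheses (cK : compact K) (seta : smooth eta) (eta0 : zero_off K eta).

Let ieta : mu.-integrable setT (EFin \o eta).
Proof. by apply: Cc_integrable cK _ eta0; exact: smooth_continuous. Qed.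

Definition left_average (f : rV -> R) (z : rV) : R :=
  \int[mu]_y (f (op y z) * eta y).

Let kernel (f : rV -> R) (p : rV * rV) := f (op p.2 p.1).

Let kernel_Ck f k : smooth f -> Ck k setT (kernel f).
Proof.
move=> sf.
have sw : continuous (fun p : rV * rV => op p.2 p.1).
  move=> p; apply: (@continuous_comp _ _ _ (fun p : rV * rV => (p.2, p.1))
    (fun z : rV * rV => op z.1 z.2)); last exact: op_continuous.
  by apply: pair_continuous => q; [exact: cvg_snd|exact: cvg_fst].
apply: (Ck_comp (@coord_system_rV R n) (F := fun p : rV * rV => op p.2 p.1)) (sf k) => //.
move=> j; apply: (Ck_affine (f := fun z : rV * rV => op z.1 z.2 ord0 j)
    (A := fun p => (p.2, p.1)) (B := fun p => (p.2, p.1))) => //.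
- by apply: pair_continuous => q; [exact: cvg_snd|exact: cvg_fst].
- exact: op_Ck.
Qed.

Lemma smooth_left_average (f : rV -> R) : smooth f -> smooth (left_average f).
Proof. by move=> sf k; exact: (param_Ck cK eta0 ieta (kernel_Ck k sf)). Qed.

(** Under the integral the field acts on [f (op y z)] as a function of [z], and left invariance lets
    it pass through [op y]. *)
Lemma XD_left_average k (f : rV -> R) z : smooth f ->
  XD G k (left_average f) z = left_average (XD G k f) z.
Proof.
move=> sf; rewrite /XD.
have [_ ->] := param_derive cK eta0 ieta z (sgX G k z) (kernel_Ck 1 sf).
apply: eq_Rintegral => y _; congr (_ * _).
have [_ <-] := @slice_derive R rV n (kernel f) z y (sgX G k z) (Ck_derivable (kernel_Ck 1 sf)).
exact: (@XD_left R s G k f y z sf).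
Qed.

Lemma left_average_integrable (f : rV -> R) z : smooth f ->
  mu.-integrable setT (EFin \o (fun y => f (op y z) * eta y)).
Proof.
by move=> sf; exact: (param_integrable cK eta0 ieta z (Ck_continuous (kernel_Ck 0 sf))).
Qed.

Lemma sublaplacian_left_average (f : rV -> R) z : smooth f -> L (left_average f) z = left_average (L f) z.
Proof.
move=> sf; rewrite sublaplacianE.
transitivity (\sum_(k < n | (k < N)%N) left_average (XD G k (XD G k f)) z).
  apply: eq_bigr => k _; rewrite (_ : XD G k (left_average f) = left_average (XD G k f)).
    by rewrite XD_left_average//; exact: smooth_XD.
  by apply/funext => t; rewrite XD_left_average.
have [|_ <-] := @Rintegral_sum _ _ R mu _ (index_enum 'I_n) (fun k : 'I_n => k < N)%N
  (fun k y => XD G k (XD G k f) (op y z) * eta y).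
  by move=> k _; apply: left_average_integrable; do 2 apply: smooth_XD.
by apply: eq_Rintegral => y _; rewrite sublaplacianE mulr_suml.
Qed.

End left_average.

Lemma near_box m (P : 'rV[R]_m -> Prop) : (\forall y \near (0 : 'rV[R]_m), P y) ->
  exists2 r : R, 0 < r & forall y, rV_box r y -> P y.
Proof.
move=> /nbhs_ballP[e /= e0 He]; exists (e / 2); first by rewrite divr_gt0.
move=> y yb; apply: He; split=> // i j; rewrite -ball_normE /ball_ /= mxE sub0r normrN (ord1 i).
by apply: le_lt_trans (yb j) _; rewrite ltr_pdivrMr// mulr2n mulrDr mulr1 ltrDl.
Qed.

(** The points y^-1 x with y in the box and x in [S]. Averaging a function that vanishes off [S]
    gives one that vanishes off this set, because y z in [S] means z = y^-1 (y z). *)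
Definition left_hull (r : R) (S : set rV) : set rV :=
  (fun p : rV * rV => op (inv p.1) p.2) @` (rV_box r `*` S).

Lemma compact_left_hull r S : compact S -> compact (left_hull r S).
Proof.
move=> cS; apply: continuous_compact; last by apply: compact_setX => //; exact: compact_rV_box.
apply: continuous_subspaceT => p.
apply: (@continuous_comp _ _ _ (fun p : rV * rV => (inv p.1, p.2))
    (fun z : rV * rV => op z.1 z.2)); last exact: op_continuous.
apply: pair_continuous => q; last exact: cvg_snd.
by apply: (@continuous_comp _ _ _ fst inv); [exact: cvg_fst|exact: inv_continuous].
Qed.

(** Both properties hold near each (x, 0) by continuity of the group operations; compactness of [S]
    yields one radius for all of [S]. *)
Lemma left_translation_near (Omega S : set rV) (W : rV -> R) (e : R) :
  open Omega -> compact S -> S `<=` Omega ->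
  (forall x, Omega x -> {for x, continuous W}) -> 0 < e ->
  exists2 r : R, 0 < r & forall y x, rV_box r y -> S x ->
    Omega (op (inv y) x) /\ `|W (op (inv y) x) - W x| <= e.
Proof.
move=> oO cS SO cW e0.
have /compact_near_coveringP cov := cS.
suff H : forall x, S x -> \forall x' \near x & y \near nbhs (0 : rV),
    Omega (op (inv y) x') /\ `|W (op (inv y) x') - W x'| <= e.
  have /near_box[r r0 hr] := cov _ _ _ (nbhs_filter (0 : rV)) H.
  by exists r => // y x yb Sx; exact: (hr y yb x Sx).
move=> x Sx; have Ox := SO _ Sx.
have cxy : {for (x, 0), continuous (fun p : rV * rV => op (inv p.2) p.1)}.
  apply: (@continuous_comp _ _ _ (fun p : rV * rV => (inv p.2, p.1))
    (fun z : rV * rV => op z.1 z.2)); last exact: op_continuous.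
  apply: pair_continuous => q; last exact: cvg_fst.
  by apply: (@continuous_comp _ _ _ snd inv); [exact: cvg_snd|exact: inv_continuous].
have e20 : 0 < e / 2 by rewrite divr_gt0.
have nW : \forall x' \near x, `|W x - W x'| < e / 2.
  by have /cvgrPdist_lt/(_ _ e20) := cW x Ox.
have nO : nbhs x Omega by exact: open_nbhs_nbhs.
have [[A1 B1] [/= A1x B10] AB1] : nbhs (x, 0 : rV)
    ((fun p : rV * rV => op (inv p.2) p.1) @^-1` (Omega `&` [set x' | `|W x - W x'| < e / 2])).
  by apply: cxy; rewrite /= sg_inv0 sg_op0x; exact: filterI.
exists (A1 `&` [set x' | `|W x - W x'| < e / 2], B1) => /=.
  by split=> //; exact: filterI.
move=> [x' y] /= [[A1x' Wx'] B1y].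
have [/= O1 W1] := AB1 (x', y) (conj A1x' B1y).
split=> //; apply: ltW; rewrite -(subrKA (W x)) (le_lt_trans (ler_normD _ _))// (splitr e) ltrD//.
by rewrite distrC.
Qed.

(* [m] is a normalized average of [W] over left translates.  Since [L] commutes with
   left translations, testing [m] against [L zeta] is testing [W] against [L] of
   an average of [zeta]. *)
Lemma mollify (Omega S : set rV) (W : rV -> R) (e : R) :
  open Omega -> compact S -> S `<=` Omega -> L1loc Omega W ->
  (forall x, Omega x -> {for x, continuous W}) -> (forall x, Omega x -> 0 <= W x) ->
  (forall K psi, compact K -> K `<=` Omega -> test K psi -> (forall x, 0 <= psi x) ->
    \int[mu]_x (W x * L psi x) <= 0) ->
  0 < e ->
  exists m : rV -> R, [/\ smooth m, forall x, 0 <= m x,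
    forall x, S x -> `|m x - W x| <= e &
    forall zeta, test S zeta -> (forall x, 0 <= zeta x) ->
      \int[mu]_x (m x * L zeta x) <= 0].
Proof.
move=> oO cS SO WL cW W0 superW e0.
have [r r0 hr] := left_translation_near oO cS SO cW e0.
pose K0 := left_hull r S.
have cK0 : compact K0 by exact: compact_left_hull.
have K0O : K0 `<=` Omega by move=> _ [[y x] [/= yb Sx] <-]; exact: (hr y x yb Sx).1.
pose eta : rV -> R := bump r.
have seta : smooth eta by move=> k; exact: bump_Ck.
have ceta := smooth_continuous seta.
have cB : compact (@rV_box R n r) by exact: compact_rV_box.
have eta0 : zero_off (rV_box r) eta by apply: bump_zero_off; exact: ltW.
have ieta : mu.-integrable setT (EFin \o eta) by exact: bump_integrable.
pose c := \int[mu]_y eta y.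
have c0 : 0 < c by exact: bump_integral_gt0.
(* [W] is controlled only on [Omega], so it is cut off outside [K0]. For [x] in [S] the cut is
   invisible: [H (x, z)] can be nonzero only if z = y^-1 x with y in the box, hence z in [K0]. *)
pose Wk := W \_ K0.
have iWk : mu.-integrable setT (EFin \o Wk) by exact: (L1loc_integrable_restrict WL).
have Wk0 : zero_off K0 Wk by move=> x nK; rewrite /Wk patchN// notin_setE.
have WkE x : K0 x -> Wk x = W x by move=> Kx; rewrite /Wk patchE mem_set.
have Wk_ge0 x : 0 <= Wk x.
  by have [Kx|nK] := pselect (K0 x); [rewrite WkE// W0//; exact: K0O|rewrite Wk0].
pose H (p : rV * rV) := eta (opV p).
have CH k : Ck k setT H.
  by apply: (Ck_comp (@coord_system_rV R n)) (seta k); [exact: opV_continuous|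
    move=> j; exact: opV_Ck].
have cH : continuous H := Ck_continuous (CH 0%N).
pose w x := \int[mu]_z (H (x, z) * Wk z).
have sw : smooth w by move=> k; exact: (param_Ck cK0 Wk0 iWk (CH k)).
have w_ge0 x : 0 <= w x.
  by apply: Rintegral_ge0 => z _; rewrite mulr_ge0// bump_ge0.
have iH x : mu.-integrable setT (EFin \o (fun z => H (x, z))).
  apply: (@triangular_integrable R n (-1) (fun z => opV (x, z)) eta).
  - by right.
  - by apply: continuous_measurable_rVrV; exact: continuous_opV2.
  - exact: triangular_opV2.
  - exact: ieta.
have H0 x z : 0 <= H (x, z) by exact: bump_ge0.
have Hbox x z : H (x, z) != 0 -> rV_box r (opV (x, z)).
  by move=> /eqP; apply: contra_notP; exact: eta0.
have wW x : S x -> `|w x - c * W x| <= c * e.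
  move=> Sx.
  (* Each slice [H (x, _)] has the same integral [c] as the bump, so the error becomes an integral
     of [H (x, z) * (Wk z - W x)]. *)
  have cE (a : R) : c * a = \int[mu]_z (a * H (x, z)).
    by rewrite (RintegralZl a measurableT (iH x)) [X in _ = _ * X](@integral_opV2 eta x)// mulrC.
  rewrite [c * W x]cE.
  have iWH : mu.-integrable setT (EFin \o (fun z => W x * H (x, z))).
    by have := integrableZl measurableT (W x) (iH x); apply: eq_integrable.
  have iHW := param_integrable cK0 Wk0 iWk x cH.
  have iB : mu.-integrable setT (EFin \o (fun z => H (x, z) * Wk z - W x * H (x, z))).
    by have := integrableB measurableT iHW iWH; apply: eq_integrable.
  rewrite -RintegralB//.
  apply: le_trans (le_normr_Rintegral measurableT iB) _.
  rewrite cE.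
  apply: le_Rintegral => //.
  - by have := integrable_norm iB; apply: eq_integrable.
  - by have := integrableZl measurableT e (iH x); apply: eq_integrable.
  - move=> z _; rewrite [W x * _]mulrC -mulrBr normrM ger0_norm// mulrC.
    have [->|/Hbox zb] := eqVneq (H (x, z)) 0; first by rewrite !mulr0.
    rewrite ler_wpM2r//.
    have := hr _ x zb Sx; rewrite opVK => -[_]; rewrite WkE//.
    by exists (opV (x, z), x) => //=; rewrite opVK.
have wsuper zeta : test S zeta -> (forall x, 0 <= zeta x) -> \int[mu]_x (w x * L zeta x) <= 0.
  move=> tz z0; have [sz zS] := tz.
  have clS : closed S by exact: compact_closed.
  have [sL LS] := test_sublaplacian G clS tz.
  have iL : mu.-integrable setT (EFin \o L zeta) by apply: (test_integrable cS).
  (* After Fubini, the substitution y = x z^-1 in the inner integral turns it into a left average of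
     [L zeta], that is, [L] of the left average [Z]. Being nonnegative and zero off [K0], [Z] is an
     admissible test function for [W]. *)
  rewrite (Fubini_kernel cH cS cK0 LS Wk0 iL iWk).
  have avgE (f : rV -> R) z : smooth f ->
      \int[mu]_x (H (x, z) * f x) = left_average eta f z.
    move=> sf; rewrite /left_average -(@integral_opV1 (fun y => f (op y z) * eta y) z).
      by apply: eq_Rintegral => x _; rewrite op_opV mulrC.
    have cop : continuous (fun y => op y z).
      move=> y; apply: (@continuous_comp _ _ _ (fun y => (y, z))
        (fun z : rV * rV => op z.1 z.2)); last exact: op_continuous.
      exact: continuous_pair1.
    have cf : continuous (fun y => f (op y z)).
      move=> y; apply: (@continuous_comp _ _ _ (fun y => op y z) f); first exact: cop.
      exact: smooth_continuous.
    move=> y; exact: (cvgM (cf y) (ceta y)).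
  pose Z := left_average eta zeta.
  have sZ : smooth Z by exact: (smooth_left_average cB seta eta0).
  have Z0 x : 0 <= Z x.
    by apply: Rintegral_ge0 => y _; rewrite mulr_ge0// bump_ge0.
  have ZK : zero_off K0 Z.
    move=> z nK; rewrite /Z /left_average (_ : (fun y => _) = cst 0).
      by rewrite Rintegral_cst// mul0r.
    apply/funext => y /=.
    have [yb|nyb] := pselect (rV_box r y); last by rewrite eta0// mulr0.
    rewrite zS ?mul0r// => Syz; apply: nK; exists (y, op y z) => //=.
    exact: op_invK.
  have -> : (\int[mu]_z (\int[mu]_x (H (x, z) * L zeta x) * Wk z)) =
      \int[mu]_z (W z * L Z z).
    apply: eq_Rintegral => z _; rewrite avgE// -(sublaplacian_left_average cB seta eta0)//.
    have [Kz|nK] := pselect (K0 z); first by rewrite WkE// mulrC.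
    have clK0 : closed K0 by exact: compact_closed.
    by rewrite Wk0// (test_sublaplacian G clK0 (conj sZ ZK)).2// !mulr0.
  by apply: (superW K0).
exists (fun x => c^-1 * w x); split.
- by apply: smoothM; [exact: smooth_cst|].
- by move=> x; rewrite mulr_ge0// invr_ge0 ltW.
- move=> x Sx; rewrite -(ler_pM2l c0) -[X in X * _](gtr0_norm c0) -normrM mulrBr.
  by rewrite mulrA divff ?gt_eqF// mul1r wW.
- move=> zeta tz z0.
  have -> : (\int[mu]_x (c^-1 * w x * L zeta x)) = c^-1 * \int[mu]_x (w x * L zeta x).
    have clS : closed S by exact: compact_closed.
    rewrite -RintegralZl//.
      by apply: eq_Rintegral => x _; rewrite mulrA.
    apply: (test_integrable cS); apply: testMr => //.
    exact: test_sublaplacian.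
  by rewrite mulr_ge0_le0// ?wsuper// invr_ge0 ltW.
Qed.

End mollification.

(** * The weighted Hardy inequality *)

Local Opaque XD sublaplacian.

Section weighted_hardy.
Variables (R : realType) (s : seq nat) (G : stratified_group R s).
Local Notation n := (sumn s).
Local Notation N := (head 0%N s).
Local Notation rV := 'rV[R]_n.
Local Notation mu := (lebesgue_rV R n).
Local Notation smooth f := (smooth_on [set: rV] f).
Local Notation L := (sublaplacian G).

Definition carre_du_champ (f g : rV -> R) (x : rV) : R :=
  \sum_(k < n | (k < N)%N) XD G k f x * XD G k g x.
Local Notation gamma := carre_du_champ.

Lemma carre_du_champE f g x :
  gamma f g x = \sum_(k < n | (k < N)%N) XD G k f x * XD G k g x.
Proof. by []. Qed.

Lemma test_gamma K (f g : rV -> R) : closed K -> smooth f -> test K g -> test K (gamma f g).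
Proof.
move=> cK sf tg; split.
  by apply: smooth_sum => k _; apply: smoothM; apply: smooth_XD => //; exact: tg.1.
move=> x nK; rewrite /gamma big1// => k _.
by rewrite (test_XD G k cK tg).2// mulr0.
Qed.

Lemma integral_green K (f g : rV -> R) : compact K -> smooth f -> test K g ->
  \int[mu]_x (f x * L g x) = - \int[mu]_x gamma f g x.
Proof.
move=> cK sf tg; have clK : closed K by exact: compact_closed.
have tX k := test_XD G k clK tg.
have i1 (k : 'I_n) : (k < N)%N -> mu.-integrable setT (EFin \o (fun x => XD G k f x * XD G k g x)).
  by move=> _; apply: (test_integrable cK); apply: testMr => //; exact: smooth_XD.
have [_ e1] := @Rintegral_sum _ _ R mu _ (index_enum 'I_n) (fun k : 'I_n => k < N)%N
  (fun k x => XD G k f x * XD G k g x) i1.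
have i2 (k : 'I_n) : (k < N)%N -> mu.-integrable setT (EFin \o (fun x => f x * XD G k (XD G k g) x)).
  by move=> _; apply: (test_integrable cK); apply: testMr => //; exact: test_XD.
have [_ e2] := @Rintegral_sum _ _ R mu _ (index_enum 'I_n) (fun k : 'I_n => k < N)%N
  (fun k x => f x * XD G k (XD G k g) x) i2.
rewrite /gamma e1 -sumrN.
transitivity (\int[mu]_x \sum_(k < n | (k < N)%N) (f x * XD G k (XD G k g) x)).
  by apply: eq_Rintegral => x _; rewrite sublaplacianE mulr_sumr.
rewrite e2; apply: eq_bigr => k _.
have := congr1 -%R (integral_XD_parts G k cK (tX k) sf); rewrite opprK => e3.
apply: (etrans _ (etrans (esym e3) (congr1 -%R _))).
  by apply: eq_Rintegral => x _; exact: mulrC.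
by apply: eq_Rintegral => x _; exact: mulrC.
Qed.

(** AM-GM term by term: multiplied by [a], each q f is at most lam a^2 Phi q^2 / m + m f^2 / (4 lam
    Phi), the difference being a positive multiple of a square. Where [Phi] vanishes the hypothesis
    forces every [f k] to vanish, and the left side is 0. *)
Lemma hardy_pointwise (I : finType) (P : pred I) (q f : I -> R) (m Phi theta a lam : R) :
  0 < m -> 0 <= Phi -> 0 <= theta -> 0 < a -> 0 < lam ->
  \sum_(k | P k) f k ^+ 2 <= Phi * theta ->
  a * (\sum_(k | P k) q k * f k) <=
  lam * a ^+ 2 * (m^-1 * Phi * \sum_(k | P k) q k ^+ 2) + (4 * lam)^-1 * (m * theta).
Proof.
move=> m0 Phi0 theta0 a0 l0 hf.
have l40 : 0 < 4 * lam by rewrite mulr_gt0.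
have [Phi_gt0|Phi_le0] := ltP 0 Phi; last first.
  have Phi_eq : Phi = 0 by apply/eqP; rewrite eq_le Phi_le0.
  have f0 k : P k -> f k = 0.
    move=> Pk; have s0 : \sum_(k | P k) f k ^+ 2 == 0.
      rewrite eq_le sumr_ge0 ?andbT => [|i _]; last exact: sqr_ge0.
      by move: hf; rewrite Phi_eq mul0r.
    move: s0; rewrite psumr_eq0 => [/allP/(_ k)|i _]; last exact: sqr_ge0.
    by rewrite mem_index_enum Pk sqrf_eq0 => /(_ isT)/eqP.
  rewrite big1 => [|k Pk]; last by rewrite f0// mulr0.
  rewrite Phi_eq !mulr0 mul0r mulr0 add0r.
  by apply: mulr_ge0; [rewrite invr_ge0 ltW|exact: mulr_ge0 (ltW m0) theta0].
have amgm k : a * (q k * f k) <= lam * a ^+ 2 * (m^-1 * Phi * q k ^+ 2) +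
    (4 * lam)^-1 * (m * (Phi^-1 * f k ^+ 2)).
  rewrite -subr_ge0.
  have -> : lam * a ^+ 2 * (m^-1 * Phi * q k ^+ 2) +
    (4 * lam)^-1 * (m * (Phi^-1 * f k ^+ 2)) - a * (q k * f k) =
    lam * a ^+ 2 * Phi * m^-1 * (q k - m * f k / (2 * lam * a * Phi)) ^+ 2.
    by field; rewrite (gt_eqF Phi_gt0) (gt_eqF a0) (gt_eqF l0) (gt_eqF m0).
  apply: mulr_ge0; last exact: sqr_ge0.
  apply: mulr_ge0; last by rewrite invr_ge0 ltW.
  by apply: mulr_ge0 Phi0; apply: mulr_ge0; [exact: ltW|exact: sqr_ge0].
rewrite mulr_sumr; apply: le_trans (ler_sum _ (fun k _ => amgm k)) _.
rewrite big_split /= -!mulr_sumr lerD2l ler_wpM2l ?invr_ge0 ?(ltW l40)// ler_wpM2l ?(ltW m0)//.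
by rewrite ler_pdivrMl.
Qed.

(** The role of superharmonicity is the sign of [I3]: it gives (1 - a) B <= A, which eliminates the
    gradient energy [B] of the weight in favour of [A], a multiple of [I2]. *)
Lemma hardy_scalar (a lam I1 I2 I3 A B C D : R) : 0 < a -> a < 1 -> 0 < lam ->
  I1 = - (a * C) -> I2 = - (a * A) -> I3 = - (A + (a - 1) * B) -> I3 <= 0 ->
  a * C <= lam * a ^+ 2 * B + (4 * lam)^-1 * D ->
  - I1 <= lam * (a / (1 - a)) * (- I2) + (4 * lam)^-1 * D.
Proof.
move=> a0 a1 l0 -> -> -> AB CB; rewrite !opprK.
have a10 : 0 < 1 - a by rewrite subr_gt0.
apply: (le_trans CB); rewrite lerD2r.
have BA : B <= (1 - a)^-1 * A by rewrite ler_pdivlMl//; move: AB; lra.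
have -> : lam * (a / (1 - a)) * (a * A) = lam * a ^+ 2 * ((1 - a)^-1 * A) by ring.
by rewrite ler_wpM2l// mulr_ge0 ?sqr_ge0// ltW.
Qed.

(* Here [m `^ a] plays the part of [V] and [m] that of [V `^ sigma], [a = 1 / sigma]:
   superharmonicity of [m] is tested against [m `^ (a - 1) * Phi]. *)
Lemma hardy_smooth K (m phi Phi theta : rV -> R) (a lam : R) :
  compact K -> smooth m -> (forall x, 0 < m x) -> test K phi -> test K Phi ->
  (forall x, 0 <= Phi x) -> continuous theta -> zero_off K theta ->
  (forall x, 0 <= theta x) ->
  (forall x, gamma phi phi x <= Phi x * theta x) ->
  0 < a < 1 -> 0 < lam ->
  \int[mu]_x (m x * L (fun x => m x `^ (a - 1) * Phi x) x) <= 0 ->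
  - (\int[mu]_x (m x `^ a * L phi x)) <=
  lam * (a / (1 - a)) * (- (\int[mu]_x (m x `^ a * L Phi x))) +
  (4 * lam)^-1 * \int[mu]_x (m x `^ a * theta x).
Proof.
move=> cK sm m0 tphi tPhi Phi0 ctheta theta0 theta_ge0 hg /andP[a0 a1] l0.
have clK : closed K by exact: compact_closed.
have sma b : smooth (fun x => m x `^ b) by exact: smooth_powR.
have tzeta : test K (fun x => m x `^ (a - 1) * Phi x) by exact: testMr.
have gm (b : R) f x : gamma (fun x => m x `^ b) f x = b * m x `^ (b - 1) * gamma m f x.
  by rewrite /gamma mulr_sumr; apply: eq_bigr => k _; rewrite XD_powR// mulrA.
have gz x : gamma m (fun x => m x `^ (a - 1) * Phi x) x =
    m x `^ (a - 1) * gamma m Phi x + (a - 1) * (m x `^ (a - 1 - 1) * Phi x * gamma m m x).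
  rewrite /gamma !mulr_sumr -big_split/=; apply: eq_bigr => k _.
  by rewrite XDM//; [rewrite XD_powR//; ring|exact: tPhi.1].
pose A x := m x `^ (a - 1) * gamma m Phi x.
pose B x := m x `^ (a - 1 - 1) * Phi x * gamma m m x.
pose C x := m x `^ (a - 1) * gamma m phi x.
pose D x := m x `^ a * theta x.
have iA : mu.-integrable setT (EFin \o A).
  by apply: (test_integrable cK); apply: testMr => //; exact: test_gamma.
have iC : mu.-integrable setT (EFin \o C).
  by apply: (test_integrable cK); apply: testMr => //; exact: test_gamma.
have iB : mu.-integrable setT (EFin \o B).
  apply: (Cc_integrable cK); last first.
    by move=> x nK; rewrite /B tPhi.2// mulr0 mul0r.
  apply: smooth_continuous; apply: smoothM; first by apply: smoothM; [exact: sma|exact: tPhi.1].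
  by apply: smooth_sum => k _; apply: smoothM; exact: smooth_XD.
have iD : mu.-integrable setT (EFin \o D).
  apply: (Cc_integrable cK); last by move=> x nK; rewrite /D theta0// mulr0.
  exact: continuousM_fun (smooth_continuous (sma a)) ctheta.
have phiE : \int[mu]_x (m x `^ a * L phi x) = - (a * \int[mu]_x C x).
  apply: (etrans (integral_green cK (sma a) tphi)); congr (- _).
  apply: (etrans _ (RintegralZl a measurableT iC)).
  by apply: eq_Rintegral => x _; rewrite gm mulrA.
have PhiE : \int[mu]_x (m x `^ a * L Phi x) = - (a * \int[mu]_x A x).
  apply: (etrans (integral_green cK (sma a) tPhi)); congr (- _).
  apply: (etrans _ (RintegralZl a measurableT iA)).
  by apply: eq_Rintegral => x _; rewrite gm mulrA.
have zetaE : \int[mu]_x (m x * L (fun x => m x `^ (a - 1) * Phi x) x) =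
    - (\int[mu]_x A x + (a - 1) * \int[mu]_x B x).
  apply: (etrans (integral_green cK sm tzeta)); congr (- _).
  rewrite -(RintegralZl (a - 1) measurableT iB).
  have iB' : mu.-integrable setT (EFin \o (fun x => (a - 1) * B x)).
    by have := integrableZl measurableT (a - 1) iB; apply: eq_integrable.
  apply: (etrans _ (RintegralD measurableT iA iB')).
  by apply: eq_Rintegral => x _; rewrite gz.
have CB : a * \int[mu]_x C x <= lam * a ^+ 2 * \int[mu]_x B x + (4 * lam)^-1 * \int[mu]_x D x.
  have iB' := integrableZl measurableT (lam * a ^+ 2) iB.
  have iD' := integrableZl measurableT (4 * lam)^-1 iD.
  rewrite -!RintegralZl// -RintegralD//.
  apply: le_Rintegral => //.
  - by have := integrableZl measurableT a iC; apply: eq_integrable.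
  - by have := integrableD measurableT iB' iD'; apply: eq_integrable.
  - move=> x _; rewrite /B /C /D.
    have := @hardy_pointwise _ (fun k : 'I_n => k < N)%N (fun k => XD G k m x)
      (fun k => XD G k phi x) (m x) (Phi x) (theta x) a lam (m0 x) (Phi0 x) (theta_ge0 x) a0 l0.
    have -> : \sum_(k < n | (k < N)%N) XD G k phi x ^+ 2 = gamma phi phi x.
      by apply: eq_bigr => k _; rewrite expr2.
    move=> /(_ (hg x)).
    have -> : \sum_(k < n | (k < N)%N) XD G k m x ^+ 2 = gamma m m x.
      by apply: eq_bigr => k _; rewrite expr2.
    (* All powers are written through m^(a-1); the integrated inequality is the pointwise one
       multiplied by this positive factor. *)
    have p0 : 0 < m x `^ (a - 1) by exact: powR_gt0.
    have e1 : m x `^ (a - 1 - 1) = m x `^ (a - 1) * (m x)^-1.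
      by rewrite powRB ?(gt_eqF (m0 x)) ?implybT// powRr1// ltW.
    have e2 : m x `^ a = m x `^ (a - 1) * m x.
      by rewrite mulrC mulr_powRB1// ltW.
    rewrite -(ler_pM2l p0) e1 e2 /gamma => h; apply: le_trans (le_trans h _);
      by rewrite le_eqVlt; apply/orP; left; apply/eqP; ring.
by move=> I3; exact: (hardy_scalar a0 a1 l0 phiE PhiE zetaE I3 CB).
Qed.

End weighted_hardy.

Local Opaque carre_du_champ.

(** * The Hardy inequality for a continuous weight, by approximation *)

Section hardy.
Variables (R : realType) (s : seq nat) (G : stratified_group R s).
Local Notation n := (sumn s).
Local Notation rV := 'rV[R]_n.
Local Notation mu := (lebesgue_rV R n).
Local Notation smooth f := (smooth_on [set: rV] f).
Local Notation L := (sublaplacian G).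
Local Notation gamma := (carre_du_champ G).

(** A root of exponent sigma > 1 does not enlarge a relative error: (1 + rho)^(1/sigma) <= 1 +
    rho. *)
Lemma powR_perturbation (v w sigma rho : R) : 1 < sigma -> 0 < v -> 0 < rho ->
  v `^ sigma <= w <= v `^ sigma * (1 + rho) ->
  v <= w `^ sigma^-1 <= v * (1 + rho).
Proof.
move=> s1 v0 r0 /andP[w1 w2].
have s0 : 0 < sigma by lra.
have si0 : 0 <= sigma^-1 by rewrite invr_ge0 ltW.
have vs0 : 0 < v `^ sigma by exact: powR_gt0.
have vE : (v `^ sigma) `^ sigma^-1 = v.
  by rewrite -powRrM divff ?gt_eqF// powRr1// ltW.
apply/andP; split.
  by rewrite -[leLHS]vE ge0_ler_powR// nnegrE ltW// (lt_le_trans vs0).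
apply: (@le_trans _ _ ((v `^ sigma * (1 + rho)) `^ sigma^-1)).
  rewrite ge0_ler_powR// nnegrE ltW// ?(lt_le_trans vs0 w1)//.
  by rewrite mulr_gt0// addr_gt0.
rewrite powRM ?(ltW vs0)//; last by rewrite addr_ge0// ltW.
rewrite vE ler_pM2l// -[leRHS]powRr1; last by rewrite addr_ge0// ltW.
rewrite ler_powR//; first by rewrite lerDl ltW.
by rewrite invf_le1// ltW.
Qed.

Lemma Rintegral_near (K : set rV) (V v psi : rV -> R) (rho : R) :
  mu.-integrable setT (EFin \o (fun x => V x * psi x)) ->
  mu.-integrable setT (EFin \o (fun x => v x * psi x)) ->
  zero_off K psi -> 0 <= rho -> (forall x, K x -> 0 <= V x) ->
  (forall x, K x -> V x <= v x <= V x * (1 + rho)) ->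
  `|\int[mu]_x (v x * psi x) - (\int[mu]_x (V x * psi x))| <=
    rho * \int[mu]_x `|V x * psi x|.
Proof.
move=> iV iv psi0 r0 V0 Vv.
have iB : mu.-integrable setT (EFin \o (fun x => v x * psi x - V x * psi x)).
  by have := integrableB measurableT iv iV; apply: eq_integrable.
have iN : mu.-integrable setT (EFin \o (fun x => `|V x * psi x|)).
  by have := integrable_norm iV; apply: eq_integrable.
rewrite -RintegralB// -RintegralZl//.
apply: le_trans (le_normr_Rintegral measurableT iB) _.
apply: le_Rintegral => //.
- by have := integrable_norm iB; apply: eq_integrable.
- by have := integrableZl measurableT rho iN; apply: eq_integrable.
- move=> x _; have [Kx|nK] := pselect (K x); last first.
    by rewrite psi0// !mulr0 subrr normr0 mulr0.
  have /andP[h1 h2] := Vv x Kx.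
  rewrite -mulrBl !normrM mulrA ler_wpM2r// ger0_norm ?subr_ge0// ger0_norm ?V0//.
  by rewrite lerBlDr; apply: le_trans h2 _; rewrite mulrDr mulr1 addrC [rho * _]mulrC.
Qed.

Lemma perturbation_scalar (I1 I2 I3 J1 J2 J3 N1 N2 N3 X Y c rho : R) :
  X = 2^-1 -> Y = c -> 0 <= c -> - I1 <= X * (- I2) + Y * I3 ->
  `|I1 - J1| <= rho * N1 -> `|I2 - J2| <= rho * N2 -> `|I3 - J3| <= rho * N3 ->
  - J1 <= 2^-1 * (- J2) + c * J3 + rho * (N1 + 2^-1 * N2 + c * N3).
Proof.
move=> -> -> c0 H; rewrite !ler_norml => /andP[a1 a2] /andP[b1 b2] /andP[c1 c2].
have a3 : c * I3 <= c * J3 + c * (rho * N3) by rewrite -mulrDr ler_wpM2l// -lerBlDl.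
have -> : rho * (N1 + 2^-1 * N2 + c * N3) = rho * N1 + 2^-1 * (rho * N2) + c * (rho * N3).
  by ring.
lra.
Qed.

Lemma hardy (Omega K : set rV) (V phi Phi theta : rV -> R) (sigma : R) :
  open Omega -> compact K -> K `<=` Omega -> 1 < sigma ->
  (forall x, Omega x -> 0 < V x) -> (forall x, Omega x -> {for x, continuous V}) ->
  L1loc Omega V -> L1loc Omega (fun x => V x `^ sigma) ->
  (forall K psi, compact K -> K `<=` Omega -> test K psi -> (forall x, 0 <= psi x) ->
    \int[mu]_x (V x `^ sigma * L psi x) <= 0) ->
  test K phi -> test K Phi -> (forall x, 0 <= Phi x) ->
  continuous theta -> zero_off K theta -> (forall x, 0 <= theta x) ->
  (forall x, gamma phi phi x <= Phi x * theta x) ->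
  - (\int[mu]_x (V x * L phi x)) <=
  2^-1 * (- (\int[mu]_x (V x * L Phi x))) +
  (2 * (sigma - 1))^-1 * \int[mu]_x (V x * theta x).
Proof.
move=> oO cK KO s1 V0 cV VL WL superW tphi tPhi Phi0 ctheta theta0 theta_ge0 hg.
have clK : closed K by exact: compact_closed.
have s0 : 0 < sigma by lra.
have KV x : K x -> 0 < V x by move=> /KO; exact: V0.
have cW x : Omega x -> {for x, continuous (fun x => V x `^ sigma)}.
  move=> Ox; apply: (@continuous_comp _ _ _ V (fun t => t `^ sigma)); first exact: cV.
  exact: is_derive1_continuous (is_derive1_powR sigma (V0 _ Ox)).
(* A positive lower bound on [K] turns the additive error of the averaging into a relative one. It
   comes from bounding the continuous inverse; [M + 1] keeps the quotient meaningful when [M] is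
   0. *)
have [w0 w0_gt0 hw0] : exists2 w0 : R, 0 < w0 & forall x, K x -> w0 <= V x `^ sigma.
  have [|M M0 hM] := @compact_continuous_bounded R _ K (fun x => (V x `^ sigma)^-1) cK.
    apply: continuous_in_subspaceT => x /set_mem Kx.
    have vs0 : V x `^ sigma != 0 by rewrite gt_eqF// powR_gt0// KV.
    exact: (cvgV vs0 (cW x (KO _ Kx))).
  exists (M + 1)^-1; first by rewrite invr_gt0 ltr_wpDl.
  move=> x Kx; have vs0 : 0 < V x `^ sigma by rewrite powR_gt0// KV.
  rewrite -[leRHS]invrK lef_pV2 ?posrE ?invr_gt0 ?ltr_wpDl//.
  by apply: le_trans (ler_norm _) (le_trans (hM x Kx) _); rewrite lerDl.
have [tL1 tL2] := (test_sublaplacian G clK tphi, test_sublaplacian G clK tPhi).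
have iV psi : continuous psi -> zero_off K psi ->
    mu.-integrable setT (EFin \o (fun x => V x * psi x)).
  by move=> cpsi psi0; exact: (L1loc_integrableM VL cK KO).
have i1 := iV _ (smooth_continuous tL1.1) tL1.2.
have i2 := iV _ (smooth_continuous tL2.1) tL2.2.
have i3 := iV _ ctheta theta0.
pose N1 := \int[mu]_x `|V x * L phi x|.
pose N2 := \int[mu]_x `|V x * L Phi x|.
pose N3 := \int[mu]_x `|V x * theta x|.
have N1_ge0 : 0 <= N1 by exact: Rintegral_ge0.
have N2_ge0 : 0 <= N2 by exact: Rintegral_ge0.
have N3_ge0 : 0 <= N3 by exact: Rintegral_ge0.
pose c := (2 * (sigma - 1))^-1.
have c0 : 0 < c by rewrite invr_gt0 mulr_gt0// subr_gt0.
pose C := N1 + 2^-1 * N2 + c * N3.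
have main (rho : R) : 0 < rho ->
  - (\int[mu]_x (V x * L phi x)) <=
  2^-1 * (- (\int[mu]_x (V x * L Phi x))) + c * \int[mu]_x (V x * theta x) +
  rho * C.
  move=> r0.
  (* Adding [e] to [m0] places [m] between V^sigma and V^sigma + 2 e, and 2 e = [rho * w0] is at
     most [rho] V^sigma on [K]. The shift also makes [m] strictly positive everywhere. *)
  pose e := rho * w0 / 2.
  have e0 : 0 < e by rewrite divr_gt0// mulr_gt0.
  have [m0 [sm0 m0_ge0 m0W m0super]] := mollify oO cK KO WL cW
    (fun x Ox => powR_ge0 _ _) superW e0.
  pose m x := m0 x + e.
  have sm : smooth m by apply: smoothD => //; exact: smooth_cst.
  have m_gt0 x : 0 < m x by rewrite ltr_wpDl.
  pose v x := m x `^ sigma^-1.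
  have sv : smooth v by exact: smooth_powR.
  have vV x : K x -> V x <= v x <= V x * (1 + rho).
    move=> Kx; apply: powR_perturbation => //; first exact: KV.
    have := m0W x Kx; rewrite ler_norml => /andP[h1 h2].
    have h3 : rho * w0 <= rho * V x `^ sigma by rewrite ler_wpM2l ?hw0// ltW.
    have h4 : rho * w0 = e + e by rewrite /e; field.
    by rewrite /m mulrDr mulr1 [_ * rho]mulrC; apply/andP; split; lra.
  have a01 : 0 < sigma^-1 < 1 by rewrite invr_gt0 s0 invf_lt1.
  (* With a = 1/sigma this value gives the [Phi] term the weight 1/2. For Phi = phi a weight x would
     give 4 x (1 - x) (sigma - 1) A <= T, with A and T the two integrals, so 1/2 is optimal. *)
  have lam0 : 0 < (sigma - 1) / 2 by rewrite divr_gt0// subr_gt0.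
  have tzeta : test K (fun x => m x `^ (sigma^-1 - 1) * Phi x).
    by apply: testMr => //; exact: smooth_powR.
  have msuper : \int[mu]_x (m x * L (fun x => m x `^ (sigma^-1 - 1) * Phi x) x) <= 0.
    (* Green's formula sees [m] only through its horizontal gradient, so the added constant
       disappears and superharmonicity of [m0] carries over to [m]. *)
    rewrite (integral_green G cK sm tzeta) oppr_le0.
    have -> : gamma m (fun x => m x `^ (sigma^-1 - 1) * Phi x) =
        gamma m0 (fun x => m x `^ (sigma^-1 - 1) * Phi x).
      apply/funext => x; rewrite !carre_du_champE; apply: eq_bigr => k _; congr (_ * _).
      by rewrite XDD ?XD_cst ?addr0//; exact: smooth_cst.
    rewrite -oppr_le0 -(integral_green G cK sm0 tzeta); apply: m0super => // x.
    by rewrite mulr_ge0// powR_ge0.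
  have H := hardy_smooth cK sm m_gt0 tphi tPhi Phi0 ctheta theta0 theta_ge0 hg a01 lam0 msuper.
  have eX : (sigma - 1) / 2 * (sigma^-1 / (1 - sigma^-1)) = 2^-1.
    by field; rewrite subr_eq0 (gt_eqF s1) (gt_eqF s0).
  have eY : (4 * ((sigma - 1) / 2))^-1 = c.
    by rewrite /c; congr (_^-1); field.
  have V0' x : K x -> 0 <= V x by move/KV/ltW.
  have iv psi : continuous psi -> zero_off K psi ->
      mu.-integrable setT (EFin \o (fun x => v x * psi x)).
    move=> cpsi psi0; apply: (Cc_integrable cK); last by move=> x nK; rewrite psi0// mulr0.
    exact: continuousM_fun (smooth_continuous sv) cpsi.
  have j1 := iv _ (smooth_continuous tL1.1) tL1.2.
  have j2 := iv _ (smooth_continuous tL2.1) tL2.2.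
  have j3 := iv _ ctheta theta0.
  have E1 := Rintegral_near i1 j1 tL1.2 (ltW r0) V0' vV.
  have E2 := Rintegral_near i2 j2 tL2.2 (ltW r0) V0' vV.
  have E3 := Rintegral_near i3 j3 theta0 (ltW r0) V0' vV.
  exact: (perturbation_scalar eX eY (ltW c0) H E1 E2 E3).
apply/ler_addgt0Pr => e e0.
have C0 : 0 <= C by rewrite !addr_ge0// mulr_ge0// ltW.
have C1 : 0 < C + 1 by rewrite ltr_wpDl.
have rC : e / (C + 1) * C <= e.
  by rewrite mulrAC ler_pdivrMr// ler_wpM2l ?(ltW e0)// lerDl.
have r0 : 0 < e / (C + 1) by rewrite divr_gt0.
exact: (le_trans (main _ r0) (lerD (lexx _) rC)).
Qed.

End hardy.

(** * The weighted Rellich inequality *)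

Section cutoff.
Variables (R : realType) (n : nat).
Local Notation rV := 'rV[R]_n.
Local Notation mu := (lebesgue_rV R n).

Definition thickening (r : R) (K : set rV) : set rV :=
  (fun p : rV * rV => p.1 + p.2) @` (K `*` rV_box r).

Lemma compact_thickening r K : compact K -> compact (thickening r K).
Proof.
move=> cK; apply: continuous_compact; last by apply: compact_setX => //; exact: compact_rV_box.
by apply: continuous_subspaceT; exact: add_continuous.
Qed.

Lemma thickening_near (Omega K : set rV) : open Omega -> compact K -> K `<=` Omega ->
  exists2 r : R, 0 < r & thickening r K `<=` Omega.
Proof.
move=> oO cK KO; have /compact_near_coveringP cov := cK.
suff H : forall x, K x -> \forall x' \near x & y \near nbhs (0 : rV), Omega (x' + y).
  have /near_box[r r0 hr] := cov _ _ _ (nbhs_filter (0 : rV)) H.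
  by exists r => // _ [[x y] [/= Kx yb] <-]; exact: hr.
move=> x Kx.
have nO : nbhs (x + 0) Omega by rewrite addr0; apply: open_nbhs_nbhs; split=> //; exact: KO.
have [[A B] [/= Ax B0] AB] := @add_continuous rV (x, 0) Omega nO.
by exists (A, B) => // -[x' y] /= [Ax' By]; exact: (AB (x', y)).
Qed.

(** A Euclidean convolution: the indicator of the d/2-thickening of [K] is averaged against a bump
    of radius d/2. The result is 1 on [K] and vanishes off the d-thickening. *)
Lemma cutoff (Omega K : set rV) : open Omega -> compact K -> K `<=` Omega ->
  exists K' (chi : rV -> R), [/\ compact K', K `<=` K', K' `<=` Omega,
    test K' chi /\ (forall x, 0 <= chi x) & forall x, K x -> chi x = 1].
Proof.
move=> oO cK KO; have [d d0 hd] := thickening_near oO cK KO.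
pose r := d / 2; have r0 : 0 < r by rewrite divr_gt0.
pose K1 := thickening r K; have cK1 : compact K1 by exact: compact_thickening.
pose g : rV -> R := (cst (1 : R) : rV -> R) \_ K1.
have ig : mu.-integrable setT (EFin \o g).
  apply: (@L1loc_integrable_restrict R n setT K1 (cst 1)) => //; exact: L1loc_cst.
have g0 : zero_off K1 g by move=> x nK; rewrite /g patchN// notin_setE.
have gE x : K1 x -> g x = 1 by move=> Kx; rewrite /g patchE mem_set.
have g_ge0 x : 0 <= g x.
  by have [/gE ->//|/g0 ->] := pselect (K1 x).
pose c := \int[mu]_y @bump R n r y.
have c0 : 0 < c by exact: bump_integral_gt0.
pose H (p : rV * rV) := bump r (p.1 - p.2).
have CH k : Ck k setT H.
  apply: (Ck_affine (A := fun p : rV * rV => p.1 - p.2)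
    (B := fun p : rV * rV => p.1 - p.2)) (bump_Ck n r k).
    by move=> h v x; rewrite /= scalerBr opprD addrACA.
  exact: sub_continuous.
have cH := Ck_continuous (CH 0%N).
have b0 := @bump_zero_off R n r (ltW r0).
pose chi x := c^-1 * \int[mu]_z (H (x, z) * g z).
exists (thickening d K), chi; split => //.
- exact: compact_thickening.
- move=> x Kx; exists (x, 0); last by rewrite addr0.
  by split=> //= i; rewrite mxE normr0 ltW.
- split; last first.
    move=> x; rewrite /chi mulr_ge0 ?invr_ge0 ?(ltW c0)//.
    by apply: Rintegral_ge0 => z _; rewrite mulr_ge0// bump_ge0.
  split.
    apply: smoothM; first exact: smooth_cst.
    by move=> k; exact: (param_Ck cK1 g0 ig (CH k)).
  move=> x nK; rewrite /chi (_ : (fun z => H (x, z) * g z) = cst 0).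
    by rewrite Rintegral_cst// mul0r mulr0.
  apply/funext => z /=.
  have [[[k b] [/= Kk bb] <-]|/g0 ->] := pselect (K1 z); last by rewrite mulr0.
  have [yb|/b0 yb] := pselect (rV_box r (x - (k + b))); last by rewrite /H /= yb mul0r.
  exfalso; apply: nK; exists (k, b + (x - (k + b))); last first.
    by rewrite /= addrA addrC subrK.
  split=> //= i; have := yb i; have := bb i; rewrite !mxE => h1 h2.
  by rewrite (le_trans (ler_normD _ _))// (splitr d) lerD.
- move=> x Kx; rewrite /chi.
  have -> : \int[mu]_z (H (x, z) * g z) = \int[mu]_z bump r (x - z).
    apply: eq_Rintegral => z _; rewrite /H /=.
    have [yb|/b0 ->] := pselect (rV_box r (x - z)); last by rewrite mul0r.
    rewrite gE ?mulr1//; exists (x, z - x); last by rewrite /= addrC subrK.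
    by split=> //= i; have := yb i; rewrite !mxE distrC.
  rewrite (@triangular_Rintegral R n (-1) (fun z => x - z) (bump r)).
  - by rewrite mulVf// gt_eqF.
  - by right.
  - apply: continuous_measurable_rVrV => z.
    apply: (@continuous_comp _ _ _ (fun z : rV => - z) (fun z => x + z)).
      exact: opp_continuous.
    exact: continuous_translation.
  - by move=> j y z _; rewrite !mxE; ring.
  - apply: continuous_measurable_rV; exact: Ck_continuous (bump_Ck n r 0).
Qed.

End cutoff.

(** * Horizontal calculus of powers of |u|^2 + t *)

Section regularized_modulus.
Variables (R : realType) (s : seq nat) (G : stratified_group R s).
Local Notation n := (sumn s).
Local Notation N := (head 0%N s).
Local Notation rV := 'rV[R]_n.
Local Notation mu := (lebesgue_rV R n).
Local Notation smooth f := (smooth_on [set: rV] f).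
Local Notation L := (sublaplacian G).
Local Notation gamma := (carre_du_champ G).
Implicit Types f g : rV -> R.

Lemma smooth_gamma f g : smooth f -> smooth g -> smooth (gamma f g).
Proof.
move=> sf sg; rewrite (_ : gamma f g = fun x => \sum_(k < n | (k < N)%N) XD G k f x * XD G k g x).
  by apply: smooth_sum => k _; apply: smoothM; exact: smooth_XD.
by apply/funext => x; exact: carre_du_champE.
Qed.

Lemma sublaplacianD f g x : smooth f -> smooth g ->
  L (fun x => f x + g x) x = L f x + L g x.
Proof.
move=> sf sg; rewrite !sublaplacianE -big_split/=; apply: eq_bigr => k _.
rewrite (_ : XD G k (fun x => f x + g x) = fun x => XD G k f x + XD G k g x).
  by rewrite XDD//; exact: smooth_XD.
by apply/funext => y; rewrite XDD.
Qed.

Lemma sublaplacian_cst (a : R) x : L (fun=> a) x = 0.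
Proof.
rewrite sublaplacianE big1// => k _.
by rewrite (_ : XD G k (fun=> a) = fun=> 0) ?XD_cst//; apply/funext => y; rewrite XD_cst.
Qed.

Lemma sublaplacianM f g x : smooth f -> smooth g ->
  L (fun x => f x * g x) x = f x * L g x + g x * L f x + 2 * gamma f g x.
Proof.
move=> sf sg; rewrite !sublaplacianE !carre_du_champE !mulr_sumr -!big_split/=; apply: eq_bigr => k _.
rewrite (_ : XD G k (fun x => f x * g x) = fun x => f x * XD G k g x + g x * XD G k f x).
  have [sXf sXg] := (smooth_XD G k sf : smooth (XD G k f), smooth_XD G k sg : smooth (XD G k g)).
  rewrite (XDD G k x (smoothM sf sXg) (smoothM sg sXf)) (XDM G k x sf sXg) (XDM G k x sg sXf).
  move: (XD G k (XD G k f) x) (XD G k (XD G k g) x) (XD G k f x) (XD G k g x) (f x) (g x).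
  by move=> *; ring.
by apply/funext => y; rewrite XDM.
Qed.

Lemma sublaplacian_powR f (b : R) x : (forall x, 0 < f x) -> smooth f ->
  L (fun x => f x `^ b) x =
  b * f x `^ (b - 1) * L f x + b * (b - 1) * f x `^ (b - 1 - 1) * gamma f f x.
Proof.
move=> f0 sf; rewrite !sublaplacianE !carre_du_champE !mulr_sumr -!big_split/=; apply: eq_bigr => k _.
rewrite (_ : XD G k (fun x => f x `^ b) = fun x => b * (f x `^ (b - 1) * XD G k f x)); last first.
  by apply/funext => y; rewrite XD_powR// mulrA.
have s1 : smooth (fun x => f x `^ (b - 1)) by exact: smooth_powR.
rewrite XDZ; last by apply: smoothM => //; exact: smooth_XD.
by rewrite XDM ?XD_powR//; [ring|exact: smooth_XD].
Qed.

Variables (K : set rV) (a b : rV -> R).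
Hypotheses (cK : compact K) (ta : test K a) (tb : test K b).
Let clK : closed K := compact_closed (@norm_hausdorff _ _) cK.

(* [|u| ^ 2 + t] for [u = a + i b]. *)
Definition sqmod (t : R) (x : rV) : R := a x * a x + b x * b x + t.

Let sa : smooth a := ta.1.
Let sb : smooth b := tb.1.

Lemma smooth_sqmod t : smooth (sqmod t).
Proof.
by apply: smoothD; [apply: smoothD; exact: smoothM|exact: smooth_cst].
Qed.

Lemma sqmod_ge t x : t <= sqmod t x.
Proof. by rewrite /sqmod lerDr addr_ge0// -expr2 sqr_ge0. Qed.

Lemma sqmod_gt0 t x : 0 < t -> 0 < sqmod t x.
Proof. by move=> t0; exact: lt_le_trans (sqmod_ge t x). Qed.

Lemma sqmod_off t x : ~ K x -> sqmod t x = t.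
Proof. by move=> nK; rewrite /sqmod ta.2// tb.2// !mulr0 !add0r. Qed.

Lemma XD_sqmod k t x : XD G k (sqmod t) x = 2 * (a x * XD G k a x + b x * XD G k b x).
Proof.
rewrite /sqmod XDD; [|by apply: smoothD; exact: smoothM|exact: smooth_cst].
by rewrite XDD ?XDM ?XD_cst; [ring|by []|by []|by []|by []|exact: smoothM|exact: smoothM].
Qed.

Lemma sublaplacian_sqmod t x :
  L (sqmod t) x = 2 * (a x * L a x + b x * L b x) + 2 * (gamma a a x + gamma b b x).
Proof.
rewrite /sqmod sublaplacianD; [|by apply: smoothD; exact: smoothM|exact: smooth_cst].
rewrite (sublaplacianD x (smoothM sa sa) (smoothM sb sb)).
rewrite (sublaplacianM x sa sa) (sublaplacianM x sb sb) sublaplacian_cst.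
move: (L a x) (L b x) (gamma a a x) (gamma b b x) (a x) (b x) => *; ring.
Qed.

(** A regularized form of |grad |u|| <= |grad u|. It rests on the Lagrange identity (A X + B Y)^2 +
    (A Y - B X)^2 = (A^2 + B^2)(X^2 + Y^2). *)
Lemma gamma_sqmod_le t x : 0 < t ->
  gamma (sqmod t) (sqmod t) x <= 4 * sqmod t x * (gamma a a x + gamma b b x).
Proof.
move=> t0; rewrite !carre_du_champE -big_split/= mulr_sumr; apply: ler_sum => k _.
rewrite !XD_sqmod /sqmod.
move: (a x) (b x) (XD G k a x) (XD G k b x) => A B X Y.
have h1 : 0 <= (A * Y - B * X) ^+ 2 by exact: sqr_ge0.
have h2 : 0 <= t * (X * X + Y * Y).
  by rewrite mulr_ge0 ?(ltW t0)// addr_ge0// -expr2 sqr_ge0.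
have -> : 4 * (A * A + B * B + t) * (X * X + Y * Y) =
  2 * (A * X + B * Y) * (2 * (A * X + B * Y)) + 4 * (A * Y - B * X) ^+ 2 +
  4 * (t * (X * X + Y * Y)) by ring.
lra.
Qed.

Lemma gamma_ge0 f x : 0 <= gamma f f x.
Proof. by rewrite carre_du_champE; apply: sumr_ge0 => k _; rewrite -expr2 sqr_ge0. Qed.

Variables (p : R).
Hypothesis p1 : 1 <= p.
Local Notation q := (p / 2).
Let p0 : 0 < p. Proof. exact: lt_le_trans p1. Qed.
Let q0 : 0 < q. Proof. by rewrite divr_gt0. Qed.

Definition phi_reg (t : R) (x : rV) : R := sqmod t x `^ q + - t `^ q.
(** The squared gradient of [phi_reg t] divided by [sqmod t x ^ q], with the division carried out in
    the exponent. *)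
Definition theta_reg (t : R) (x : rV) : R :=
  q ^+ 2 * sqmod t x `^ (q - 1 - 1) * gamma (sqmod t) (sqmod t) x.
Definition normL (x : rV) : R := Num.sqrt (L a x ^+ 2 + L b x ^+ 2).

Lemma smooth_sqmod_powR t (c : R) : 0 < t -> smooth (fun x => sqmod t x `^ c).
Proof.
by move=> t0; apply: smooth_powR; [move=> x; exact: sqmod_gt0|exact: smooth_sqmod].
Qed.

Lemma test_phi_reg t : 0 < t -> test K (phi_reg t).
Proof.
move=> t0; split.
  by apply: smoothD; [exact: smooth_sqmod_powR|exact: smooth_cst].
by move=> x nK; rewrite /phi_reg sqmod_off// subrr.
Qed.

Lemma phi_reg_ge0 t x : 0 < t -> 0 <= phi_reg t x.
Proof.
move=> t0; rewrite subr_ge0 ge0_ler_powR ?(ltW q0)// ?nnegrE ?(ltW t0)//.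
  by rewrite ltW// sqmod_gt0.
exact: sqmod_ge.
Qed.

Lemma XD_phi_reg k t x : 0 < t ->
  XD G k (phi_reg t) x = q * sqmod t x `^ (q - 1) * XD G k (sqmod t) x.
Proof.
move=> t0; rewrite /phi_reg XDD; [|exact: smooth_sqmod_powR|exact: smooth_cst].
rewrite XD_cst addr0 XD_powR//; last exact: smooth_sqmod.
by move=> y; exact: sqmod_gt0.
Qed.

Lemma sqmod_powRS t x (c : R) : 0 < t -> sqmod t x `^ c = sqmod t x * sqmod t x `^ (c - 1).
Proof.
move=> t0; have s0 := sqmod_gt0 x t0.
by rewrite powRB ?(gt_eqF s0) ?implybT// powRr1 ?(ltW s0)// mulrC divfK ?gt_eqF.
Qed.

Lemma gamma_phi_reg t x : 0 < t ->
  gamma (phi_reg t) (phi_reg t) x = sqmod t x `^ q * theta_reg t x.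
Proof.
move=> t0; rewrite /theta_reg !carre_du_champE !mulr_sumr; apply: eq_bigr => k _.
rewrite !XD_phi_reg// (sqmod_powRS x q t0) (sqmod_powRS x (q - 1) t0).
ring.
Qed.

Lemma test_theta_reg t : 0 < t -> test K (theta_reg t).
Proof.
move=> t0; split.
  apply: smoothM; last by apply: smooth_gamma; exact: smooth_sqmod.
  by apply: smoothM; [exact: smooth_cst|exact: smooth_sqmod_powR].
move=> x nK; rewrite /theta_reg carre_du_champE big1 ?mulr0// => k _.
by rewrite XD_sqmod ta.2// tb.2// !mul0r addr0 mulr0 mul0r.
Qed.

Lemma theta_reg_ge0 t x : 0 <= theta_reg t x.
Proof. by rewrite mulr_ge0 ?gamma_ge0// mulr_ge0 ?powR_ge0// sqr_ge0. Qed.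

(** Write S for |u|^2 + t. Expanding L S^q leaves a positive multiple of |grad u|^2, which is at
    least |grad S|^2 / (4 S). The coefficient of S^(q-2) |grad S|^2 becomes q/2 + q (q - 1) = q^2 (p
    - 1) / p because q = p/2. *)
Lemma sublaplacian_phi_reg_ge t x : 0 < t ->
  p * sqmod t x `^ (q - 1) * (a x * L a x + b x * L b x) + (p - 1) / p * theta_reg t x
  <= L (phi_reg t) x.
Proof.
move=> t0; rewrite /phi_reg sublaplacianD; [|exact: smooth_sqmod_powR|exact: smooth_cst].
rewrite sublaplacian_cst addr0 sublaplacian_powR; last 2 first.
- by move=> y; exact: sqmod_gt0.
- exact: smooth_sqmod.
rewrite sublaplacian_sqmod /theta_reg (sqmod_powRS x (q - 1) t0).
have := gamma_sqmod_le x t0; have := sqmod_gt0 x t0.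
have : 0 <= sqmod t x `^ (q - 1 - 1) by exact: powR_ge0.
move: (sqmod t x) (gamma (sqmod t) (sqmod t) x) (gamma a a x + gamma b b x)
  (a x * L a x + b x * L b x) (sqmod t x `^ (q - 1 - 1)) => S g e w y y0 S0 gle.
have h : 0 <= y * (4 * S * e - g) by rewrite mulr_ge0// subr_ge0.
rewrite -subr_ge0.
have -> : q * (S * y) * (2 * w + 2 * e) + q * (q - 1) * y * g -
  (p * (S * y) * w + (p - 1) / p * (q ^+ 2 * y * g)) = p / 4 * (y * (4 * S * e - g)).
  by field; rewrite gt_eqF.
by rewrite mulr_ge0// divr_ge0// ltW.
Qed.

Lemma normL_off x : ~ K x -> normL x = 0.
Proof.
move=> nK; rewrite /normL (test_sublaplacian G clK ta).2// (test_sublaplacian G clK tb).2//.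
by rewrite expr0n addr0 sqrtr0.
Qed.

Lemma continuous_normL : continuous normL.
Proof.
move=> x; apply: (@continuous_comp _ _ _ (fun x => L a x ^+ 2 + L b x ^+ 2) Num.sqrt).
  apply: smooth_continuous; rewrite (_ : (fun x => _) = fun x => L a x * L a x + L b x * L b x).
    by apply: smoothD; apply: smoothM; exact: smooth_sublaplacian.
  by apply/funext => y; congr (_ + _); exact: expr2.
exact: sqrt_continuous.
Qed.

(** Cauchy-Schwarz for the real part of conj(u) L u, followed by |u| <= (|u|^2 + t)^(1/2), which
    raises the exponent q - 1 to q - 1/2. *)
Lemma re_inner_ge t x : 0 < t ->
  - (sqmod t x `^ (q - 2^-1) * normL x) <=
  sqmod t x `^ (q - 1) * (a x * L a x + b x * L b x).
Proof.
move=> t0; have s0 := sqmod_gt0 x t0.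
have -> : sqmod t x `^ (q - 2^-1) = sqmod t x `^ (q - 1) * Num.sqrt (sqmod t x).
  rewrite -powR12_sqrt ?(ltW s0)// -powRD ?(gt_eqF s0) ?implybT//.
  by congr (_ `^ _); lra.
rewrite -mulrA -mulrN ler_wpM2l ?powR_ge0//.
rewrite lerNl; apply: le_trans (ler_norm _) _; rewrite normrN.
rewrite /normL -sqrtrM ?(ltW s0)// -sqrtr_sqr ler_wsqrtr//.
rewrite /sqmod; move: (a x) (b x) (L a x) (L b x) => A B X Y.
have h1 : 0 <= (A * Y - B * X) ^+ 2 by exact: sqr_ge0.
have h2 : 0 <= t * (X ^+ 2 + Y ^+ 2).
  by rewrite mulr_ge0 ?(ltW t0)// addr_ge0// sqr_ge0.
have -> : (A * A + B * B + t) * (X ^+ 2 + Y ^+ 2) =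
  (A * X + B * Y) ^+ 2 + (A * Y - B * X) ^+ 2 + t * (X ^+ 2 + Y ^+ 2) by ring.
lra.
Qed.

(** [A] and [B] stand for minus the integrals of V L phi and V L Phi, [T] for that of V theta, and
    [e * M] for the cost of the cutoff. The Hardy bound gives (sigma - 1)(A - e M) <= T; this lower
    bound for [T] is inserted into the second inequality. *)
Lemma regularized_scalar (sigma A B T J M e : R) : 1 < sigma -> B = A + e * M ->
  A <= 2^-1 * B + (2 * (sigma - 1))^-1 * T ->
  A <= p * J - (p - 1) / p * T ->
  A <= p ^+ 2 / ((p - 1) * sigma + 1) * J +
    e * ((p - 1) * (sigma - 1) / ((p - 1) * sigma + 1) * M).
Proof.
move=> s1 -> h1 h2.
have s10 : 0 < sigma - 1 by rewrite subr_gt0.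
have pm : 0 <= p - 1 by rewrite subr_ge0.
have d0 : 0 < (p - 1) * sigma + 1 by rewrite ltr_wpDl// mulr_ge0//; lra.
have h3 : (sigma - 1) * (A - e * M) <= T.
  have : 2 * (sigma - 1) * (A - (2^-1 * (A + e * M))) <= T.
    by rewrite -ler_pdivlMl ?mulr_gt0// lerBlDl.
  by apply: le_trans; rewrite le_eqVlt; apply/orP; left; apply/eqP; field.
have h4 : (p - 1) / p * ((sigma - 1) * (A - e * M)) <= (p - 1) / p * T.
  by rewrite ler_wpM2l// divr_ge0// ltW.
have h5 : A <= p * J - (p - 1) / p * ((sigma - 1) * (A - e * M)) by lra.
rewrite -subr_ge0.
have -> : p ^+ 2 / ((p - 1) * sigma + 1) * J +
    e * ((p - 1) * (sigma - 1) / ((p - 1) * sigma + 1) * M) - A =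
  p / ((p - 1) * sigma + 1) * (p * J - (p - 1) / p * ((sigma - 1) * (A - e * M)) - A).
  by field; rewrite (gt_eqF p0) (gt_eqF d0).
by rewrite mulr_ge0 ?subr_ge0// divr_ge0// ltW.
Qed.

(* [phi_reg t] is a test function but does not satisfy the gradient bound of [hardy]
   by itself; [Phi = sqmod t `^ q] does, and a cutoff [chi] equal to 1 on [K] turns
   it into the test function [phi_reg t + t `^ q * chi], at the cost of an error
   [t `^ q * M]. *)
Lemma regularized_rellich (Omega : set rV) (V : rV -> R) (sigma : R) :
  open Omega -> K `<=` Omega -> 1 < sigma ->
  (forall x, Omega x -> 0 < V x) -> (forall x, Omega x -> {for x, continuous V}) ->
  L1loc Omega V -> L1loc Omega (fun x => V x `^ sigma) ->
  (forall K psi, compact K -> K `<=` Omega -> test K psi -> (forall x, 0 <= psi x) ->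
    \int[mu]_x (V x `^ sigma * L psi x) <= 0) ->
  exists M : R, forall t : R, 0 < t ->
    - (\int[mu]_x (V x * L (phi_reg t) x)) <=
    p ^+ 2 / ((p - 1) * sigma + 1) *
      \int[mu]_x (V x * (sqmod t x `^ (q - 2^-1) * normL x)) + t `^ q * M.
Proof.
move=> oO KO s1 V0 cV VL WL superW.
have [K' [chi [cK' KK' K'O [tchi chi0] chi1]]] := cutoff oO cK KO.
have clK' : closed K' by exact: compact_closed.
exists ((p - 1) * (sigma - 1) / ((p - 1) * sigma + 1) * (- (\int[mu]_x (V x * L chi x)))).
move=> t t0; have tphi := test_phi_reg t0; have tth := test_theta_reg t0.
have zK f : zero_off K f -> zero_off K' f by move=> f0 x nK'; apply: f0 => /KK'.
have tphi' : test K' (phi_reg t) by split; [exact: tphi.1|exact: zK tphi.2].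
have scK : smooth (fun x => t `^ q * chi x).
  by apply: smoothM; [exact: smooth_cst|exact: tchi.1].
have tchi' : test K' (fun x => t `^ q * chi x) by apply: testMr => //; exact: smooth_cst.
pose Phi x := phi_reg t x + t `^ q * chi x.
have tPhi : test K' Phi by exact: testD.
have Phi0 x : 0 <= Phi x by rewrite addr_ge0 ?phi_reg_ge0// mulr_ge0// powR_ge0.
have hg x : gamma (phi_reg t) (phi_reg t) x <= Phi x * theta_reg t x.
  rewrite gamma_phi_reg//; have [Kx|nK] := pselect (K x); last by rewrite tth.2// !mulr0.
  by rewrite ler_wpM2r ?theta_reg_ge0// /Phi /phi_reg chi1// mulr1 subrK.
have H := hardy oO cK' K'O s1 V0 cV VL WL superW tphi' tPhi Phi0
  (smooth_continuous tth.1) (zK _ tth.2) (theta_reg_ge0 t) hg.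
have iV psi : test K' psi -> mu.-integrable setT (EFin \o (fun x => V x * psi x)).
  by move=> [spsi psi0]; apply: (L1loc_integrableM VL cK' K'O) => //; exact: smooth_continuous.
have iphi := iV _ (test_sublaplacian G clK' tphi').
have ichi := iV _ (test_sublaplacian G clK' tchi).
have PhiE : - (\int[mu]_x (V x * L Phi x)) =
    - (\int[mu]_x (V x * L (phi_reg t) x)) + t `^ q * (- (\int[mu]_x (V x * L chi x))).
  rewrite mulrN -opprD -(RintegralZl (t `^ q) measurableT ichi); congr (- _).
  have ichi' : mu.-integrable setT (EFin \o (fun x => t `^ q * (V x * L chi x))).
    by have := integrableZl measurableT (t `^ q) ichi; apply: eq_integrable.
  apply: (etrans _ (RintegralD measurableT iphi ichi')).
  apply: eq_Rintegral => x _.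
  rewrite /Phi sublaplacianD//; [|exact: tphi.1].
  rewrite sublaplacianM; [|exact: smooth_cst|exact: tchi.1].
  rewrite sublaplacian_cst carre_du_champE big1 => [|k _]; last by rewrite XD_cst mul0r.
  move: (V x) (L (phi_reg t) x) (L chi x) (t `^ q) (chi x) => *; ring.
apply: (regularized_scalar s1 PhiE H).
have ith := iV _ (conj tth.1 (zK _ tth.2)).
pose psi x := sqmod t x `^ (q - 2^-1) * normL x.
have iJ : mu.-integrable setT (EFin \o (fun x => V x * psi x)).
  apply: (L1loc_integrableM VL cK KO).
    by apply: continuousM_fun continuous_normL; exact: smooth_continuous (smooth_sqmod_powR _ t0).
  by move=> x nK; rewrite /psi normL_off// mulr0.
have i1 : mu.-integrable setT (EFin \o (fun x => p * (V x * psi x))).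
  by have := integrableZl measurableT p iJ; apply: eq_integrable.
have i2 : mu.-integrable setT (EFin \o (fun x => (p - 1) / p * (V x * theta_reg t x))).
  by have := integrableZl measurableT ((p - 1) / p) ith; apply: eq_integrable.
have i3 : mu.-integrable setT (EFin \o (fun x => (-1) * (V x * L (phi_reg t) x))).
  by have := integrableZl measurableT (-1) iphi; apply: eq_integrable.
have i12 : mu.-integrable setT (EFin \o
    (fun x => p * (V x * psi x) - (p - 1) / p * (V x * theta_reg t x))).
  by have := integrableB measurableT i1 i2; apply: eq_integrable.
have e1 := RintegralZl p measurableT iJ.
have e2 := RintegralZl ((p - 1) / p) measurableT ith.
have e3 := RintegralZl (-1) measurableT iphi.
have e12 := RintegralB measurableT i1 i2.
have transport (X Y Z I1 I2 P Q : R) : Z = -1 * X -> Y = I1 - I2 -> I1 = P -> I2 = Q ->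
    Z <= Y -> - X <= P - Q by move=> -> -> -> ->; rewrite mulN1r.
apply: (transport _ _ _ _ _ _ _ e3 e12 e1 e2).
(* The comparison is pointwise: on [K] it is the lower bound for L phi multiplied by V > 0, and off
   [K] every term vanishes. *)
apply: le_Rintegral => // x _.
have [Kx|nK] := pselect (K x); last first.
  rewrite /psi normL_off// tth.2// !mulr0 subr0.
  by rewrite (test_sublaplacian G clK tphi).2// !mulr0.
have Vx := V0 _ (KO _ Kx).
have -> : p * (V x * psi x) - (p - 1) / p * (V x * theta_reg t x) =
  V x * (p * psi x - (p - 1) / p * theta_reg t x) by ring.
rewrite mulN1r -mulrN ler_pM2l// lerNl.
apply: le_trans (sublaplacian_phi_reg_ge x t0).
rewrite -[X in _ <= X + _]mulrA opprB [X in X <= _]addrC lerD2r -mulrN ler_pM2l//.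
exact: re_inner_ge.
Qed.

End regularized_modulus.

(** [g] is replaced by the maximum of [f] and [g], which equals [g] almost everywhere and dominates
    [f] everywhere. *)
Lemma le_Rintegral_ae d (T : measurableType d) (R : realType)
    (mu : {measure set T -> \bar R}) (f g : T -> R) :
  mu.-integrable setT (EFin \o f) -> mu.-integrable setT (EFin \o g) ->
  {ae mu, forall x, f x <= g x} -> \int[mu]_x f x <= \int[mu]_x g x.
Proof.
move=> i_f ig fg; pose h x := Num.max (f x) (g x).
have mf : measurable_fun setT f by apply/measurable_EFinP; case/integrableP: i_f.
have mg : measurable_fun setT g by apply/measurable_EFinP; case/integrableP: ig.
have mh : measurable_fun setT h by exact: measurable_maxr.
have ih : mu.-integrable setT (EFin \o h).
  have iN := integrableD measurableT (integrable_norm i_f) (integrable_norm ig).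
  apply: le_integrable iN => //; first exact/measurable_EFinP.
  move=> x _; have hx : `|h x| <= `|f x| + `|g x|.
    by rewrite /h maxEle; case: ifP => _; rewrite ?lerDl ?lerDr.
  by rewrite lee_fin (le_trans hx)// ler_norm.
have -> : \int[mu]_x g x = \int[mu]_x h x.
  congr fine; apply: ae_eq_integral => //; [exact/measurable_EFinP|exact/measurable_EFinP|].
  by apply: filterS fg => x fgx _; rewrite /h max_r.
by apply: le_Rintegral => // x _; rewrite /h le_max lexx.
Qed.

(** * Young's inequality and passage to L^p norms *)

Section rellich.
Variable R : realType.

(** Young's inequality with exponents p/(p-1) and p, after inserting l^r l^(-r) = 1 for r = (p-1)/p.
    The first factor becomes l S^(p/2), and the second carries the weight of the right-hand norm.
    The constant [C] sits in the second factor, so it comes out as C^p. *)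
Lemma young_pointwise (p l V U S C : R) : 1 <= p -> 0 < l -> 0 <= V -> 0 <= U -> 0 < S ->
  0 <= C ->
  C * (V * (S `^ (p / 2 - 2^-1) * U)) <=
  (1 - p^-1) * (l * S `^ (p / 2)) +
  p^-1 * (C `^ p * (V * l `^ (- ((p - 1) / p)) * U) `^ p).
Proof.
move=> p1 l0 V0 U0 S0 C0; have p0 : 0 < p by exact: lt_le_trans p1.
have pn0 : p != 0 by rewrite gt_eqF.
(* At p = 1 the conjugate exponent p/(p-1) is a division by zero; there the coefficient 1 - 1/p is 0
   and both sides coincide. *)
have [->|pN1] := eqVneq p 1.
  rewrite invr1 !mul1r !subrr !mul0r oppr0 !powRr0 mulr1 add0r mul1r.
  by rewrite !powRr1// mulr_ge0.
have {}p1 : 1 < p by rewrite lt_neqAle eq_sym pN1.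
have pm : 0 < p - 1 by rewrite subr_gt0.
pose r := (p - 1) / p.
have conj : (p / (p - 1))^-1 + p^-1 = 1 by field; rewrite (gt_eqF p0) (gt_eqF pm).
have := @conjugate_powR R (l `^ r * S `^ (p / 2 - 2^-1)) (C * (V * l `^ (- r) * U))
  (p / (p - 1)) p.
rewrite mulr_ge0 ?powR_ge0// !mulr_ge0 ?powR_ge0// divr_gt0// p0.
move=> /(_ isT isT isT isT conj).
have -> : l `^ r * S `^ (p / 2 - 2^-1) * (C * (V * l `^ (- r) * U)) =
    C * (V * (S `^ (p / 2 - 2^-1) * U)).
  have lr : l `^ r * l `^ (- r) = 1.
    by rewrite powRN divff// gt_eqF// powR_gt0.
  by rewrite -[RHS]mul1r -lr; move: (l `^ r) (l `^ (- r)) (S `^ _) => x y z; ring.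
rewrite powRM ?powR_ge0// -!powRrM.
have -> : r * (p / (p - 1)) = 1 by rewrite /r; field; rewrite (gt_eqF p0) (gt_eqF pm).
have -> : (p / 2 - 2^-1) * (p / (p - 1)) = p / 2 by field; rewrite (gt_eqF pm).
rewrite powRr1 ?(ltW l0)// powRM ?mulr_ge0 ?powR_ge0//.
have -> : (p / (p - 1))^-1 = 1 - p^-1 by field; rewrite (gt_eqF p0) (gt_eqF pm).
by move=> h; apply: le_trans h _; rewrite [X in X + _]mulrC [X in _ + X]mulrC.
Qed.

(** [Y] returns on the right with weight 1 - 1/p; absorbing it leaves [Y] / p, and multiplication by
    p restores the exact constant [Cp]. *)
Lemma rellich_scalar (p A J Y X Lam M e C Cp : R) : 1 <= p ->
  A = Y - e * Lam -> A <= C * J + e * M -> C * J <= (1 - p^-1) * Y + p^-1 * (Cp * X) ->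
  Y <= Cp * X + e * (p * (M + Lam)).
Proof.
move=> p1 -> h1 h2; have p0 : 0 < p by exact: lt_le_trans p1.
have h3 : Y - e * Lam <= (1 - p^-1) * Y + p^-1 * (Cp * X) + e * M by lra.
have h4 : 0 <= p * ((1 - p^-1) * Y + p^-1 * (Cp * X) + e * M - (Y - e * Lam)).
  by rewrite mulr_ge0 ?(ltW p0)// subr_ge0.
rewrite -subr_ge0; apply: le_trans h4 _; rewrite le_eqVlt; apply/orP; left; apply/eqP.
by field; rewrite gt_eqF.
Qed.

Lemma Lp_norm_restrict n (Omega : set 'rV[R]_n) (p : R) (F : 'rV[R]_n -> R[i])
    (h : 'rV[R]_n -> R) :
  (forall x, 0 <= h x) -> (forall x, Omega x -> ComplexField.Normc.normc (F x) = h x) ->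
  zero_off Omega h ->
  Lp_norm Omega p F = ((\int[lebesgue_rV R n]_x (h x `^ p)%:E) `^ p^-1)%E.
Proof.
move=> h0 Fh hO; rewrite /Lp_norm unlock; congr (_ `^ _)%E.
apply: eq_integral => x _; rewrite patchE; case: ifPn => [/set_mem Ox|].
  by rewrite Fh//= ger0_norm// .
by rewrite notin_setE => nO; rewrite /= normr0 hO.
Qed.

Lemma normc_real_mul (r : R) (z : R[i]) :
  ComplexField.Normc.normc (r%:C%C * z) =
  `|r| * Num.sqrt (complex.Re z ^+ 2 + complex.Im z ^+ 2).
Proof.
rewrite ComplexField.Normc.normcM; congr (_ * _); last by case: z.
by rewrite /= expr0n addr0 sqrtr_sqr.
Qed.

Lemma le_poweR_root (X1 X2 : \bar R) (p C : R) : 1 <= p -> 0 <= C ->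
  (0 <= X1)%E -> (0 <= X2)%E -> (X1 <= (C `^ p)%:E * X2)%E ->
  (X1 `^ p^-1 <= C%:E * X2 `^ p^-1)%E.
Proof.
move=> p1 C0 X10 X20 h; have p0 : 0 < p by exact: lt_le_trans p1.
have CX0 : (0 <= (C `^ p)%:E * X2)%E by rewrite mule_ge0// lee_fin powR_ge0.
have -> : (C%:E * X2 `^ p^-1 = ((C `^ p)%:E * X2) `^ p^-1)%E.
  rewrite poweRM// ?lee_fin ?powR_ge0//.
  by rewrite poweR_EFin -powRrM divff ?gt_eqF// powRr1.
by apply: gt0_ler_poweR h; rewrite ?invr_ge0 ?(ltW p0)// in_itv/= leey andbT.
Qed.

End rellich.

(** * Removal of the regularization *)

Section limit.
Variables (R : realType) (s : seq nat) (G : stratified_group R s).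
Local Notation n := (sumn s).
Local Notation rV := 'rV[R]_n.
Local Notation mu := (lebesgue_rV R n).
Variables (K : set rV) (a b : rV -> R) (p : R) (W l : rV -> R).
Hypotheses (cK : compact K) (ta : test K a) (tb : test K b) (p1 : 1 <= p).
Hypotheses (mW : measurable_fun setT W) (W0 : forall x, 0 <= W x).
Hypotheses (il : mu.-integrable setT (EFin \o l)) (l0 : forall x, 0 <= l x).
Hypothesis lgt0 : {ae mu, forall x, K x -> 0 < l x}.
Hypothesis lK : zero_off K l.
Let p0 : 0 < p. Proof. exact: lt_le_trans p1. Qed.

Definition weighted_mod (x : rV) : R :=
  l x `^ p^-1 * Num.sqrt (a x ^+ 2 + b x ^+ 2).
Definition weighted_normL (x : rV) : R :=
  W x * l x `^ (- ((p - 1) / p)) * normL G a b x.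

Let ml : measurable_fun setT l.
Proof. by apply/measurable_EFinP; case/integrableP: il. Qed.

Let continuous_sqmod_powR t c : 0 < t -> continuous (fun x => sqmod a b t x `^ c).
Proof. by move=> t0; exact: smooth_continuous (smooth_sqmod_powR ta tb c t0). Qed.

Lemma measurable_weighted_mod : measurable_fun setT weighted_mod.
Proof.
apply: measurable_funM; first exact: (measurableT_comp (measurable_powR _)).
apply: continuous_measurable_rV => x.
apply: (@continuous_comp _ _ _ (fun x => a x ^+ 2 + b x ^+ 2) Num.sqrt).
  apply: smooth_continuous.
  by apply: smoothD; apply: (smoothM ta.1 ta.1) || apply: (smoothM tb.1 tb.1).
exact: sqrt_continuous.
Qed.

Lemma measurable_weighted_normL : measurable_fun setT weighted_normL.
Proof.
apply: measurable_funM; last first.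
  by apply: continuous_measurable_rV; exact: (continuous_normL ta tb).
apply: measurable_funM => //; exact: (measurableT_comp (measurable_powR _)).
Qed.

Lemma weighted_mod_le t x : 0 < t -> weighted_mod x `^ p <= l x * sqmod a b t x `^ (p / 2).
Proof.
move=> t0; rewrite /weighted_mod powRM ?powR_ge0 ?sqrtr_ge0// -powRrM mulVf ?gt_eqF//.
rewrite powRr1// ler_wpM2l// -powR12_sqrt ?addr_ge0 ?sqr_ge0// -powRrM mulrC.
have h : 0 <= a x ^+ 2 + b x ^+ 2 by rewrite addr_ge0 ?sqr_ge0.
rewrite ge0_ler_powR ?nnegrE ?(ltW (sqmod_gt0 _ _ x t0)) ?divr_ge0 ?(ltW p0)//.
by rewrite /sqmod !expr2 lerDl ltW.
Qed.

Lemma integrable_sqmod t : 0 < t ->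
  mu.-integrable setT (EFin \o (fun x => l x * sqmod a b t x `^ (p / 2))).
Proof.
move=> t0.
have := integrableM_continuous (continuous_sqmod_powR (c := p / 2) t0) cK lK il.
by apply: eq_integrable => // x _ /=; rewrite mulrC.
Qed.

(** An infinite right side is trivial. Otherwise |u|^2 <= |u|^2 + t bounds the left side by the
    regularized integral [Y] for every t, and the remaining error is [t ^ (p / 2)] times a constant
    independent of t. *)
Lemma rellich_limit (C M : R) : 0 < C ->
  (forall t, 0 < t -> mu.-integrable setT
     (EFin \o (fun x => W x * (sqmod a b t x `^ (p / 2 - 2^-1) * normL G a b x)))) ->
  (forall t, 0 < t -> \int[mu]_x (l x * phi_reg a b p t x) <=
    C * \int[mu]_x (W x * (sqmod a b t x `^ (p / 2 - 2^-1) * normL G a b x)) +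
    t `^ (p / 2) * M) ->
  (\int[mu]_x (weighted_mod x `^ p)%:E <=
   (C `^ p)%:E * \int[mu]_x (weighted_normL x `^ p)%:E)%E.
Proof.
move=> C0 iJ H; set X2 := (\int[mu]_x (weighted_normL x `^ p)%:E)%E.
have X20 : (0 <= X2)%E by apply: integral_ge0 => x _; rewrite lee_fin powR_ge0.
have [X2oo|X2fin] := eqVneq X2 +oo%E.
  by rewrite X2oo gt0_muley ?leey// lte_fin powR_gt0.
have mX2 : measurable_fun setT (fun x => weighted_normL x `^ p).
  exact: (measurableT_comp (measurable_powR _) measurable_weighted_normL).
have iX2 : mu.-integrable setT (EFin \o (fun x => weighted_normL x `^ p)).
  apply/integrableP; split; first exact/measurable_EFinP.
  rewrite (eq_integral (fun x => (weighted_normL x `^ p)%:E)) ?ltey// => x _.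
  by rewrite /= ger0_norm ?powR_ge0.
pose x2 := \int[mu]_x (weighted_normL x `^ p).
have X2E : X2 = x2%:E by rewrite /x2 /Rintegral fineK// ge0_fin_numE// ltey.
rewrite X2E -EFinM; apply/lee_addgt0Pr => e e0.
pose Lam := \int[mu]_x l x.
(* [B] is the coefficient of the error; [t] is chosen so that [t ^ (p / 2)] is e / (|B| + 1), which
   makes the error at most [e]. *)
pose B := p * (M + Lam); pose e' := e / (`|B| + 1).
have B1 : 0 < `|B| + 1 by rewrite ltr_wpDl.
have e'0 : 0 < e' by rewrite divr_gt0.
pose t := e' `^ (2 / p); have t0 : 0 < t by exact: powR_gt0.
have tE : t `^ (p / 2) = e'.
  rewrite -powRrM (_ : 2 / p * (p / 2) = 1) ?powRr1 ?(ltW e'0)//.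
  by field; rewrite gt_eqF.
have iY := integrable_sqmod t0; pose Y := \int[mu]_x (l x * sqmod a b t x `^ (p / 2)).
have YE : \int[mu]_x (l x * phi_reg a b p t x) = Y - e' * Lam.
  have il' : mu.-integrable setT (EFin \o (fun x => e' * l x)).
    by have := integrableZl measurableT e' il; apply: eq_integrable.
  rewrite -(RintegralZl e' measurableT il).
  apply: (etrans _ (RintegralB measurableT iY il')).
  by apply: eq_Rintegral => x _; rewrite /phi_reg tE mulrDr mulrN [e' * _]mulrC.
have YX : Y <= C `^ p * x2 + e' * B.
  have := H t t0; rewrite tE; set J := \int[mu]_x _ => HJ.
  apply: (rellich_scalar p1 YE HJ).
  have i1 : mu.-integrable setT (EFin \o (fun x =>
      C * (W x * (sqmod a b t x `^ (p / 2 - 2^-1) * normL G a b x)))).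
    by have := integrableZl measurableT C (iJ t t0); apply: eq_integrable.
  have i2 : mu.-integrable setT (EFin \o (fun x =>
      (1 - p^-1) * (l x * sqmod a b t x `^ (p / 2)))).
    by have := integrableZl measurableT (1 - p^-1) iY; apply: eq_integrable.
  have i3' : mu.-integrable setT (EFin \o (fun x => C `^ p * weighted_normL x `^ p)).
    by have := integrableZl measurableT (C `^ p) iX2; apply: eq_integrable.
  have i3 : mu.-integrable setT (EFin \o (fun x =>
      p^-1 * (C `^ p * weighted_normL x `^ p))).
    by have := integrableZl measurableT p^-1 i3'; apply: eq_integrable.
  have i23 : mu.-integrable setT (EFin \o (fun x =>
      (1 - p^-1) * (l x * sqmod a b t x `^ (p / 2)) +
      p^-1 * (C `^ p * weighted_normL x `^ p))).
    by have := integrableD measurableT i2 i3; apply: eq_integrable.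
  have e1 := RintegralZl C measurableT (iJ t t0).
  have e2 := RintegralZl (1 - p^-1) measurableT iY.
  have e3 := RintegralZl p^-1 measurableT i3'.
  have e3' := RintegralZl (C `^ p) measurableT iX2.
  have e23 := RintegralD measurableT i2 i3.
  have transport (z z1 z2 z3 z4 w1 w2 w3 w4 : R) : z1 = w1 -> z = z2 + z3 -> z2 = w2 ->
      z3 = p^-1 * w3 -> w3 = w4 -> z1 <= z -> w1 <= w2 + p^-1 * w4.
    by move=> -> -> -> -> ->.
  apply: (transport _ _ _ _ 0 _ _ _ _ e1 e23 e2 e3 e3').
  apply: le_Rintegral_ae => //.
  apply: filterS lgt0 => x lx; have [Kx|nK] := pselect (K x); last first.
    rewrite (normL_off G cK ta tb nK) lK// !mulr0 !mul0r mulr0 add0r.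
    by rewrite !mulr_ge0 ?invr_ge0 ?powR_ge0 ?(ltW p0).
  rewrite young_pointwise ?(ltW C0) ?lx// ?sqmod_gt0//.
  exact: sqrtr_ge0.
apply: (@le_trans _ _ Y%:E).
  have -> : Y%:E = (\int[mu]_x (l x * sqmod a b t x `^ (p / 2))%:E)%E.
    by rewrite /Y /Rintegral fineK// integrable_fin_num.
  have mX1 : measurable_fun setT (EFin \o (fun x => weighted_mod x `^ p)).
    apply/measurable_EFinP.
    exact: (measurableT_comp (measurable_powR _) measurable_weighted_mod).
  apply: ge0_le_integral => //.
  - by move=> x _; rewrite lee_fin powR_ge0.
  - by case/integrableP: iY.
  - by move=> x _; rewrite lee_fin weighted_mod_le.
rewrite -EFinD lee_fin (le_trans YX)// lerD2l.
rewrite /e' mulrAC ler_pdivrMr// ler_wpM2l ?(ltW e0)//.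
by rewrite (le_trans (ler_norm _))// lerDl.
Qed.

End limit.

(** At least one horizontal field exists, so the hypotheses quantified over such fields carry
    information. *)
Lemma first_layer_index (s : seq nat) :
  s != [::] /\ {in s, forall d, (0 < d)%N} ->
  exists k : 'I_(sumn s), (k < head 0 s)%N.
Proof.
case: s => [[]//|N s] [_ /(_ N (mem_head _ _)) N0].
have h : (0 < sumn (N :: s))%N by rewrite /= ltn_addr.
by exists (Ordinal h).
Qed.

Theorem theorem3p3 (R : realType) (s : seq nat) (G : stratified_group R s)
    (Omega : set 'rV[R]_(sumn s)) (V LV LVsigma : 'rV[R]_(sumn s) -> R)
    (sigma : R) :
  admissible_domain Omega ->
  (forall x, Omega x -> 0 < V x) ->
  {within Omega, continuous V} ->
  W21loc Omega V ->
  weak_sublaplacian G Omega V LV ->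
  {ae lebesgue_rV R (sumn s), forall x, Omega x -> LV x < 0} ->
  1 < sigma ->
  weak_sublaplacian G Omega (fun x => V x `^ sigma) LVsigma ->
  {ae lebesgue_rV R (sumn s), forall x, Omega x -> LVsigma x <= 0} ->
  forall (u : 'rV[R]_(sumn s) -> R[i]) (p : R),
    Cc_infty_complex Omega u -> 1 <= p ->
    (Lp_norm Omega p (fun x => (`|LV x| `^ (1 / p))%:C%C * u x)%R <=
     (p ^+ 2 / ((p - 1) * sigma + 1))%:E *
     Lp_norm Omega p
       (fun x => (V x / `|LV x| `^ ((p - 1) / p))%:C%C *
                 csublaplacian G u x)%R)%E.
Proof.
move=> [oO _ _ _] V0 cV _ wV LV0 s1 wVs LVs0 u p [su sv cK KO] p1.
have p0 : 0 < p by exact: lt_le_trans p1.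
set K := closure [set x | u x != 0] in cK KO.
have clK : closed K by exact: closed_closure.
pose a x := complex.Re (u x); pose b x := complex.Im (u x).
have u0 x : ~ K x -> u x = 0.
  by move=> nK; apply/eqP/negPn/negP => ux; apply: nK; exact: subset_closure.
have ta : test K a by split=> // x /u0 ux; rewrite /a ux.
have tb : test K b by split=> // x /u0 ux; rewrite /b ux.
have cV' x : Omega x -> {for x, continuous V}.
  by move=> Ox; move: cV; rewrite continuous_open_subspace// => /(_ x); apply; exact: mem_set.
have [k0 k0N] := first_layer_index (sg_layers G).
(* Local integrability of the function itself is recorded inside the data of each horizontal field,
   so it is extracted from the field of index [k0]. *)
have loc f h : weak_sublaplacian G Omega f h -> L1loc Omega f.
  by move=> [_ [Xf [XXf [/(_ k0 k0N)[[_ [D [/(_ k0)[fL _ _] _]]] _] _]]]].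
have VL := loc _ _ wV; have VsL := loc _ _ wVs; have LVL := wV.1.
have superW K' psi : compact K' -> K' `<=` Omega -> test K' psi -> (forall x, 0 <= psi x) ->
    \int[lebesgue_rV R (sumn s)]_x (V x `^ sigma * sublaplacian G psi x) <= 0.
  move=> cK' K'O tpsi psi0; rewrite (weak_sublaplacian_test wVs cK' K'O tpsi).
  have i1 := L1loc_integrableM wVs.1 cK' K'O (smooth_continuous tpsi.1) tpsi.2.
  have i0 : (lebesgue_rV R (sumn s)).-integrable setT (EFin \o cst 0).
    by have := integrable0 (lebesgue_rV R (sumn s)) setT; apply: eq_integrable.
  have e0 : \int[lebesgue_rV R (sumn s)]_x cst 0 x = 0.
    by rewrite /Rintegral integral0_eq.
  rewrite -e0; apply: le_Rintegral_ae => //.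
  apply: filterS LVs0 => x LVx; have [K'x|nK'] := pselect (K' x).
    by rewrite mulr_le0_ge0// LVx//; exact: K'O.
  by rewrite tpsi.2// mulr0.
have [M HM] := regularized_rellich cK ta tb p1 oO KO s1 V0 cV' VL VsL superW.
(* Both weights are set to 0 off [K]. They thereby become measurable on the whole space, and [l]
   integrable, while the integrals are unchanged because the functions built from [u] vanish
   there. *)
pose W := V \_ K; pose l x := `|(LV \_ K) x|.
have iLV := L1loc_integrable_restrict LVL cK KO.
have iV := L1loc_integrable_restrict VL cK KO.
have il : (lebesgue_rV R (sumn s)).-integrable setT (EFin \o l).
  exact: integrable_norm iLV.
have mW : measurable_fun setT W by apply/measurable_EFinP; case/integrableP: iV.
have W0 x : 0 <= W x.
  by rewrite /W patchE; case: ifPn => // /set_mem Kx; rewrite ltW// V0//; exact: KO.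
have lgt0 : {ae lebesgue_rV R (sumn s), forall x, K x -> 0 < l x}.
  apply: filterS LV0 => x LVx Kx.
  by rewrite /l patchE mem_set// normr_gt0 lt_eqF// LVx//; exact: KO.
have lK : zero_off K l.
  by move=> x nK; rewrite /l patchE memNset// normr0.
have d0 : 0 < (p - 1) * sigma + 1.
  by rewrite ltr_wpDl// mulr_ge0 ?subr_ge0// ltW// (lt_trans ltr01).
pose C := p ^+ 2 / ((p - 1) * sigma + 1).
have C0 : 0 < C by rewrite divr_gt0// exprn_gt0.
have JE t : (fun x => V x * (sqmod a b t x `^ (p / 2 - 2^-1) * normL G a b x)) =
    (fun x => W x * (sqmod a b t x `^ (p / 2 - 2^-1) * normL G a b x)).
  apply/funext => x; rewrite /W patchE; case: ifPn => //.
  by rewrite notin_setE => nK; rewrite (normL_off G cK ta tb nK) !mulr0.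
have iJ t : 0 < t -> (lebesgue_rV R (sumn s)).-integrable setT
    (EFin \o (fun x => W x * (sqmod a b t x `^ (p / 2 - 2^-1) * normL G a b x))).
  move=> t0; rewrite -JE; apply: (L1loc_integrableM VL cK KO).
    apply: continuousM_fun; last exact: continuous_normL ta tb.
    exact: smooth_continuous (smooth_sqmod_powR ta tb _ t0).
  by move=> x nK; rewrite (normL_off G cK ta tb nK) mulr0.
have H t : 0 < t -> \int[lebesgue_rV R (sumn s)]_x (l x * phi_reg a b p t x) <=
    C * \int[lebesgue_rV R (sumn s)]_x
      (W x * (sqmod a b t x `^ (p / 2 - 2^-1) * normL G a b x)) + t `^ (p / 2) * M.
  move=> t0; have tphi := test_phi_reg ta tb p t0.
  rewrite -JE; apply: le_trans (HM t t0).
  have i1 := L1loc_integrableM LVL cK KO (smooth_continuous tphi.1) tphi.2.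
  have e1 := RintegralZl (-1) measurableT i1.
  have i2 : (lebesgue_rV R (sumn s)).-integrable setT
      (EFin \o (fun x => -1 * (LV x * phi_reg a b p t x))).
    by have := integrableZl measurableT (-1) i1; apply: eq_integrable.
  have i3 : (lebesgue_rV R (sumn s)).-integrable setT
      (EFin \o (fun x => l x * phi_reg a b p t x)).
    have := integrableM_continuous (smooth_continuous tphi.1) cK lK il.
    by apply: eq_integrable => // x _ /=; rewrite mulrC.
  (* Testing the equation of V against [phi_reg] moves L onto V, and -LV = |LV| almost everywhere on
     [Omega]. *)
  rewrite (weak_sublaplacian_test wV cK KO tphi) -mulN1r.
  rewrite -[X in _ <= X]e1.
  apply: le_Rintegral_ae => //.
  apply: filterS LV0 => x LVx; have [Kx|nK] := pselect (K x); last first.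
    by rewrite tphi.2// !mulr0.
  rewrite /l patchE mem_set// ltr0_norm ?mulN1r ?mulNr//.
  by apply: LVx; exact: KO.
have l0 x : 0 <= l x by exact: normr_ge0.
have main := rellich_limit cK ta tb p1 mW W0 il l0 lgt0 lK C0 iJ H.
have KE x : Omega x -> K x -> W x = V x /\ l x = `|LV x|.
  by move=> _ Kx; rewrite /W /l !patchE mem_set.
rewrite (@Lp_norm_restrict _ _ _ _ _ (weighted_mod a b p l)); first last.
- move=> x nO; have nK : ~ K x by move=> /KO.
  by rewrite /weighted_mod ta.2// tb.2// expr0n addr0 sqrtr0 mulr0.
- move=> x Ox; rewrite normc_real_mul ger0_norm ?powR_ge0// /weighted_mod div1r.
  have [Kx|nK] := pselect (K x); first by rewrite (KE x Ox Kx).2.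
  by rewrite /a /b u0//= expr0n addr0 sqrtr0 !mulr0.
- by move=> x; rewrite mulr_ge0 ?powR_ge0// sqrtr_ge0.
rewrite (@Lp_norm_restrict _ _ _ _ _ (weighted_normL G a b p W l)); first last.
- move=> x nO; have nK : ~ K x by move=> /KO.
  by rewrite /weighted_normL (normL_off G cK ta tb nK) mulr0.
- move=> x Ox; rewrite normc_real_mul /weighted_normL powRN.
  have [Kx|nK] := pselect (K x).
    have [-> ->] := KE x Ox Kx; rewrite ger0_norm// divr_ge0 ?powR_ge0// ltW// V0//.
  by rewrite (normL_off G cK ta tb nK) mulr0 [X in _ * X](normL_off G cK ta tb nK) mulr0.
- by move=> x; rewrite mulr_ge0 ?sqrtr_ge0// mulr_ge0 ?powR_ge0.
(* Both norms are now p-th roots of integrals over the whole space, so the inequality with C^p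
   yields the claim. *)
apply: le_poweR_root => //; first exact: ltW.
- by apply: integral_ge0 => x _; rewrite lee_fin powR_ge0.
- by apply: integral_ge0 => x _; rewrite lee_fin powR_ge0.
Qed.
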